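(* Let $q>n$. Then every bounded domain $\Omega\subset\mathbb{R}^n$ that is a $(W^{1,\infty},W^{1,q})$-extension domain is also an $(L^{1,\infty},L^{1,q})$-extension domain.
   Context: A domain is a nonempty connected open set. For a domain $\Omega\subset\mathbb{R}^n$ and $1\leq p\leq\infty$, the homogeneous Sobolev space $L^{1,p}(\Omega)$ consists of all $u\in L^1_{\rm loc}(\Omega)$ whose distributional gradient $\nabla u$ belongs to $L^p(\Omega;\mathbb{R}^n)$, with semi-norm $\|u\|_{L^{1,p}(\Omega)}=\|\nabla u\|_{L^p(\Omega)}$. The Sobolev space $W^{1,p}(\Omega)$ consists of all $u\in L^{1,p}(\Omega)$ that also belong to $L^p(\Omega)$, with norm $\|u\|_{W^{1,p}(\Omega)}=\left(\int_\Omega |u|^p+|\nabla u|^p\,dx\right)^{1/p}$ for $p<\infty$ and $\|u\|_{W^{1,\infty}(\Omega)}=\operatorname{ess\,sup}_\Omega(|u|+|\nabla u|)$. For (semi-)normed function spaces $\mathcal{X}(\Omega)$ on $\Omega$ and $\mathcal{Y}(\mathbb{R}^n)$ on $\mathbb{R}^n$, $\Omega$ is an $(\mathcal{X},\mathcal{Y})$-extension domain if there exists a bounded extension operator $E:\mathcal{X}(\Omega)\to\mathcal{Y}(\mathbb{R}^n)$, that is, there is a constant $C>0$ such that for every $u\in\mathcal{X}(\Omega)$ one has $E(u)|_\Omega= u$ (almost everywhere) and $\|E(u)\|_{\mathcal{Y}(\mathbb{R}^n)}\leq C\|u\|_{\mathcal{X}(\Omega)}$. (Linearity of $E$ is not part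 of the definition.) *)

(* Defs.v *)
From HB Require Import structures.
From mathcomp Require Import all_boot all_order all_algebra.
From mathcomp Require Import all_classical all_reals all_analysis measurable_realfun.

Set Implicit Arguments.
Unset Strict Implicit.
Unset Printing Implicit Defensive.

Import Order.TTheory GRing.Theory Num.Theory.
Import numFieldNormedType.Exports.

Local Open Scope classical_set_scope.
Local Open Scope ring_scope.

(* The coordinate-generated sigma-algebra on ['rV[R]_n], as for [n.-tuple R] in
   the library; it is the Borel sigma-algebra (see [open_measurable_rV]). *)
Section measurable_rV.
Context {R : realType} {n : nat}.

Definition rV_measurable : set (set 'rV[R]_n) :=
  g_sigma_preimage (fun (i : 'I_n) (v : 'rV[R]_n) => v ord0 i).

Let rV_set0 : rV_measurable set0.
Proof. exact: sigma_algebra0. Qed.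

Let rV_setC A : rV_measurable A -> rV_measurable (~` A).
Proof. exact: sigma_algebraC. Qed.

Let rV_bigcup (F : (set 'rV[R]_n)^nat) : (forall i, rV_measurable (F i)) ->
  rV_measurable (\bigcup_i (F i)).
Proof. exact: sigma_algebra_bigcup. Qed.

HB.instance Definition _ := @isMeasurable.Build default_measure_display
  'rV[R]_n rV_measurable rV_set0 rV_setC rV_bigcup.

End measurable_rV.

Lemma measurable_rV_coord {R : realType} n (i : 'I_n) :
  measurable_fun [set: 'rV[R]_n] (fun v => v ord0 i).
Proof.
move=> _ Y mY; rewrite setTI; apply: sub_sigma_algebra => /=.
rewrite -bigcup_seq/=; exists i => /=; first by rewrite mem_index_enum.
by exists Y => //; rewrite setTI.
Qed.

Lemma measurable_rV_box {R : realType} n (A : 'I_n -> set R) :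
  (forall i, measurable (A i)) ->
  measurable [set v : 'rV[R]_n | forall i, A i (v ord0 i)].
Proof.
move=> mA.
rewrite (_ : [set v | _] = \bigcap_(i in [set: 'I_n])
    ((fun v : 'rV[R]_n => v ord0 i) @^-1` A i)); last first.
  by apply/seteqP; split=> [v Av i _|v Av i]; apply: Av.
apply: fin_bigcap_measurable => // i _.
by rewrite -[X in measurable X]setTI; exact: measurable_rV_coord.
Qed.

Lemma measurable_fun_rVP d (T : measurableType d) {R : realType} n
    (f : T -> 'rV[R]_n) :
  (forall i, measurable_fun [set: T] (fun x => f x ord0 i)) ->
  measurable_fun [set: T] f.
Proof.
move=> mf.
have /= mS : g_sigma_preimage (fun i x => f x ord0 i) `<=` measurable.
  apply: smallest_sub; first exact: sigma_algebra_measurable.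
  case: n => [|n] in f mf *; first by rewrite big_ord0.
  rewrite -bigcup_mkord_ord; apply: bigcup_sub => i Ii.
  by move=> A [B mB <-]; exact: mf.
move=> _ A mA; apply: mS.
rewrite (g_sigma_preimage_comp (fun i (v : 'rV[R]_n) => v ord0 i) f).
by exists A.
Qed.

Definition rV_cons {R : realType} n (xv : measurableTypeR R * 'rV[R]_n) : 'rV[R]_n.+1 :=
  row_mx (const_mx xv.1 : 'rV_1) xv.2.

Lemma rV_cons0 {R : realType} n (xv : measurableTypeR R * 'rV[R]_n) :
  rV_cons xv ord0 ord0 = xv.1.
Proof. by rewrite mxE; case: splitP => // j _; rewrite mxE. Qed.

Lemma rV_consS {R : realType} n (xv : measurableTypeR R * 'rV[R]_n) i :
  rV_cons xv ord0 (lift ord0 i) = xv.2 ord0 i.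
Proof.
rewrite mxE; case: splitP => j; first by rewrite (ord1 j).
by move=> /= [ij]; congr (_ _ _); apply/val_inj.
Qed.

Lemma measurable_rV_cons {R : realType} n :
  measurable_fun [set: measurableTypeR R * 'rV[R]_n] (@rV_cons R n).
Proof.
apply: measurable_fun_rVP => i; rewrite /rV_cons.
under eq_fun do rewrite mxE.
case: splitP => j _; first by under eq_fun do rewrite mxE; exact: measurable_fst.
exact: (measurableT_comp (measurable_rV_coord j) measurable_snd).
Qed.


Lemma measurable_rV_ord0 (R : realType) (A : set 'rV[R]_0) : measurable A.
Proof.
have [->|/set0P[x Ax]] := eqVneq A set0; first exact: measurable0.
suff -> : A = setT by exact: measurableT.
by apply/seteqP; split=> // y _; rewrite (_ : y = x)//; apply/rowP => -[].
Qed.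

(* The n-fold product of one-dimensional Lebesgue measures. *)
Section lebesgue_rV.
Context {R : realType}.
Local Open Scope ereal_scope.

Fixpoint lebesgue_rV n : set 'rV[R]_n -> \bar R :=
  match n with
  | 0 => \d_(0%R : 'rV[R]_0)
  | m.+1 => pushforward (lebesgue_measure \x @lebesgue_rV m) (@rV_cons R m)
  end.


Let sigma_finite_pack d (T : measurableType d) (mu : {measure set T -> \bar R}) :
  sigma_finite setT mu ->
  exists nu : {sigma_finite_measure set T -> \bar R}, mu = nu :> (set T -> \bar R).
Proof.
move=> smu.
pose H1 := isSFinite.Build _ _ _ _ (sfinite_measure_sigma_finite smu).
pose H2 := isSigmaFinite.Build _ _ _ _ smu.
pose nu := HB.pack_for (SigmaFiniteMeasure.type T R) (Measure.sort mu) H1 H2.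
by exists nu.
Qed.

Let lebesgue_rV_sigma_finite_measure n :
  exists mu : {sigma_finite_measure set 'rV[R]_n -> \bar R}, @lebesgue_rV n = mu.
Proof.
elim: n => [|n [mu muE]]; first by exists (\d_(0%R : 'rV[R]_0)).
pose f := @rV_cons R n.
have mf : measurable_fun setT f := @measurable_rV_cons R n.
pose P : {measure set (measurableTypeR R * 'rV[R]_n)%type -> \bar R} :=
  (@lebesgue_measure R \x mu).
have [M ME] : exists M : {measure set 'rV[R]_n.+1 -> \bar R}, M = pushforward P f :> (set _ -> \bar R).
  by unshelve eexists; [unshelve refine (pushforward P f)|]; [exact: mf|].
have [|nu nuE] := @sigma_finite_pack _ _ M.
  have /sigma_finiteP[F [TF ndF Foo]] := sigma_finiteT (@lebesgue_measure R).
  have /sigma_finiteP[G [TG ndG Goo]] := sigma_finiteT mu.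
  exists (fun k => [set w : 'rV[R]_n.+1 |
      F k (w ord0 ord0) /\ G k (rsubmx (w : 'rV_(1 + n)))]).
    apply/seteqP; split => // w _.
    have [k _ Fk] : (\bigcup_k F k) (w ord0 ord0) by rewrite -TF.
    have [l _ Gl] : (\bigcup_k G k) (rsubmx (w : 'rV_(1 + n))) by rewrite -TG.
    exists (maxn k l) => //; split.
    - by move: Fk; exact/subsetPset/ndF/leq_maxl.
    - by move: Gl; exact/subsetPset/ndG/leq_maxr.
  move=> k; have [mF Fk] := Foo k; have [mG Gk] := Goo k; split.
    apply: measurableI; rewrite -[X in measurable X]setTI.
      exact: measurable_rV_coord.
    have : measurable_fun setT (fun w : 'rV[R]_n.+1 => rsubmx (w : 'rV_(1 + n))).
      apply: measurable_fun_rVP => i; under eq_fun do rewrite mxE.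
      exact: measurable_rV_coord.
    exact.
  rewrite /= ME /pushforward (_ : _ @^-1` _ = F k `*` G k).
    have -> : P (F k `*` G k) = lebesgue_measure (F k) * mu (G k).
      exact: product_measure1E.
    by rewrite lte_mul_pinfty// ge0_fin_numE.
  apply/seteqP; split=> -[x v] /=; rewrite /f /rV_cons row_mxKr.
  - by rewrite -/(rV_cons (x, v)) rV_cons0.
  - by rewrite -/(rV_cons (x, v)) rV_cons0.
by exists nu; rewrite -nuE ME /= muE.
Qed.


Let lebesgue_rV0 n : @lebesgue_rV n set0 = 0.
Proof. by have [mu ->] := lebesgue_rV_sigma_finite_measure n; exact: measure0. Qed.

Let lebesgue_rV_ge0 n A : 0 <= @lebesgue_rV n A.
Proof. by have [mu ->] := lebesgue_rV_sigma_finite_measure n; exact: measure_ge0. Qed.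

Let lebesgue_rV_sigma_additive n : semi_sigma_additive (@lebesgue_rV n).
Proof.
have [mu ->] := lebesgue_rV_sigma_finite_measure n.
exact: measure_semi_sigma_additive.
Qed.

HB.instance Definition _ n := isMeasure.Build _ _ _ (@lebesgue_rV n)
  (@lebesgue_rV0 n) (@lebesgue_rV_ge0 n) (@lebesgue_rV_sigma_additive n).

Let lebesgue_rV_sigma_finite n : sigma_finite setT (@lebesgue_rV n).
Proof.
have [mu ->] := lebesgue_rV_sigma_finite_measure n; exact: sigma_finiteT.
Qed.

HB.instance Definition _ n := Measure_isSigmaFinite.Build _ _ _ (@lebesgue_rV n)
  (@lebesgue_rV_sigma_finite n).

Lemma lebesgue_rVS n (A : set 'rV[R]_n.+1) :
  @lebesgue_rV n.+1 A = (lebesgue_measure \x @lebesgue_rV n) (@rV_cons R n @^-1` A).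
Proof. by []. Qed.

Lemma lebesgue_rV_box n (A : 'I_n -> set R) : (forall i, measurable (A i)) ->
  @lebesgue_rV n [set v : 'rV[R]_n | forall i, A i (v ord0 i)] =
  \prod_(i < n) lebesgue_measure (A i).
Proof.
elim: n A => [|n IHn] A mA.
  rewrite big_ord0 -(@diracT _ 'rV[R]_0 R 0%R); congr (dirac _ _).
  by apply/seteqP; split => // v _ [].
rewrite big_ord_recl -IHn // lebesgue_rVS.
rewrite -(@product_measure1E _ _ _ _ _ lebesgue_measure (@lebesgue_rV n)) //=.
  congr (_ _); apply/seteqP; split=> -[x v] /=.
    move=> Av; split; first by have := Av ord0; rewrite rV_cons0.
    by move=> i; have := Av (lift ord0 i); rewrite rV_consS.
  move=> [Ax Av] i; have [->|[j ->]] : i = ord0 \/ exists j, i = lift ord0 j.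
  - by case: (unliftP ord0 i) => [j ->|->]; [right; exists j|left].
  - by rewrite rV_cons0.
  - by rewrite rV_consS.
- exact: mA.
- exact: (@measurable_rV_box R n (fun i => A (lift ord0 i))).
Qed.

End lebesgue_rV.

Lemma open_measurable_rV {R : realType} n (A : set 'rV[R]_n) :
  open A -> measurable A.
Proof.
move=> oA.
pose c (a : 'rV[rat]_n) : 'rV[R]_n := map_mx ratr a.
pose B (ak : 'rV[rat]_n * nat) : set 'rV[R]_n := ball (c ak.1) ak.2.+1%:R^-1.
have mB ak : measurable (B ak).
  rewrite (_ : B ak = [set v : 'rV[R]_n |
      forall i, ball (c ak.1 ord0 i) ak.2.+1%:R^-1 (v ord0 i)]).
    apply: (@measurable_rV_box R n
      (fun i => ball (c ak.1 ord0 i) ak.2.+1%:R^-1)) => i.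
    exact: measurable_ball.
  apply/seteqP; split=> [v [_ Bv] i|v Bv]; first exact: Bv.
  by split=> // i j; rewrite (ord1 i); exact: Bv.
suff -> : A = \bigcup_ak (if `[< B ak `<=` A >] then B ak else set0).
  by apply: countable_bigcupT_measurable => [//|ak]; case: ifPn.
apply/seteqP; split=> [v Av|v [ak _]]; last first.
  by case: ifPn => // /asboolP; exact.
have /nbhs_ballP[_/posnumP[e] vA] : nbhs v A by exact: open_nbhs_nbhs.
have e2 : 0 < e%:num / 2 by [].
near \oo => k.
have ke : k.+1%:R^-1 < e%:num / 2 by near: k; exact: near_infty_natSinv_lt (PosNum e2).
have k0 : 0 < k.+1%:R^-1 :> R by [].
have vq i : exists q : rat, ball (ratr q : R) k.+1%:R^-1 (v ord0 i).
  have /rat_in_itvoo[q] : v ord0 i - k.+1%:R^-1 < v ord0 i + k.+1%:R^-1.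
    by rewrite ltrBlDr -addrA ltrDl addr_gt0.
  rewrite in_itv/= => /andP[q1 q2]; exists q.
  by rewrite /ball/= ltr_distl q1.
have /choice[q qv] := vq.
exists (\row_i q i, k) => //; rewrite ifT.
  by split=> // i j; rewrite /c !mxE (ord1 i); exact: qv.
apply/asboolP => w [_ Bw]; apply: vA; split => // i j.
rewrite [e%:num]splitr (ord1 i); apply: (@ball_triangle _ _ (ratr (q j) : R)).
  by apply: le_ball (ltW ke) _ _; apply: ball_sym; exact: qv.
apply: le_ball (ltW ke) _ _; have := Bw ord0 j.
by rewrite /c !mxE.
Unshelve. all: by end_near. Qed.

Section sobolev.
Context {R : realType} {n : nat}.
Implicit Types (Omega K : set 'rV[R]_n) (u v phi : 'rV[R]_n -> R)
  (g : 'rV[R]_n -> 'rV[R]_n) (p : \bar R).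
Local Notation mu := (@lebesgue_rV R n).

Definition domain Omega := [/\ Omega !=set0, open Omega & connected Omega].

(* The library norm on ['rV[R]_n] is the max norm. *)
Definition enorm (x : 'rV[R]_n) : R := Num.sqrt (\sum_i x ord0 i ^+ 2).

Definition partial (i : 'I_n) phi : 'rV[R]_n -> R := 'D_(delta_mx ord0 i) phi.

Fixpoint Ck (k : nat) phi : Prop :=
  continuous phi /\
  match k with
  | 0 => True
  | k'.+1 => forall i, (forall x, derivable phi x (delta_mx ord0 i)) /\
                       Ck k' (partial i phi)
  end.

Definition test_function Omega phi :=
  [/\ forall k, Ck k phi,
      compact (closure [set x | phi x != 0]) &
      closure [set x | phi x != 0] `<=` Omega].

Definition locally_L1 Omega u :=
  measurable_fun Omega u /\
  forall K, K `<=` Omega -> compact K ->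
    (\int[mu]_(x in K) `|u x|%:E < +oo)%E.

Definition is_gradient Omega u g :=
  (forall i, locally_L1 Omega (fun x => g x ord0 i)) /\
  forall phi, test_function Omega phi -> forall i,
    \int[mu]_(x in Omega) (u x * partial i phi x) =
    - \int[mu]_(x in Omega) (g x ord0 i * phi x).

(* The distributional gradient is only determined almost everywhere on [Omega];
   this picks one representative. *)
Definition gradient Omega u : 'rV[R]_n -> 'rV[R]_n :=
  xget (cst 0) [set g | is_gradient Omega u g].

(* [u \_ Omega] is [u] extended by 0 outside [Omega]; for [p = +oo] this is
   harmless because an essential supremum of absolute values is taken. *)
Definition Lp_norm Omega p u : \bar R := 'N[mu]_p[EFin \o (u \_ Omega)].

(* A (semi-)normed space of functions on a set [Omega]: its members are
   represented by total functions whose values outside [Omega] are irrelevant,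
   and which stand for their almost everywhere class on [Omega]. *)
Record fspace := FSpace {
  fs_mem : set ('rV[R]_n -> R);
  fs_norm : ('rV[R]_n -> R) -> \bar R }.

Definition L1p p Omega : fspace := {|
  fs_mem := [set u | locally_L1 Omega u /\
    exists2 g, is_gradient Omega u g & (Lp_norm Omega p (enorm \o g) < +oo)%E];
  fs_norm := fun u => Lp_norm Omega p (enorm \o gradient Omega u) |}.

Definition W1p p Omega : fspace := {|
  fs_mem := fs_mem (L1p p Omega) `&` [set u | (Lp_norm Omega p u < +oo)%E];
  fs_norm := fun u => let g := gradient Omega u in
    match p with
    | r%:E => ((\int[mu]_(x in Omega) (`|u x| `^ r + enorm (g x) `^ r)%:E)
                 `^ r^-1)%E
    | _ => Lp_norm Omega p (fun x => `|u x| + enorm (g x))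
    end |}.

(* The first clause on [E] says that it is well defined on almost everywhere
   classes; [E] need not be linear. *)
Definition extension_domain (X Y : set 'rV[R]_n -> fspace) Omega :=
  exists (E : ('rV[R]_n -> R) -> 'rV[R]_n -> R) (C : R),
  [/\ 0 < C,
      forall u v, fs_mem (X Omega) u -> fs_mem (X Omega) v ->
        u = v %[ae mu in Omega] -> E u = E v %[ae mu] &
      forall u, fs_mem (X Omega) u ->
        [/\ fs_mem (Y setT) (E u), E u = u %[ae mu in Omega] &
            (fs_norm (Y setT) (E u) <= C%:E * fs_norm (X Omega) u)%E]].

End sobolev.

(* Main.v *)
(** Compose u with the well t^2 / (1 + t^2), centred at u(x0) and rescaled by
    the essential supremum of |grad u|. The result and its gradient are bounded
    by 1, so its W^{1,oo} norm is at most 2 however large u is. Its W^{1,q}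
    extension is Hölder continuous by Morrey's inequality (this is where q > n
    enters), with constants that depend neither on u nor on x0; hence within a
    fixed distance of x0 it stays below 1/2, which means that
    |u - u(x0)| <= ess sup |grad u| there. A bounded connected set is chained
    by a bounded number of steps of a given length, so there are N, depending
    only on Omega, and a constant c, depending on u, such that
    |u - c| <= N ess sup |grad u| almost everywhere on Omega. The W^{1,oo} norm
    of u - c is then at most (N + 1) ess sup |grad u|, and u |-> E(u - c) + c is
    the required operator.

    Weak gradients enter through one identity: the integral of u over a
    translate of a box minus its integral over the box is the integral of the
    partial derivative over the region swept. Morrey's inequality follows by
    comparing the averages of u over dyadic cubes, and the chain rule for
    F(u) by passing to the limit in difference quotients. *)

Require Import Defs.
From mathcomp Require Import all_boot all_order all_algebra.
From mathcomp Require Import all_classical all_reals all_analysis.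
From mathcomp Require Import measurable_realfun ess_sup_inf ring lra zify.

Set Implicit Arguments.
Unset Strict Implicit.
Unset Printing Implicit Defensive.

Import Order.TTheory GRing.Theory Num.Theory.
Import numFieldNormedType.Exports.

Local Open Scope classical_set_scope.
Local Open Scope ring_scope.

(** * Boxes and translation invariance of the Lebesgue measure *)

(** The W^{1,oo} norm contains sup |u|, over which the seminorm of L^{1,oo} has no control until the
    oscillation bound is known; hence [E] is first applied to a bounded function of [u] and not to
    [u]. [Omega] may fold back on itself, so that points close in R^n are far apart inside [Omega].
    That [u] hardly changes between such points is read off the extension, which has a continuous
    representative on all of R^n; accordingly the closeness of two points is measured in R^n,
    whether or not the segment between them lies in [Omega]. The chain rule is wanted only for
    bounded gradients: Morrey's inequality then already gives a locally Lipschitz representative,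
    which makes Taylor remainders quadratic in the step, and no mollification occurs. Boxes are the
    only test sets: they generate the Borel sets, their smooth cut-offs are products of one-variable
    bumps, and their halves are translates of each other. Rescaling divides by the bound on the
    gradient, which may be 0; so the oscillation is bounded with an extra e > 0, which then tends to
    0. *)

Section boxes.
Context {R : realType} {n : nat}.
Implicit Types (a b v e : 'rV[R]_n).
Local Notation mu := (@lebesgue_rV R n).

(** Half-open, so that a cut across an axis gives two disjoint boxes of the same kind. *)
Definition bx a b : set 'rV[R]_n :=
  [set v | forall i, `]a ord0 i, b ord0 i]%classic (v ord0 i)].

Lemma bxP a b v : bx a b v <-> forall i, a ord0 i < v ord0 i <= b ord0 i.
Proof. by split=> H i; have := H i; rewrite /= in_itv. Qed.

Lemma measurable_bx a b : measurable (bx a b).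
Proof. exact: (@measurable_rV_box R n (fun i => `]a ord0 i, b ord0 i]%classic)). Qed.

Lemma mu_bx a b : (forall i, a ord0 i <= b ord0 i) ->
  mu (bx a b) = (\prod_i (b ord0 i - a ord0 i))%:E.
Proof.
move=> ab; rewrite (@lebesgue_rV_box R n (fun i => `]a ord0 i, b ord0 i]%classic))// -prodEFin.
apply: eq_bigr => i _.
rewrite lebesgue_measure_itv/= lte_fin; case: ltgtP (ab i) => // -> _.
by rewrite subrr.
Qed.

Lemma bx_empty a b : ~ (forall i, a ord0 i <= b ord0 i) -> bx a b = set0.
Proof.
move=> ab; rewrite -subset0 => v /bxP av; apply: ab => i.
by have /andP[/ltW] := av i; exact: le_trans.
Qed.

Lemma mu_bx_lty a b : (mu (bx a b) < +oo)%E.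
Proof.
have [ab|ab] := pselect (forall i, a ord0 i <= b ord0 i).
  by rewrite mu_bx// ltry.
by rewrite bx_empty// measure0.
Qed.

Lemma bxI a b c d : bx a b `&` bx c d =
  bx (\row_i Num.max (a ord0 i) (c ord0 i)) (\row_i Num.min (b ord0 i) (d ord0 i)).
Proof.
apply/seteqP; split=> v.
  move=> [/bxP ab /bxP cd]; apply/bxP => i; rewrite !mxE gt_max le_min.
  by have /andP[-> ->] := ab i; have /andP[-> ->] := cd i.
move=> /bxP H; split; apply/bxP => i; have := H i;
  by rewrite !mxE gt_max le_min => /andP[/andP[h1 h2] /andP[h3 h4]]; apply/andP.
Qed.

Lemma bx_cover : \bigcup_k bx (const_mx (- k%:R)) (const_mx k%:R) = setT.
Proof.
apply/seteqP; split=> // v _.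
exists (\max_(i < n) (Num.trunc `|v ord0 i|).+1)%N => //.
apply/bxP => i; rewrite !mxE.
have : `|v ord0 i| < (\max_(i < n) (Num.trunc `|v ord0 i|).+1)%:R.
  apply: (@lt_le_trans _ _ (Num.trunc `|v ord0 i|).+1%:R).
    by rewrite truncnS_gt.
  by rewrite ler_nat; exact: (@leq_bigmax _ (fun i => (Num.trunc `|v ord0 i|).+1)).
by rewrite ltr_norml => /andP[-> /ltW ->].
Qed.

Definition boxes : set (set 'rV[R]_n) := [set A | exists a b, A = bx a b].
Local Notation G := boxes.

(** The sets [Y] with this property form a sigma-algebra, and the preimage of an interval ]c, d] is
    a slab, the union of its truncations to boxes. *)
Lemma bx_coord (i : 'I_n) (Y : set R) : measurable Y ->
  <<s G >> ((fun v : 'rV[R]_n => v ord0 i) @^-1` Y).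
Proof.
move=> mY; pose S := [set Y : set R | <<s G >> ((fun v : 'rV[R]_n => v ord0 i) @^-1` Y)].
suff : measurable `<=` S by apply.
apply: smallest_sub.
  split.
  - by rewrite /S /= preimage_set0; exact: sigma_algebra0.
  - by move=> A; rewrite /S /= => SA; rewrite setTD -preimage_setC -setTD; exact: sigma_algebraCD.
  - by move=> F SF; rewrite /S /= preimage_bigcup; exact: sigma_algebra_bigcup.
move=> _ [[c d] _ <-]; rewrite /S /=.
rewrite (_ : _ @^-1` _ = \bigcup_k (bx
    (\row_j if j == i then c else - k%:R) (\row_j if j == i then d else k%:R))).
  by apply: sigma_algebra_bigcup => k; apply: sub_sigma_algebra; do 2 eexists.
apply/seteqP; split=> v /=; last first.
  by move=> [k _ /bxP/(_ i)]; rewrite !mxE eqxx in_itv.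
move=> cvd; have : setT v by [].
rewrite -bx_cover => -[k _ /bxP vk]; exists k => //; apply/bxP => j.
rewrite !mxE; case: eqP => [->|_]; first by move: cvd; rewrite in_itv.
by have := vk j; rewrite !mxE.
Qed.

Lemma setI_closed_boxes : setI_closed boxes.
Proof. by move=> _ _ [a [b ->]] [c [d ->]]; rewrite bxI; do 2 eexists. Qed.

Lemma measurable_boxesE :
  (@measurable _ 'rV[R]_n : set (set 'rV[R]_n)) = <<s boxes >>.
Proof.
apply/seteqP; split; last first.
  apply: smallest_sub; first exact: sigma_algebra_measurable.
  by move=> _ [a [b ->]]; exact: measurable_bx.
suff : <<s \big[setU/set0]_(i < n) preimage_set_system setT
    (fun v : 'rV[R]_n => v ord0 i) measurable >> `<=` <<s boxes >> by apply.
apply: smallest_sub; first exact: smallest_sigma_algebra.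
rewrite -bigcup_seq => B [i _ [Y mY <-]]; rewrite setTI; exact: bx_coord.
Qed.

(** Boxes are stable under intersection, generate the measurable sets, and exhaust the space with
    finite measure. *)
Lemma measure_unique_bx (m1 m2 : {measure set 'rV[R]_n -> \bar R}) :
  (forall a b, m1 (bx a b) = m2 (bx a b)) ->
  (forall a b, m1 (bx a b) < +oo)%E ->
  forall A, measurable A -> m1 A = m2 A.
Proof.
move=> m12 m1oo A mA.
apply: (@g_sigma_algebra_measure_unique _ _ _ G _
  (fun k => bx (const_mx (- k%:R)) (const_mx k%:R)) _ bx_cover m1 m2).
- by move=> _ [a [b ->]]; exact: measurable_bx.
- by move=> k; do 2 eexists.
- exact: setI_closed_boxes.
- by move=> _ [a [b ->]]; exact: m12.
- by move=> k; exact: m1oo.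
- by rewrite -measurable_boxesE.
Qed.

Lemma measurable_shift e : measurable_fun [set: 'rV[R]_n] (fun x => x + e).
Proof.
apply: measurable_fun_rVP => i; under eq_fun do rewrite mxE.
by apply: measurable_funD => //; exact: measurable_rV_coord.
Qed.

(** The image of [mu] under a translation is a measure that agrees with [mu] on boxes. *)
Lemma mu_shift e A : measurable A -> mu ((fun x => x + e) @^-1` A) = mu A.
Proof.
have [M ME] : exists M : {measure set 'rV[R]_n -> \bar R},
    M = pushforward mu (fun x => x + e) :> (set _ -> \bar R).
  by unshelve eexists; [unshelve refine (pushforward mu (fun x => x + e))|];
    [exact: measurable_shift|].
move=> mA; have -> : mu ((fun x => x + e) @^-1` A) = M A by rewrite ME.
have pre a b : (fun x => x + e) @^-1` bx a b = bx (a - e) (b - e).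
  apply/seteqP; split=> v /bxP H; apply/bxP => i; have := H i; rewrite !mxE.
    by rewrite ltrBlDr lerBrDr.
  by rewrite ltrBlDr lerBrDr.
apply: measure_unique_bx => // a b.
  rewrite ME /pushforward pre.
  have [ab|ab] := pselect (forall i, a ord0 i <= b ord0 i).
    rewrite [RHS]mu_bx// mu_bx; last by move=> i; rewrite !mxE lerD2r.
    by congr (_%:E); apply: eq_bigr => i _; rewrite !mxE; ring.
  rewrite (bx_empty ab) bx_empty ?measure0// => H; apply: ab => i.
  by have := H i; rewrite !mxE lerD2r.
by rewrite ME /pushforward pre mu_bx_lty.
Qed.

Lemma ge0_integral_shift e (f : 'rV[R]_n -> \bar R) :
  measurable_fun setT f -> (forall x, 0 <= f x)%E ->
  (\int[mu]_x f (x + e)%R = \int[mu]_x f x)%E.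
Proof.
move=> mf f0; have ms := measurable_shift e.
have := ge0_integral_pushforward ms mu measurableT mf (fun y _ => f0 y).
rewrite preimage_setT => <-.
apply: eq_measure_integral => A mA _; exact: mu_shift.
Qed.

Lemma integral_shift e (f : 'rV[R]_n -> \bar R) :
  measurable_fun setT f ->
  (\int[mu]_x f (x + e)%R = \int[mu]_x f x)%E.
Proof.
move=> mf; rewrite integralE [RHS]integralE; congr (_ - _)%E.
  rewrite -[RHS](ge0_integral_shift e (measurable_funepos mf) (funepos_ge0 f)).
  by apply: eq_integral => x _; rewrite !funeposE.
rewrite -[RHS](ge0_integral_shift e (measurable_funeneg mf) (funeneg_ge0 f)).
by apply: eq_integral => x _; rewrite !funenegE.
Qed.

Lemma integrable_shift e (f : 'rV[R]_n -> \bar R) :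
  mu.-integrable setT f -> mu.-integrable setT (fun x => f (x + e)).
Proof.
move=> /integrableP[mf foo]; apply/integrableP; split.
  by apply: (measurableT_comp mf); exact: measurable_shift.
rewrite (ge0_integral_shift e (f := fun x => `|f x|%E))//.
exact: measurableT_comp.
Qed.

Lemma Rintegral_shift e (f : 'rV[R]_n -> R) :
  measurable_fun setT f ->
  \int[mu]_x f (x + e) = \int[mu]_x f x.
Proof.
move=> mf; rewrite /Rintegral; congr fine.
by rewrite (integral_shift e (f := EFin \o f))//; exact/measurable_EFinP.
Qed.

End boxes.

(** * Smooth bumps on boxes *)

Section smooth1.
Context {R : realType}.
Implicit Types (f g : R -> R) (p : {poly R}).

(** The derivative is carried as a witness, so that an explicit formula for it proves smoothness by
    induction on the order. *)
Fixpoint smoothk (k : nat) f : Prop :=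
  match k with
  | 0 => continuous f
  | k'.+1 => exists2 f', (forall x : R, is_derive x 1 f (f' x)) & smoothk k' f'
  end.

Lemma is_derive_continuous f f' : (forall x : R, is_derive x 1 f (f' x)) ->
  continuous f.
Proof.
move=> ff' x; apply: differentiable_continuous; apply/derivable1_diffP.
by have [] := ff' x.
Qed.

Lemma smoothkS k f : smoothk k.+1 f -> smoothk k f.
Proof.
elim: k f => [|k IH] f [f' ff' sf']; first exact: is_derive_continuous ff'.
by exists f' => //; exact: IH.
Qed.

Lemma smoothkD k f g : smoothk k f -> smoothk k g -> smoothk k (fun x => f x + g x).
Proof.
elim: k f g => [|k IH] f g /=.
  by move=> cf cg x; apply: cvgD; [exact: cf|exact: cg].
move=> [f' ff' sf'] [g' gg' sg']; exists (fun x => f' x + g' x); last exact: IH.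
by move=> x; exact: is_deriveD.
Qed.

Lemma smoothkM k f g : smoothk k f -> smoothk k g -> smoothk k (fun x => f x * g x).
Proof.
elim: k f g => [|k IH] f g.
  by move=> cf cg x; apply: cvgM; [exact: cf|exact: cg].
move=> sf sg; have [f' ff' sf'] := sf; have [g' gg' sg'] := sg.
exists (fun x => f x * g' x + g x * f' x); last first.
  by apply: smoothkD; apply: IH => //; exact: smoothkS.
by move=> x; exact: is_deriveM.
Qed.

Lemma smoothk_affine k f (c d : R) : smoothk k f -> smoothk k (fun x => f (c * x + d)).
Proof.
have aff (x : R) : is_derive x 1 (fun y : R => c * y + d) c.
  apply: (is_derive_eq (is_deriveD (is_deriveZ c (is_derive_id x 1)) (is_derive_cst d x 1))).
  by rewrite addr0 /GRing.scale /= mulr1.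
elim: k f => [|k IH] f /=.
  move=> cf x; apply: continuous_comp; last exact: cf.
  exact: (is_derive_continuous aff).
move=> [f' ff' sf']; exists (fun x => f' (c * x + d) * c).
  by move=> x; apply: (is_derive1_comp (ff' _) (aff x)).
have : smoothk k (fun x => f' (c * x + d)) by exact: IH.
have : smoothk k (cst c).
  elim: k {IH sf'} c {aff} => [|k IH] c /=; first by move=> x; exact: cvg_cst.
  by exists (cst 0); [move=> x; exact: is_derive_cst|exact: IH].
by move=> s1 s2; exact: smoothkM.
Qed.

(* The derivatives of exp(-1/t), extended by 0 to t <= 0, are all of this form,
   which makes smoothness an induction. *)
Definition flat p (t : R) : R := if 0 < t then p.[t^-1] * expR (- t^-1) else 0.

(** With y = 1/t this is e^y >= y^(k+2) / (k+2)!, one term of the exponential series. The factor t^2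
    kept on the right is what makes the derivative at 0 vanish. *)
Lemma flat_boundXn k (t : R) : 0 < t ->
  (t^-1) ^+ k * expR (- t^-1) <= (k.+2)`!%:R * t ^+ 2.
Proof.
move=> t0; have y0 : 0 < t^-1 by rewrite invr_gt0.
have := @expR_ge1Dxn R t^-1 k.+1 (ltW y0); rewrite expRN => H.
have {}H : t^-1 ^+ k.+2 / (k.+2)`!%:R <= expR t^-1.
  by apply: le_trans H; rewrite lerDr.
have e0 := expR_gt0 t^-1.
rewrite ler_pdivrMr// -ler_pdivrMl; last first.
  by rewrite mulr_gt0 ?exprn_gt0// ltr0n fact_gt0.
apply: le_trans H; rewrite le_eqVlt; apply/orP; left; apply/eqP.
have f0 : (k.+2)`!%:R != 0 :> R by rewrite pnatr_eq0 -lt0n fact_gt0.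
by rewrite [in RHS]exprS [in RHS]exprS; set z := _ ^+ k; field; rewrite f0 gt_eqF.
Qed.

Lemma flat_bound p : exists2 C : R, 0 <= C & forall t : R, `|flat p t| <= C * t ^+ 2.
Proof.
exists (\sum_(i < size p) `|p`_i| * (i.+2)`!%:R).
  by apply: sumr_ge0 => i _; rewrite mulr_ge0.
move=> t; rewrite /flat; case: ifPn => t0; last first.
  rewrite normr0 mulr_ge0 ?sqr_ge0//.
  by apply: sumr_ge0 => i _; rewrite mulr_ge0.
rewrite horner_coef !mulr_suml; apply: (le_trans (ler_norm_sum _ _ _)).
apply: ler_sum => i _; rewrite -!mulrA normrM ler_wpM2l//.
rewrite ger0_norm ?flat_boundXn// mulr_ge0 ?expR_ge0// exprn_ge0// invr_ge0.
exact: ltW.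
Qed.

(** For t > 0 and y = 1/t, the derivative of p(y) e^(-y) in t is y^2 (p - p')(y) e^(-y). At 0 the
    difference quotient is at most a constant times the increment, by [flat_bound]. *)
Lemma is_derive_flat p (t : R) :
  is_derive t 1 (flat p) (flat ('X^2 * (p - p^`())) t).
Proof.
have [t0|t0|->] := ltgtP t 0.
- apply: (@near_eq_is_derive _ _ _ (cst 0)).
    near=> s; rewrite /flat ifF//; apply/negbTE; rewrite -leNgt ltW//.
    by near: s; exact: lt_nbhsl.
  rewrite /flat ifF; first exact: is_derive_cst.
  by apply/negbTE; rewrite -leNgt ltW.
- have tN0 : t != 0 by rewrite gt_eqF.
  have dV : is_derive t 1 (fun s : R => s^-1) (- t ^- 2).
    apply: (is_derive_eq (is_deriveV tN0 (is_derive_id t 1))).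
    by rewrite /GRing.scale /= mulr1.
  have dp := is_derive1_comp (is_derive_poly p t^-1) dV.
  have dN : is_derive t 1 (fun s : R => - s^-1) (- (- t ^- 2)).
    exact: is_deriveN.
  have de := @is_derive1_comp R expR (fun s : R => - s^-1) t _ _ (is_derive_expR (- t^-1)) dN.
  apply: (near_eq_is_derive _ (is_derive_eq (is_deriveM dp de) _)).
    by near=> s; rewrite /flat ifT//; near: s; exact: lt_nbhsr.
  rewrite /flat t0 hornerM hornerXn hornerD hornerN exprVn.
  change (p.[t^-1] * (expR (- t^-1) * - - t ^- 2)
    + expR (- t^-1) * (p^`().[t^-1] * - t ^- 2) =
    t ^- 2 * (p.[t^-1] - p^`().[t^-1]) * expR (- t^-1)).
  by ring.
- have [C C0 HC] := flat_bound p.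
  have cv : h^-1 *: ((flat p \o shift 0) (h *: (1:R)) - flat p 0) @[h --> 0^'] --> (0 : R).
    apply/cvgrPdist_le => /= e e0; near=> h.
    rewrite [flat p 0]/flat ltxx subr0 sub0r normrN /= addr0 /GRing.scale /= mulr1.
    rewrite normrM normfV ler_pdivrMl; last by rewrite normr_gt0; near: h; exact: nbhs_dnbhs_neq.
    apply: (le_trans (HC h)).
    rewrite -real_normK ?num_real// expr2 mulrCA ler_wpM2l//.
    (* The next step divides by the constant, and [C] may be 0. *)
    apply: (@le_trans _ _ ((C + 1) * `|h|)); first by rewrite ler_wpM2r// lerDl.
    rewrite -ler_pdivlMl; last by rewrite ltr_wpDl.
    near: h; apply: dnbhs0_le; rewrite mulr_gt0// invr_gt0.
    by rewrite ltr_wpDl.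
  apply: DeriveDef; first by apply/cvg_ex; exists 0.
  rewrite [flat _ 0]/flat ltxx; exact/cvg_lim.
Unshelve. all: by end_near. Qed.

Lemma smoothk_flat k p : smoothk k (flat p).
Proof.
elim: k p => [|k IH] p /=; first exact: is_derive_continuous (is_derive_flat p).
by exists (flat ('X^2 * (p - p^`()))); [exact: is_derive_flat|exact: IH].
Qed.

(** [flat 1] is exp(-1/t) for t > 0 and 0 elsewhere. The factor m + 1 steepens both edges, so that
    the bumps tend to the indicator of the open interval. *)
Definition bump1 (a b : R) (m : nat) (t : R) : R :=
  flat 1 (m.+1%:R * (t - a)) * flat 1 (m.+1%:R * (b - t)).

Lemma flat1E (t : R) : flat 1 t = if 0 < t then expR (- t^-1) else 0.
Proof. by rewrite /flat hornerE mul1r. Qed.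

Lemma flat1_ge0 (t : R) : 0 <= flat 1 t.
Proof. by rewrite flat1E; case: ifP => // _; exact: expR_ge0. Qed.

Lemma flat1_le1 (t : R) : flat 1 t <= 1.
Proof.
rewrite flat1E; case: ifPn => // t0; rewrite -[leRHS]expR0 ler_expR.
by rewrite oppr_le0 invr_ge0 ltW.
Qed.

Lemma bump1_ge0 a b m t : 0 <= bump1 a b m t.
Proof. by rewrite mulr_ge0 ?flat1_ge0. Qed.

Lemma bump1_le1 a b m t : bump1 a b m t <= 1.
Proof. by rewrite mulr_ile1 ?flat1_ge0 ?flat1_le1. Qed.

Lemma bump1_eq0 a b m t : ~~ (a < t < b) -> bump1 a b m t = 0.
Proof.
rewrite negb_and -!leNgt /bump1 !flat1E => /orP[h|h].
  by rewrite ifF ?mul0r//; apply/negbTE; rewrite -leNgt pmulr_rle0// subr_le0.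
by rewrite mulrC ifF ?mul0r//; apply/negbTE; rewrite -leNgt pmulr_rle0// subr_le0.
Qed.

Lemma smoothk_bump1 k a b m : smoothk k (bump1 a b m).
Proof.
apply: smoothkM.
  have := @smoothk_affine k _ m.+1%:R (m.+1%:R * - a) (smoothk_flat k 1).
  by under eq_fun do rewrite -mulrDr.
have := @smoothk_affine k _ (- m.+1%:R) (m.+1%:R * b) (smoothk_flat k 1).
by under eq_fun do rewrite mulNr -mulrN -mulrDr addrC.
Qed.

Lemma bump1_shift a b m t d : bump1 (a + d) (b + d) m t = bump1 a b m (t - d).
Proof. by congr (flat _ (_ * _) * flat _ (_ * _)); ring. Qed.

Lemma flat1_cvg (t : R) : 0 < t -> flat 1 (m.+1%:R * t) @[m --> \oo] --> (1 : R).
Proof.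
move=> t0; have : expR (- (m.+1%:R^-1 * t^-1)) @[m --> \oo] --> (1 : R).
  rewrite -[X in _ --> X]expR0; apply: continuous_cvg; first exact: continuous_expR.
  rewrite -[X in _ --> X]oppr0; apply: cvgN; rewrite -[X in _ --> X](mul0r t^-1).
  by apply: cvgM; [exact: cvg_harmonic|exact: cvg_cst].
by apply: cvg_trans; apply: near_eq_cvg; near=> m; rewrite flat1E mulr_gt0// invfM.
Unshelve. all: by end_near. Qed.

Lemma bump1_cvg a b t : a < t < b -> bump1 a b m t @[m --> \oo] --> (1 : R).
Proof.
move=> /andP[at_ tb]; rewrite -(mulr1 1).
by apply: cvgM; apply: flat1_cvg; rewrite subr_gt0.
Qed.

End smooth1.

(** * Products of one-variable bumps as test functions *)

Section tensor.
Context {R : realType} {n : nat}.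
Implicit Types (a b v e x : 'rV[R]_n) (f : 'I_n -> R -> R).

Definition tensor f x : R := \prod_j f j (x ord0 j).

Lemma continuous_coord (j : 'I_n) : continuous (fun x : 'rV[R]_n => x ord0 j).
Proof. by move=> x; exact: coord_continuous. Qed.

Lemma tensor_continuous f : (forall j, continuous (f j)) -> continuous (tensor f).
Proof.
move=> cf x; rewrite /tensor.
apply: (@cvg_big _ _ (fun u v : R => u * v)); first exact: mul_continuous.
  exact: (nbhs_filter x).
move=> j _; apply: (@continuous_comp _ _ _ (fun x : 'rV[R]_n => x ord0 j) (f j)).
  exact: continuous_coord.
exact: cf.
Qed.

Lemma is_derive_tensor f i x (df : R) : is_derive (x ord0 i) 1 (f i) df ->
  is_derive x (delta_mx ord0 i) (tensor f) (df * \prod_(j | j != i) f j (x ord0 j)).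
Proof.
move=> [/cvg_ex[l Hl] Hd].
have ld : l = df by rewrite -Hd; apply/esym/cvg_lim.
have H : h^-1 *: ((tensor f \o shift x) (h *: delta_mx ord0 i) - tensor f x)
    @[h --> 0^'] --> (df * \prod_(j | j != i) f j (x ord0 j) : R).
  rewrite -ld; set P := \prod_(_ | _) _.
  have Hm : h^-1 *: ((f i \o shift (x ord0 i)) (h *: (1 : R)) - f i (x ord0 i)) * P
      @[h --> 0^'] --> l * P by apply: cvgM; [exact: Hl|exact: cvg_cst].
  apply: cvg_trans Hm; apply: near_eq_cvg; near=> h.
  have TE y : tensor f y = f i (y ord0 i) * \prod_(j | j != i) f j (y ord0 j).
    by rewrite /tensor (bigD1 i).
  rewrite /= !TE [in RHS](eq_bigr (fun j => f j (x ord0 j))) -/P; last first.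
    by move=> j ji; rewrite !mxE eqxx (negbTE ji) mulr0 add0r.
  by rewrite !mxE !eqxx /GRing.scale /= mulr1; ring.
apply: DeriveDef; first by apply/cvg_ex; eexists; exact: H.
exact/cvg_lim.
Unshelve. all: by end_near. Qed.

(** A partial derivative of a product of one-variable functions is again such a product, with one
    factor differentiated, so the induction stays within this class. *)
Lemma Ck_tensor k f : (forall k j, smoothk k (f j)) -> Ck k (tensor f).
Proof.
elim: k f => [|k IH] f sf; split => //; try by apply: tensor_continuous => j; exact: (sf 0).
move=> i; have /choice[f' f'P] : forall l : nat, exists f' : R -> R,
    (forall x : R, is_derive x 1 (f i) (f' x)) /\ smoothk l f'.
  by move=> l; have [f' ? ?] := sf l.+1 i; exists f'.
(* Each order of smoothness supplies its own derivative of [f i]; uniqueness of derivatives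
   identifies them all. *)
have f'E l : f' l = f' 0.
  apply/funext => x; have [_ <-] := (f'P l).1 x.
  by have [_ <-] := (f'P 0).1 x.
have df := fun x : 'rV[R]_n => is_derive_tensor ((f'P 0).1 (x ord0 i)).
split=> [x|]; first by have [] := df x.
rewrite (_ : partial i _ = tensor (fun j => if j == i then f' 0 else f j)).
  apply: IH => l j; case: eqP => _ //; rewrite -(f'E l); exact: (f'P l).2.
apply/funext => x; have [_ dx] := df x; rewrite /partial dx /tensor.
rewrite [in RHS](bigD1 i)//= eqxx; congr (_ * _); apply: eq_bigr => j ji.
by rewrite (negbTE ji).
Qed.

Definition cbx a b : set 'rV[R]_n :=
  [set v | forall i, `[a ord0 i, b ord0 i]%classic (v ord0 i)].

Lemma cbxP a b v : cbx a b v <-> forall i, a ord0 i <= v ord0 i <= b ord0 i.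
Proof. by split=> H i; have := H i; rewrite /= in_itv. Qed.

Lemma compact_cbx a b : compact (cbx a b).
Proof.
apply: (rV_compact (A := fun i => `[a ord0 i, b ord0 i]%classic)) => i.
exact: segment_compact.
Qed.

Lemma closed_cbx a b : closed (cbx a b).
Proof. by apply: compact_closed; [exact: norm_hausdorff|exact: compact_cbx]. Qed.

Lemma bx_cbx a b : bx a b `<=` cbx a b.
Proof.
by move=> v /bxP H; apply/cbxP => i; have /andP[/ltW -> ->] := H i.
Qed.

Lemma measurable_cbx a b : measurable (cbx a b).
Proof. exact: (@measurable_rV_box R n (fun i => `[a ord0 i, b ord0 i]%classic)). Qed.

Definition boxbump a b m : 'rV[R]_n -> R :=
  tensor (fun j => bump1 (a ord0 j) (b ord0 j) m).

Lemma boxbump_ge0 a b m x : 0 <= boxbump a b m x.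
Proof. by apply: prodr_ge0 => j _; exact: bump1_ge0. Qed.

Lemma boxbump_le1 a b m x : boxbump a b m x <= 1.
Proof.
suff /andP[] : 0 <= boxbump a b m x <= 1 by [].
rewrite /boxbump /tensor; elim/big_rec : _ => [|j y _ /andP[y0 y1]]; first by rewrite ler01 lexx.
have b0 := bump1_ge0 (a ord0 j) (b ord0 j) m (x ord0 j).
have b1 := bump1_le1 (a ord0 j) (b ord0 j) m (x ord0 j).
by apply/andP; split; [exact: mulr_ge0|exact: mulr_ile1].
Qed.

Definition obx a b : set 'rV[R]_n :=
  [set v | forall i, `]a ord0 i, b ord0 i[%classic (v ord0 i)].

Lemma boxbump_eq0 a b m x : ~ obx a b x -> boxbump a b m x = 0.
Proof.
move=> /existsNP[i]; rewrite /= in_itv/= => /negP abx.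
by rewrite /boxbump /tensor (bigD1 i)//= bump1_eq0// mul0r.
Qed.

Lemma boxbump_shift a b m d x : boxbump (a + d) (b + d) m x = boxbump a b m (x - d).
Proof. by apply: eq_bigr => j _; rewrite !mxE bump1_shift. Qed.

Lemma boxbump_cvg a b x : boxbump a b m x @[m --> \oo] --> (\1_(obx a b) x : R).
Proof.
rewrite indicE; case: (boolP (x \in _)) => [|/negP]; rewrite inE.
  move=> abx; rewrite /boxbump /tensor.
  rewrite [X in _ --> X](_ : _ = \prod_(j < n) (1 : R)); last by rewrite big1.
  apply: (@cvg_big _ _ (fun u v : R => u * v)); first exact: mul_continuous.
  by move=> j _; apply: bump1_cvg; have := abx j; rewrite /= in_itv.
by move=> abx; under eq_fun do rewrite (boxbump_eq0 _ abx); exact: cvg_cst.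
Qed.

Lemma closure_boxbump a b m : closure [set x | boxbump a b m x != 0] `<=` cbx a b.
Proof.
have := @closed_cbx a b; rewrite closure_id => ->.
apply: closure_subset => x /= /eqP bx0; apply/cbxP => i.
have abx : obx a b x by apply: contrapT => /(boxbump_eq0 m).
by have := abx i; rewrite /= in_itv/= => /andP[/ltW -> /ltW ->].
Qed.

Lemma test_boxbump Omega a b m : cbx a b `<=` Omega -> test_function Omega (boxbump a b m).
Proof.
move=> abO; have sub := @closure_boxbump a b m.
split; last exact: subset_trans abO.
  by move=> k; apply: Ck_tensor => l j; exact: smoothk_bump1.
exact: (subclosed_compact (@closed_closure _ _) (@compact_cbx a b)).
Qed.

Lemma is_derive_line (f : 'rV[R]_n -> R) x e (s : R) : derivable f (x + s *: e) e ->
  is_derive s 1 (fun t => f (x + t *: e)) ('D_e f (x + s *: e)).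
Proof.
move=> df; have /cvg_ex[l Hl] := df; have -> : 'D_e f (x + s *: e) = l.
  exact/cvg_lim.
have H : h^-1 *: (((fun t => f (x + t *: e)) \o shift s) (h *: 1) - f (x + s *: e))
    @[h --> 0^'] --> l.
  apply: cvg_trans Hl; apply: near_eq_cvg; near=> h.
  rewrite /= -[h%:A]/(h * 1) mulr1; congr (_ *: (f _ - _)).
  by rewrite scalerDl addrCA.
apply: DeriveDef; first by apply/cvg_ex; eexists; exact: H.
exact/cvg_lim.
Unshelve. all: by end_near. Qed.

Lemma MVT_line (f : 'rV[R]_n -> R) e (M : R) :
  (forall x, derivable f x e) -> (forall x, `|'D_e f x| <= M) ->
  forall x h, `|f (x + h *: e) - f x| <= M * `|h|.
Proof.
move=> df Mf x h.
have D t := is_derive_line (df (x + t *: e)).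
have C := is_derive_continuous D.
have K (a b : R) : a < b -> `|f (x + b *: e) - f (x + a *: e)| <= M * `|b - a|.
  move=> ab; have [c _ ->] := @MVT _ _ _ _ _ ab (fun t _ => D t)
    (continuous_subspaceT C).
  by rewrite normrM ler_wpM2r.
have -> : f x = f (x + 0 *: e) by rewrite scale0r addr0.
rewrite -[X in M * `|X|]subr0.
have [h0|h0|->] := ltgtP h 0; last by rewrite !subrr !normr0 mulr0.
- by rewrite distrC (distrC h); exact: K.
- exact: K.
Qed.

Section test_function.
Variables (Omega : set 'rV[R]_n) (phi : 'rV[R]_n -> R).
Hypothesis tphi : test_function Omega phi.
Let K := closure [set x | phi x != 0].

Lemma test_continuous : continuous phi.
Proof. by have [/(_ 0)[]] := tphi. Qed.

Lemma test_derivable i x : derivable phi x (delta_mx ord0 i).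
Proof. by have [/(_ 1)[_ /(_ i)[]]] := tphi. Qed.

Lemma test_partial_continuous i : continuous (partial i phi).
Proof. by have [/(_ 1)[_ /(_ i)[_ []]]] := tphi. Qed.

Lemma test_eq0 x : ~ K x -> phi x = 0.
Proof.
move=> Kx; apply/eqP/negPn/negP => px; apply: Kx; exact: subset_closure.
Qed.

Lemma partial_eq0 i x : ~ K x -> partial i phi x = 0.
Proof.
move=> Kx; have oK : open (~` K) by exact/closed_openC/closed_closure.
suff [] : is_derive x (delta_mx ord0 i) phi 0 by [].
apply: (near_eq_is_derive _ (is_derive_cst 0 x (delta_mx ord0 i))).
apply: filterS (open_nbhs_nbhs (conj oK Kx)) => y Ky.
by rewrite test_eq0.
Qed.

Lemma compact_support_bounded (f : 'rV[R]_n -> R) : continuous f ->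
  (forall x, ~ K x -> f x = 0) -> exists2 M : R, 0 <= M & forall x, `|f x| <= M.
Proof.
move=> cf f0; have [_ cK _] := tphi.
have : bounded_set (f @` K).
  by apply: compact_bounded; apply: continuous_compact => //; exact: continuous_subspaceT.
move=> [M [_ HM]]; exists (`|M| + 1); first by rewrite addr_ge0.
move=> x; have [Kx|/f0 ->] := pselect (K x); last by rewrite normr0 addr_ge0.
by apply: (HM (`|M| + 1)); [rewrite (le_lt_trans (ler_norm M))// ltrDl|exists x].
Qed.

Lemma test_bounded : exists2 M : R, 0 <= M & forall x, `|phi x| <= M.
Proof. exact: compact_support_bounded test_continuous test_eq0. Qed.

Lemma partial_bounded i : exists2 M : R, 0 <= M & forall x, `|partial i phi x| <= M.
Proof.
by apply: compact_support_bounded; [exact: test_partial_continuous|exact: partial_eq0].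
Qed.

End test_function.
End tensor.

(** * Locally integrable functions and uniqueness of weak gradients *)

Section Rintegral_complements.
Context d (T : measurableType d) (R : realType) (mu : {measure set T -> \bar R}).
Implicit Types (D A : set T) (f g : T -> R).

Lemma dominated_cvgR D (f_ : nat -> T -> R) f g : measurable D ->
  (forall m, measurable_fun D (f_ m)) ->
  (forall x, D x -> f_ ^~ x @ \oo --> f x) ->
  mu.-integrable D (EFin \o g) ->
  (forall m x, D x -> `|f_ m x| <= g x) ->
  mu.-integrable D (EFin \o f) /\
  \int[mu]_(x in D) f_ m x @[m --> \oo] --> \int[mu]_(x in D) f x.
Proof.
move=> mD mf_ cf ig fg.
have mf : measurable_fun D f by exact: measurable_fun_cvg mf_ cf.
have [] := @dominated_convergence _ _ _ mu D mD (fun m x => (f_ m x)%:E)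
  (EFin \o f) (EFin \o g) (fun m => (measurable_EFinP _ _).2 (mf_ m)) ((measurable_EFinP _ _).2 mf) _ ig _.
- by apply: aeW => x Dx; apply: cvg_EFin; [exact: nearW|exact: cf].
- by apply: aeW => x m Dx; rewrite /= lee_fin; exact: fg.
move=> intf _ H; split => //.
by apply: fine_cvg; rewrite fineK//; exact: integrable_fin_num.
Qed.

Lemma Rintegral_subset D A f : A `<=` D -> (forall x, D x -> ~ A x -> f x = 0) ->
  \int[mu]_(x in D) f x = \int[mu]_(x in A) f x.
Proof.
move=> AD f0; rewrite Rintegral_mkcond [RHS]Rintegral_mkcond; congr (Rintegral _ _ _).
apply/funext => x; rewrite /patch; case: (boolP (x \in A)) => [|/negP]; rewrite inE => Ax.
  by rewrite mem_set//; exact: AD.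
by case: ifPn => //; rewrite inE => Dx; exact: f0.
Qed.

Lemma integrable_subset D A f : measurable D -> measurable A ->
  A `<=` D -> (forall x, D x -> ~ A x -> f x = 0) ->
  mu.-integrable A (EFin \o f) -> mu.-integrable D (EFin \o f).
Proof.
move=> mD mA AD f0 /(integrable_mkcond _ mA) H; apply/(integrable_mkcond _ mD).
rewrite (_ : _ \_ D = (EFin \o f) \_ A)//.
apply/funext => x; rewrite /patch; case: (boolP (x \in A)) => [|/negP]; rewrite inE => Ax.
  by rewrite mem_set//; exact: AD.
by case: ifPn => //; rewrite inE => Dx /=; rewrite f0.
Qed.

Lemma integrable_mul_bounded D f g (M : R) : measurable D ->
  mu.-integrable D (EFin \o f) -> measurable_fun D g ->
  (forall x, D x -> `|g x| <= M) -> mu.-integrable D (EFin \o (fun x => f x * g x)).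
Proof.
move=> mD /[dup] intf /integrableP[/measurable_EFinP mf _] mg gM.
have := integrableZl mD M (integrable_norm intf).
apply: le_integrable => //; first exact/measurable_EFinP/measurable_funM.
move=> x Dx; rewrite /= lee_fin normrM mulrC normrM normr_id.
by rewrite ler_wpM2r// (le_trans (gM _ Dx))// ler_norm.
Qed.

Lemma Rintegral_bound D f (M : R) : measurable D -> (mu D < +oo)%E ->
  mu.-integrable D (EFin \o f) -> (forall x, D x -> `|f x| <= M) ->
  `|\int[mu]_(x in D) f x| <= M * fine (mu D).
Proof.
move=> mD Doo intf fM; apply: (le_trans (le_normr_Rintegral mD intf)).
rewrite -Rintegral_cst//; apply: le_Rintegral => //.
- exact: integrable_norm.
- by apply: measurable_bounded_integrable => //; exact: bounded_cst.
Qed.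

Lemma le_Rintegral_subset A D f : measurable A -> measurable D -> A `<=` D ->
  mu.-integrable D (EFin \o f) ->
  \int[mu]_(x in A) `|f x| <= \int[mu]_(x in D) `|f x|.
Proof.
move=> mA mD AD intf; have intA := integrableS mD mA AD intf.
apply: fine_le.
- exact: (integrable_fin_num mA (integrable_norm intA)).
- exact: (integrable_fin_num mD (integrable_norm intf)).
apply: ge0_subset_integral => //; apply/measurable_EFinP.
by apply: measurableT_comp => //; have /integrableP[/measurable_EFinP] := intf.
Qed.

End Rintegral_complements.

Section rV_integrals.
Context {R : realType} {n : nat}.
Implicit Types (a b e x : 'rV[R]_n) (u v f : 'rV[R]_n -> R) (O K A : set 'rV[R]_n).
Local Notation mu := (@lebesgue_rV R n).

Lemma measurable_compact K : compact K -> measurable K.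
Proof.
move=> cK; rewrite -[K]setCK; apply: measurableC; apply: open_measurable_rV.
by apply: closed_openC; apply: compact_closed => //; exact: norm_hausdorff.
Qed.

Lemma locally_L1_integrable O u K A : open O -> locally_L1 O u ->
  compact K -> K `<=` O -> measurable A -> A `<=` K ->
  mu.-integrable A (EFin \o u).
Proof.
move=> oO [mu_ lu] cK KO mA AK.
apply: (@integrableS _ _ _ _ K) => //; first exact: measurable_compact.
apply/integrableP; split; last exact: lu.
apply/measurable_EFinP; apply: measurable_funS mu_ => //.
exact: open_measurable_rV.
Qed.

Lemma integrable_bx O u a b : open O -> locally_L1 O u -> cbx a b `<=` O ->
  mu.-integrable (bx a b) (EFin \o u).
Proof.
move=> oO lu abO; apply: (locally_L1_integrable oO lu (@compact_cbx _ _ a b)) => //.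
  exact: measurable_bx.
exact: bx_cbx.
Qed.

Lemma integrable_cbx O u a b : open O -> locally_L1 O u -> cbx a b `<=` O ->
  mu.-integrable (cbx a b) (EFin \o u).
Proof.
move=> oO lu abO; apply: (locally_L1_integrable oO lu (@compact_cbx _ _ a b)) => //.
exact: measurable_cbx.
Qed.

Lemma locally_L1D O u v : open O -> locally_L1 O u -> locally_L1 O v ->
  locally_L1 O (fun x => u x + v x).
Proof.
move=> oO lu lv; split; first by apply: measurable_funD; [exact: lu.1|exact: lv.1].
move=> K KO cK; have mK := measurable_compact cK.
have iu := locally_L1_integrable oO lu cK KO mK (@subset_refl _ K).
have iv := locally_L1_integrable oO lv cK KO mK (@subset_refl _ K).
by have /integrableP[] := integrableD mK iu iv.
Qed.

Lemma locally_L1Z O u (c : R) : open O -> locally_L1 O u ->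
  locally_L1 O (fun x => c * u x).
Proof.
move=> oO lu; split; first by apply: measurable_funM => //; exact: lu.1.
move=> K KO cK; have mK := measurable_compact cK.
have iu := locally_L1_integrable oO lu cK KO mK (@subset_refl _ K).
by have /integrableP[] := integrableZl mK c iu.
Qed.

Lemma mu_cbx a b : mu (cbx a b) = mu (bx a b).
Proof.
rewrite (@lebesgue_rV_box R n (fun i => `[a ord0 i, b ord0 i]%classic))//.
rewrite (@lebesgue_rV_box R n (fun i => `]a ord0 i, b ord0 i]%classic))//.
by apply: eq_bigr => i _; rewrite !lebesgue_measure_itv.
Qed.

Lemma measurable_obx a b : measurable (obx a b).
Proof. exact: (@measurable_rV_box R n (fun i => `]a ord0 i, b ord0 i[%classic)). Qed.

Lemma mu_obx a b : mu (obx a b) = mu (bx a b).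
Proof.
rewrite (@lebesgue_rV_box R n (fun i => `]a ord0 i, b ord0 i[%classic))//.
rewrite (@lebesgue_rV_box R n (fun i => `]a ord0 i, b ord0 i]%classic))//.
by apply: eq_bigr => i _; rewrite !lebesgue_measure_itv.
Qed.

Lemma obx_bx a b : obx a b `<=` bx a b.
Proof.
move=> v H i; have := H i; rewrite /= !in_itv/= => /andP[-> /ltW ->] //.
Qed.

Lemma Rintegral_obx u a b : mu.-integrable (bx a b) (EFin \o u) ->
  \int[mu]_(x in obx a b) u x = \int[mu]_(x in bx a b) u x.
Proof.
move=> iu; rewrite /Rintegral; congr fine.
have mN : measurable (bx a b `\` obx a b).
  by apply: measurableD; [exact: measurable_bx|exact: measurable_obx].
rewrite [RHS](negligible_integral mN)//; last 2 first.
- exact: measurable_bx.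
- rewrite measureD; [|exact: measurable_bx|exact: measurable_obx|exact: mu_bx_lty].
  rewrite setIidr; last exact: obx_bx.
  rewrite [X in (_ - X)%E](mu_obx a b) subee// ge0_fin_numE//; exact: mu_bx_lty.
by rewrite setDD setIidr//; exact: obx_bx.
Qed.

(** Inside a box, the measurable sets over which [f] integrates to 0 form a Dynkin system that
    contains the boxes, hence are all the measurable sets, and [f] vanishes almost everywhere there.
    Countably many boxes with rational corners cover [O]. *)
Lemma ae_eq0_bx O f : open O -> locally_L1 O f ->
  (forall a b, cbx a b `<=` O -> \int[mu]_(x in bx a b) f x = 0) ->
  {ae mu, forall x, O x -> f x = 0}.
Proof.
move=> oO lf f0.
have box a b : cbx a b `<=` O -> {ae mu, forall x, bx a b x -> f x = 0}.
  move=> abO; have mab := @measurable_bx R n a b.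
  have fI A : measurable A -> mu.-integrable (bx a b `&` A) (EFin \o f).
    move=> mA; apply: (@integrableS _ _ _ _ (bx a b)) => //.
      exact: measurableI.
    exact: integrable_bx abO.
  pose P (A : set 'rV[R]_n) := (\int[mu]_(x in bx a b `&` A) (f x)%:E = 0)%E.
  have bE c e : cbx c e `<=` O -> (\int[mu]_(x in bx c e) (f x)%:E = 0)%E.
    move=> /[dup] ceO /f0 /eqP; rewrite fine_eq0 => [/eqP//|].
    by apply: integrable_fin_num; [exact: measurable_bx|exact: integrable_bx ceO].
  have PT A : measurable A -> P A.
    move=> mA; apply: (dynkin_induction (@measurable_boxesE R n)); last by rewrite -measurable_boxesE.
    - exact: setI_closed_boxes.
    - by rewrite /P setIT; exact: bE.
    - move=> _ [c [e ->]]; rewrite /P bxI; apply: bE => v /cbxP H; apply: abO.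
      apply/cbxP => i; have := H i; rewrite !mxE ge_max le_min.
      by move=> /andP[/andP[-> _] /andP[-> _]].
    - move=> S mS; rewrite /P => PS.
      have := bE _ _ abO; rewrite -[X in integral _ X](setIT (bx a b)) -(setUv S) setIUr.
      rewrite integral_setU_EFin//; last 4 first.
      + exact: measurableI.
      + by apply: measurableI => //; exact: measurableC.
      + rewrite -setIUr setUv setIT; apply/measurable_EFinP.
        exact: measurable_int (integrable_bx oO lf abO).
      + by apply/disj_setPS => x [[_ Sx] [_ /(_ Sx)]].
      by rewrite PS add0e.
    - move=> F mF tF PF; rewrite /P setI_bigcupr integral_bigcup.
      + by apply: eseries0 => i _ _; exact: PF.
      + exact: trivIset_setIl.
      + by move=> k; exact: measurableI.
      + by rewrite -setI_bigcupr; apply: fI; exact: bigcupT_measurable.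
  have : ae_eq mu (bx a b) (EFin \o f) (cst 0%E).
    apply: integral_ae_eq => //; first exact: integrable_bx abO.
    by move=> E Eab mE; rewrite integral0 -(PT E mE) /P setIidr.
  by apply: filterS => x H /H [].
(* The pairs of rational corners are enumerated by [unpickle], so that the countably many
   exceptional sets can be united. *)
have : {ae mu, forall x (k : nat), if unpickle k is Some ab then
    cbx (map_mx ratr (ab : 'rV[rat]_n * 'rV[rat]_n).1) (map_mx ratr ab.2) `<=` O ->
    bx (map_mx ratr ab.1) (map_mx ratr ab.2) x -> f x = 0 else True}.
  apply: ae_foralln => k; case: (unpickle k) => [[c e]|]; last exact: aeW.
  have [/box|nO] := pselect (cbx (map_mx (ratr : rat -> R) c) (map_mx ratr e) `<=` O).
    by apply: filterS => x H _.
  exact: aeW.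
apply: filterS => x H Ox.
have /nbhs_ballP[_/posnumP[r] xO] : nbhs x O by exact: open_nbhs_nbhs.
have /choice[c cP] i : exists q : rat, x ord0 i - r%:num / 2 < ratr q < x ord0 i.
  have /rat_in_itvoo[q] : x ord0 i - r%:num / 2 < x ord0 i by rewrite ltrBlDr ltrDl.
  by rewrite in_itv/= => ?; exists q.
have /choice[e eP] i : exists q : rat, x ord0 i < ratr q < x ord0 i + r%:num / 2.
  have /rat_in_itvoo[q] : x ord0 i < x ord0 i + r%:num / 2 by rewrite ltrDl.
  by rewrite in_itv/= => ?; exists q.
have := H (pickle (\row_i c i, \row_i e i)); rewrite pickleK /=; apply.
  move=> v /cbxP vP; apply: xO; split => // i j; rewrite (ord1 i).
  have := vP j; have := cP j; have := eP j; rewrite !mxE.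
  move=> /andP[e1 e2] /andP[c1 c2] /andP[v1 v2].
  by rewrite /ball /= ltr_norml; apply/andP; split; lra.
apply/bxP => j; have := cP j; have := eP j; rewrite !mxE.
by move=> /andP[/ltW -> _] /andP[_ ->].
Qed.

Lemma measurable_continuous_rV O f : open O ->
  (forall x, O x -> {for x, continuous f}) -> measurable_fun O f.
Proof.
move=> oO cf; apply: (measurability _ (RGenOpens.measurableE R)).
move=> _ [_ [c [d ->] <-]]; apply: open_measurable_rV.
rewrite openE => x [Ox fx]; apply: filterI; first exact: open_nbhs_nbhs.
by apply: (cf x Ox); apply: open_nbhs_nbhs; split => //; exact: interval_open.
Qed.

Lemma boxbump_continuous a b m : continuous (boxbump a b m).
Proof. exact: test_continuous (test_boxbump m (@subset_refl _ _)). Qed.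

Lemma measurable_boxbump a b m O : open O -> measurable_fun O (boxbump a b m).
Proof. by move=> oO; apply: measurable_continuous_rV => // x _; exact: boxbump_continuous. Qed.

(** Dominated convergence on the closed box, with majorant |f|. The limit is the integral over the
    open box, and the faces of a box are negligible. *)
Lemma cvg_int_boxbump O f a b : open O -> locally_L1 O f -> cbx a b `<=` O ->
  \int[mu]_(x in O) (f x * boxbump a b m x) @[m --> \oo] --> \int[mu]_(x in bx a b) f x.
Proof.
move=> oO lf abO.
have mc := @measurable_cbx R n a b; have ic := integrable_cbx oO lf abO.
have E m : \int[mu]_(x in O) (f x * boxbump a b m x) = \int[mu]_(x in cbx a b) (f x * boxbump a b m x).
  apply: Rintegral_subset => // x _ abx; rewrite boxbump_eq0 ?mulr0// => ox.
  by apply: abx; apply: bx_cbx; exact: obx_bx.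
under eq_fun do rewrite E.
have -> : \int[mu]_(x in bx a b) f x = \int[mu]_(x in cbx a b) (f x * \1_(obx a b) x).
  rewrite -Rintegral_obx; last exact: integrable_bx abO.
  rewrite [RHS](@Rintegral_subset _ _ _ _ _ (obx a b)); last 2 first.
  - by apply: subset_trans; [exact: obx_bx|exact: bx_cbx].
  - by move=> x _ ox; rewrite indicE memNset// mulr0.
  by apply: eq_Rintegral => x xo; rewrite indicE xo mulr1.
apply: (@dominated_cvgR _ _ _ mu _ _ _ (fun x => `|f x|) mc _ _ _ _).2.
- move=> m; apply: measurable_funM; first by have /integrableP[/measurable_EFinP] := ic.
  apply: (measurable_funS measurableT) => //; exact: (measurable_boxbump a b m openT).
- by move=> x _; apply: cvgM; [exact: cvg_cst|exact: boxbump_cvg].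
- exact: integrable_norm.
- by move=> m x _; rewrite normrM (ger0_norm (boxbump_ge0 _ _ _ _)) ler_piMr// boxbump_le1.
Qed.

(** Tested against the bumps of a box, both gradients give the same numbers; in the limit they have
    the same integral over the box, and boxes suffice by [ae_eq0_bx]. *)
Lemma gradient_ae_unique O u (g h : 'rV[R]_n -> 'rV[R]_n) : open O ->
  is_gradient O u g -> is_gradient O u h -> {ae mu, forall x, O x -> g x = h x}.
Proof.
move=> oO [lg ug] [lh uh].
suff H i : {ae mu, forall x, O x -> g x ord0 i - h x ord0 i = 0}.
  have : {ae mu, forall x i, O x -> g x ord0 i - h x ord0 i = 0}.
    (* The coordinate is indexed by a natural number because [ae_foralln] quantifies over [nat]. *)
    pose P (k : nat) (x : 'rV[R]_n) := forall i : 'I_n, k = i -> O x -> g x ord0 i - h x ord0 i = 0.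
    have : {ae mu, forall x k, P k x}.
      apply: ae_foralln => k; have [kn|kn] := boolP (k < n)%N.
        by apply: filterS (H (Ordinal kn)) => x Hx i ki; rewrite (_ : i = Ordinal kn)//; exact/val_inj.
      by apply: aeW => x i ki; move: kn; rewrite ki ltn_ord.
    by apply: filterS => x Hx i; exact: (Hx i i).
  by apply: filterS => x Hx Ox; apply/rowP => i; apply/eqP; rewrite -subr_eq0 Hx.
have ld := locally_L1D oO (lg i) (locally_L1Z (-1) oO (lh i)).
suff : {ae mu, forall x, O x -> g x ord0 i + -1 * h x ord0 i = 0}.
  by apply: filterS => x Hx Ox; rewrite -[RHS](Hx Ox) mulN1r.
apply: ae_eq0_bx => //.
move=> a b abO; have mab := @measurable_bx R n a b.
rewrite RintegralD//; last 2 first.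
- exact: integrable_bx abO.
- by apply: integrable_bx abO => //; exact: locally_L1Z.
rewrite RintegralZl//; last exact: integrable_bx abO.
rewrite mulN1r; apply/eqP; rewrite subr_eq0; apply/eqP.
apply: (cvg_unique _ (cvg_int_boxbump oO (lg i) abO)) => //.
apply: cvg_trans (cvg_int_boxbump oO (lh i) abO); apply: near_eq_cvg; near=> m.
have tb := test_boxbump m abO.
by apply: oppr_inj; rewrite -ug// -uh.
Unshelve. all: by end_near. Qed.

End rV_integrals.

(** * Weak gradients and translations of boxes *)

Section shift.
Context {R : realType} {n : nat}.
Implicit Types (a b e x : 'rV[R]_n) (u v f : 'rV[R]_n -> R) (O K A B : set 'rV[R]_n).
Local Notation mu := (@lebesgue_rV R n).
Local Notation leb := (@lebesgue_measure R).
Local Notation delta i := (delta_mx ord0 i).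

Lemma derive_shift f d e x : 'D_e (fun y => f (y - d)) x = 'D_e f (x - d).
Proof.
rewrite /derive; set F := (X in lim (X @ _)); set G := (X in _ = lim (X @ _)).
suff -> : F = G by [].
by apply/funext => h; rewrite /F /G /= addrA.
Qed.

(** Differentiation under the integral sign, dominated by N |w|. All the dependence on the parameter
    is in the smooth factor [phi], so that [w] need only be integrable. *)
Lemma is_derive_int_shift B (w phi : 'rV[R]_n -> R) e (M N : R) :
  measurable B -> mu.-integrable B (EFin \o w) ->
  continuous phi -> (forall x, `|phi x| <= M) ->
  (forall x, derivable phi x e) -> (forall x, `|'D_e phi x| <= N) ->
  forall s : R, is_derive s 1 (fun t => \int[mu]_(x in B) (w x * phi (x - t *: e)))
    (\int[mu]_(x in B) (w x * - 'D_e phi (x - s *: e))).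
Proof.
move=> mB iw cphi phiM dphi DN s.
have Dt x (t : R) : is_derive t 1 (fun t : R => w x * phi (x - t *: e))
    (w x * - 'D_e phi (x - t *: e)).
  have dN : is_derive t 1 (fun t : R => - t) (- 1 : R) by exact: is_deriveN.
  have E : x - t *: e = x + (- t) *: e by rewrite scaleNr.
  have d1 := @is_derive_line R n phi x e (- t) (dphi _).
  have := is_deriveZ (w x) (@is_derive1_comp R _ (fun t : R => - t) t _ _ d1 dN).
  rewrite E mulrN1; congr is_derive; apply/funext => z.
  by change (w x * phi (x + (- z) *: e) = w x * phi (x - z *: e)); rewrite scaleNr.
have D1 : partial1of2 (fun (t : R) x => w x * phi (x - t *: e)) =
    fun t x => w x * - 'D_e phi (x - t *: e).
  apply/funext => t; apply/funext => x; rewrite partial1of2E.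
  by have [] := Dt x t.
have mphi (t : R) : measurable_fun B (fun x => phi (x - t *: e)).
  apply: (measurable_funS measurableT) => //.
  apply: (@measurableT_comp _ _ _ _ _ _ phi); last exact: measurable_shift.
  by apply: measurable_continuous_rV; [exact: openT|move=> x _; exact: cphi].
pose I : set R := `]s - 1, s + 1[%classic.
have Is : I s by rewrite /I /= in_itv/= ltrBlDr ltrDl ltr01.
have N0 : 0 <= N by apply: le_trans (DN 0).
have intf (t : R) : mu.-integrable B (EFin \o (fun x => w x * phi (x - t *: e))).
  by apply: (@integrable_mul_bounded _ _ _ _ _ _ _ M).
have df1 (t : R) x : I t -> B x -> derivable ((fun (t : R) x => w x * phi (x - t *: e)) ^~ x) t 1.
  by move=> _ _; have [] := Dt x t.
have intG : mu.-integrable B (EFin \o (fun x => N * `|w x|)).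
  have := integrableZl mB N (integrable_norm iw); exact.
have G0 x : 0 <= N * `|w x| by rewrite mulr_ge0.
have Gub t x : I t -> B x ->
    `|partial1of2 (fun (t : R) x => w x * phi (x - t *: e)) t x| <= N * `|w x|.
  by move=> _ _; rewrite D1 normrM normrN mulrC ler_wpM2r.
have dd := @derivable_under_integral R _ _ mu _ B mB s _ _ Is (fun t _ => intf t) df1 _ G0 intG Gub.
have dE := @differentiation_under_integral R _ _ mu _ B mB s _ _ Is (fun t _ => intf t) df1 _ G0 intG Gub.
by apply: DeriveDef => //; rewrite -derive1E dE D1.
Qed.

Section identity.
Variables (O : set 'rV[R]_n) (u : 'rV[R]_n -> R) (g : 'rV[R]_n -> 'rV[R]_n).
Hypotheses (oO : open O) (lu : locally_L1 O u) (gu : is_gradient O u g).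
Variables (i : 'I_n) (a b : 'rV[R]_n) (h : R).
Hypotheses (h0 : 0 < h) (hullO : cbx a (b + h *: delta i) `<=` O).

Let lg := gu.1 i.
Let B := cbx a (b + h *: delta i).
Let mB : measurable B. Proof. exact: measurable_cbx. Qed.
Let iu : mu.-integrable B (EFin \o u). Proof. exact: integrable_cbx hullO. Qed.
Let ig : mu.-integrable B (EFin \o (fun x => g x ord0 i)).
Proof. exact: integrable_cbx hullO. Qed.

Let sub (s : R) : `[0, h]%classic s -> cbx (a + s *: delta i) (b + s *: delta i) `<=` B.
Proof.
rewrite /= in_itv/= => /andP[s0 sh] x /cbxP H; apply/cbxP => j; have := H j.
rewrite !mxE eqxx /=; case: eqP => _; rewrite ?mulr1 ?mulr0 ?addr0// => /andP[h1 h2].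
by apply/andP; split; lra.
Qed.

Let phi_ m s x : boxbump a b m (x - s *: delta i) =
  boxbump (a + s *: delta i) (b + s *: delta i) m x.
Proof. by rewrite boxbump_shift. Qed.

Let cvg_int f (s : R) : `[0, h]%classic s -> locally_L1 O f ->
  \int[mu]_(x in B) (f x * boxbump a b m (x - s *: delta i)) @[m --> \oo] -->
  \int[mu]_(x in bx (a + s *: delta i) (b + s *: delta i)) f x.
Proof.
move=> hs lf; have sO := subset_trans (sub hs) hullO.
apply: cvg_trans (cvg_int_boxbump oO lf sO); apply: near_eq_cvg; near=> m.
rewrite (@Rintegral_subset _ _ _ mu O B (fun x => f x * boxbump (a + s *: delta i) (b + s *: delta i) m x) hullO).
  by apply: eq_Rintegral => x _; rewrite phi_.
move=> x _ Bx; rewrite boxbump_eq0 ?mulr0// => ox; apply: Bx.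
by apply: (sub hs); apply: bx_cbx; exact: obx_bx.
Unshelve. all: by end_near. Qed.

Let tb m := @test_boxbump R n _ a b m (@subset_refl _ _).

(** The derivative in [s] falls on the bump, as minus its partial derivative, and the definition of
    the weak gradient transfers it to [u]. The translated bump is supported in [O] precisely because
    [s] lies in [0, h]. *)
Let derU m (s : R) : `[0, h]%classic s ->
  is_derive s 1 (fun t => \int[mu]_(x in B) (u x * boxbump a b m (x - t *: delta i)))
  (\int[mu]_(x in B) (g x ord0 i * boxbump a b m (x - s *: delta i))).
Proof.
move=> hs; have [M _ HM] := test_bounded (tb m).
have [N _ HN] := partial_bounded (tb m) i.
have cphi := test_continuous (tb m).
have dphi x := @test_derivable R n _ _ (tb m) i x.
have D := is_derive_int_shift mB iu cphi HM dphi HN s.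
apply: (is_derive_eq D).
have sO := subset_trans (sub hs) hullO.
have := gu.2 _ (test_boxbump m sO) i.
have K0 f : (forall x, ~ cbx (a + s *: delta i) (b + s *: delta i) x -> f x = 0) ->
    \int[mu]_(x in O) f x = \int[mu]_(x in B) f x.
  by move=> f0; apply: Rintegral_subset => // x _ Bx; apply: f0 => /(sub hs).
rewrite K0; last first.
  move=> x Bx; rewrite partial_eq0 ?mulr0// => /closure_boxbump.
  exact: Bx.
rewrite K0; last first.
  move=> x Bx; rewrite boxbump_eq0 ?mulr0// => ox; apply: Bx.
  by apply: bx_cbx; exact: obx_bx.
move=> E; have -> : \int[mu]_(x in B) (g x ord0 i * boxbump a b m (x - s *: delta i)) =
    \int[mu]_(x in B) (g x ord0 i * boxbump (a + s *: delta i) (b + s *: delta i) m x).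
  by apply: eq_Rintegral => x _; rewrite phi_.
rewrite -[RHS]opprK -E -mulN1r.
have pE x : partial i (boxbump (a + s *: delta i) (b + s *: delta i) m) x =
    'D_(delta i) (boxbump a b m) (x - s *: delta i).
  have F : boxbump (a + s *: delta i) (b + s *: delta i) m =
      fun y => boxbump a b m (y - s *: delta i) by apply/funext => y; rewrite phi_.
  rewrite /partial F; exact: derive_shift.
rewrite -RintegralZl//; last first.
  apply: (@integrable_mul_bounded _ _ _ _ _ _ _ N) => //.
    by apply: (measurable_funS measurableT) => //; apply: measurable_continuous_rV;
      [exact: openT|move=> x _; exact: (test_partial_continuous (test_boxbump m sO))].
  by move=> x _; rewrite pE; exact: HN.
by apply: eq_Rintegral => x _; rewrite pE; ring.
Qed.

Let contV m : continuous (fun t : R => \int[mu]_(x in B) (g x ord0 i * boxbump a b m (x - t *: delta i))).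
Proof.
have [M _ HM] := test_bounded (tb m).
have [N _ HN] := partial_bounded (tb m) i.
have cphi := test_continuous (tb m).
have dphi x := @test_derivable R n _ _ (tb m) i x.
exact: is_derive_continuous (is_derive_int_shift mB ig cphi HM dphi HN).
Qed.

Let contU m : continuous (fun t : R => \int[mu]_(x in B) (u x * boxbump a b m (x - t *: delta i))).
Proof.
have [M _ HM] := test_bounded (tb m).
have [N _ HN] := partial_bounded (tb m) i.
have cphi := test_continuous (tb m).
have dphi x := @test_derivable R n _ _ (tb m) i x.
exact: is_derive_continuous (is_derive_int_shift mB iu cphi HM dphi HN).
Qed.

Let FTC m : \int[leb]_(s in `[0, h])
    (\int[mu]_(x in B) (g x ord0 i * boxbump a b m (x - s *: delta i))) =
  \int[mu]_(x in B) (u x * boxbump a b m (x - h *: delta i)) -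
  \int[mu]_(x in B) (u x * boxbump a b m (x - 0 *: delta i)).
Proof.
set V := fun s : R => \int[mu]_(x in B) (g x ord0 i * boxbump a b m (x - s *: delta i)).
set U := fun s : R => \int[mu]_(x in B) (u x * boxbump a b m (x - s *: delta i)).
have sub' s : s \in `]0, h[ -> `[0, h]%classic s.
  by rewrite /= !in_itv/= => /andP[/ltW -> /ltW ->].
rewrite /Rintegral -[LHS]/(fine (\int[leb]_(s in `[0, h]) (V s)%:E)).
rewrite (@continuous_FTC2 R V U)//.
- by apply: continuous_subspaceT; exact: contV.
- split; [|exact: cvg_at_right_filter (@contU m _)|exact: cvg_at_left_filter (@contU m _)].
  by move=> s /sub' hs; have [] := derU m hs.
- by move=> s /sub' hs; rewrite derive1E; have [] := derU m hs.
Qed.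

(* The integral of [u] against the m-th bump of the box translated by [s] has a
   derivative in [s] equal to the integral of the gradient against that bump, and
   the bumps tend to the indicator of the box. *)
Lemma shift_identity :
  leb.-integrable `[0, h] (EFin \o fun s : R =>
    \int[mu]_(x in bx (a + s *: delta i) (b + s *: delta i)) g x ord0 i) /\
  \int[mu]_(x in bx (a + h *: delta i) (b + h *: delta i)) u x -
  \int[mu]_(x in bx a b) u x =
  \int[leb]_(s in `[0, h])
    \int[mu]_(x in bx (a + s *: delta i) (b + s *: delta i)) g x ord0 i.
Proof.
have mI : measurable (`[0, h]%classic : set (measurableTypeR R)) by exact: measurable_itv.
pose C := \int[mu]_(x in B) `|g x ord0 i|.
have iC : leb.-integrable `[0, h] (EFin \o (cst C : R -> R)).
  apply: measurable_bounded_integrable => //; last exact: bounded_cst.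
  by rewrite /= lebesgue_measure_itv /=; case: ifP => _; rewrite ltry.
have mV m : measurable_fun (`[0, h]%classic : set (measurableTypeR R)) (fun s : R =>
    \int[mu]_(x in B) (g x ord0 i * boxbump a b m (x - s *: delta i))).
  by apply: (measurable_funS measurableT) => //; apply: continuous_measurable_fun; exact: contV.
have VC m (s : R) : `[0, h]%classic s ->
    `|\int[mu]_(x in B) (g x ord0 i * boxbump a b m (x - s *: delta i))| <= C.
  move=> hs.
  have ii : mu.-integrable B (EFin \o (fun x => g x ord0 i * boxbump a b m (x - s *: delta i))).
    apply: (@integrable_mul_bounded _ _ _ _ _ _ _ 1) => //.
      apply: (measurable_funS measurableT) => //.
      under eq_fun do rewrite phi_.
      by apply: measurable_boxbump; exact: openT.
    by move=> x _; rewrite ger0_norm ?boxbump_ge0 ?boxbump_le1.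
  apply: (le_trans (le_normr_Rintegral mB ii)).
  apply: le_Rintegral => //; [exact: integrable_norm|exact: integrable_norm|].
  by move=> x _; rewrite normrM (ger0_norm (boxbump_ge0 _ _ _ _)) ler_piMr// boxbump_le1.
have [iV cV] := dominated_cvgR (f_ := fun m (s : measurableTypeR R) =>
  \int[mu]_(x in B) (g x ord0 i * boxbump a b m (x - (s : R) *: delta i))) mI mV
  (fun s hs => cvg_int hs lg) iC VC.
(* Both sides of [FTC] converge as [m] grows; their limits are the two sides of the identity. *)
split => //; apply: cvg_unique cV => //.
have I0 : `[0, h]%classic (0 : R) by rewrite /= in_itv/= lexx ltW.
have Ih : `[0, h]%classic h by rewrite /= in_itv/= lexx ltW.
have H : \int[mu]_(x in B) (u x * boxbump a b m (x - h *: delta i)) -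
  \int[mu]_(x in B) (u x * boxbump a b m (x - 0 *: delta i)) @[m --> \oo] -->
  \int[mu]_(x in bx (a + h *: delta i) (b + h *: delta i)) u x -
  \int[mu]_(x in bx a b) u x.
  apply: cvgB; first exact: cvg_int.
  by have := cvg_int I0 lu; rewrite !scale0r !addr0.
apply: cvg_trans H; apply: near_eq_cvg; near=> m.
exact/esym/FTC.
Unshelve. all: by end_near.
Qed.

Lemma shift_le C : \int[mu]_(x in B) `|g x ord0 i| <= C ->
  `|\int[mu]_(x in bx (a + h *: delta i) (b + h *: delta i)) u x -
  \int[mu]_(x in bx a b) u x| <= C * h.
Proof.
move=> gC; have [iV ->] := shift_identity.
have mI : measurable (`[0, h]%classic : set (measurableTypeR R)) by exact: measurable_itv.
have lI : leb (`[0, h]%classic : set R) = h%:E.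
  by rewrite lebesgue_measure_itv /= lte_fin h0 oppr0 adde0.
apply: (le_trans (@Rintegral_bound _ _ _ leb `[0, h] _ C mI _ iV _)).
- by rewrite [X in (X < _)%E]lI ltry.
- move=> s hs; apply: le_trans gC.
  have sO := subset_trans (sub hs) hullO.
  have ib := integrable_bx oO lg sO.
  have mb := @measurable_bx R n (a + s *: delta i) (b + s *: delta i).
  apply: (le_trans (le_normr_Rintegral mb ib)).
  apply: le_Rintegral_subset => //.
  by move=> x /bx_cbx /(sub hs).
- by rewrite [X in fine X]lI.
Qed.

End identity.
End shift.

(** * Fubini's theorem for real integrals, and averages of translates *)

Section Rfubini.
Local Open Scope ring_scope.

(** An integrable extended function is finite almost everywhere, so [fine] changes it only on a
    negligible set. *)
Lemma integrable_fine d (T : measurableType d) (R : realType)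
    (mu : {measure set T -> \bar R}) (f : T -> \bar R) :
  mu.-integrable setT f ->
  mu.-integrable setT (EFin \o (fine \o f)) /\
  \int[mu]_x fine (f x) = fine (\int[mu]_x f x)%E.
Proof.
move=> intf; have mf := measurable_int _ intf.
have mff : measurable_fun setT (EFin \o (fine \o f)).
  by apply/measurable_EFinP; apply: measurableT_comp.
split.
  apply: le_integrable intf => // x _.
  by rewrite /comp; case: (f x) => [r| |]; rewrite ?leey //= normr0 leey.
congr fine; apply: ae_eq_integral => //.
have := integrable_ae measurableT intf; apply: filterS => x H Tx.
by rewrite /= fineK// H.
Qed.

Context d1 d2 (T1 : measurableType d1) (T2 : measurableType d2) (R : realType).
Variable m1 : {sigma_finite_measure set T1 -> \bar R}.
Variable m2 : {sigma_finite_measure set T2 -> \bar R}.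

Lemma Rfubini (F : T1 * T2 -> R) : (m1 \x m2)%E.-integrable setT (EFin \o F) ->
  [/\ m1.-integrable setT (EFin \o (fun x => \int[m2]_y F (x, y))),
      m2.-integrable setT (EFin \o (fun y => \int[m1]_x F (x, y))) &
      \int[m1]_x (\int[m2]_y F (x, y)) = \int[m2]_y (\int[m1]_x F (x, y))].
Proof.
move=> iF; have [i1 e1] := integrable_fine (integrable_fubini_F iF).
have mF := measurable_int _ iF.
have iG : m2.-integrable setT (fubini_G m1 (EFin \o F)).
  apply/integrableP; split; first exact: (measurable_fubini_G iF).
  apply: le_lt_trans ((integrable21ltyP m1 m2 mF).1 iF).
  apply: ge0_le_integral => //.
  - by apply: measurableT_comp => //; exact: (measurable_fubini_G iF).
  - apply: (@measurable_fun_fubini_tonelli_G _ _ _ _ _ m1 (fun z => `|(F z)%:E|%E)) => //.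
    exact: measurableT_comp.
  - move=> y _; apply: le_abse_integral => //.
    exact: (measurableT_comp mF (measurable_pair2 y)).
have [i2 e2] := integrable_fine iG.
split => //; rewrite [LHS]e1 [RHS]e2; congr fine.
exact: (Fubini iF).
Qed.

End Rfubini.

Section Fubini_shift.
Context {R : realType} {n : nat} d (Y : measurableType d).
Variable nu : {sigma_finite_measure set Y -> \bar R}.
Local Notation mu := (@lebesgue_rV R n).
Variables (tau : Y -> 'rV[R]_n) (Q : set Y) (f psi : 'rV[R]_n -> R) (M : R).
Hypotheses (mtau : measurable_fun setT tau) (mQ : measurable Q) (Qoo : (nu Q < +oo)%E).
Hypotheses (intf : mu.-integrable setT (EFin \o f)).
Hypotheses (mpsi : measurable_fun setT psi) (psiM : forall x, `|psi x| <= M).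

(** By translation invariance, for each [y] the integral of |psi(x) f(x + tau y)| in [x] is at most
    [M] times that of |f|. As [Q] has finite measure, the integrand is integrable on the product. *)
Lemma Fubini_shift :
  [/\ mu.-integrable setT (EFin \o (fun x => \int[nu]_(y in Q) (psi x * f (x + tau y)))),
      nu.-integrable Q (EFin \o (fun y => \int[mu]_x (psi x * f (x + tau y)))) &
      \int[mu]_x (\int[nu]_(y in Q) (psi x * f (x + tau y))) =
      \int[nu]_(y in Q) (\int[mu]_x (psi x * f (x + tau y)))].
Proof.
have mf : measurable_fun setT f by have /integrableP[/measurable_EFinP] := intf.
have M0 : 0 <= M by apply: le_trans (psiM 0).
(* The indicator of [Q] is part of the integrand, so that Fubini applies on the whole product
   space. *)
pose F (z : 'rV[R]_n * Y) : R := \1_Q z.2 * (psi z.1 * f (z.1 + tau z.2)).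
have mF : measurable_fun setT F.
  apply: measurable_funM.
    by apply: (@measurableT_comp _ _ _ _ _ _ (\1_Q : Y -> R)) => //; exact: measurable_indic.
  apply: measurable_funM; first exact: measurableT_comp.
  apply: (@measurableT_comp _ _ _ _ _ _ f) => //.
  apply: measurable_fun_rVP => i; under eq_fun do rewrite mxE.
  apply: measurable_funD.
    exact: (measurableT_comp (measurable_rV_coord i) measurable_fst).
  apply: (measurableT_comp (measurable_rV_coord i)).
  exact: measurableT_comp.
have iF : (mu \x nu)%E.-integrable setT (EFin \o F).
  apply/integrable21ltyP; first exact/measurable_EFinP.
  pose C := (M%:E * \int[mu]_x `|f x|%:E)%E.
  have foo : (\int[mu]_x `|f x|%:E < +oo)%E by have /integrableP[] := intf.
  have mnf (y : Y) : measurable_fun setT (fun x : 'rV[R]_n => `|f (x + tau y)|%:E).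
    apply/measurable_EFinP; apply: measurableT_comp => //.
    by apply: (@measurableT_comp _ _ _ _ _ _ f) => //; exact: measurable_shift.
  apply: (@le_lt_trans _ _ (\int[nu]_y (C * (\1_Q y)%:E))%E).
    apply: ge0_le_integral => //.
    - by move=> y _; exact: integral_ge0.
    - apply: (@measurable_fun_fubini_tonelli_G _ _ _ _ _ mu (fun z => `|F z|%:E)).
      + by apply/measurable_EFinP; apply: measurableT_comp.
      + by move=> z; rewrite lee_fin.
    - apply: measurable_funeM; apply/measurable_EFinP; exact: measurable_indic.
    move=> y _; apply: (@le_trans _ _ (\int[mu]_x ((M * \1_Q y)%:E * `|f (x + tau y)%R|%:E))%E).
      apply: ge0_le_integral => //.
      + apply: measurableT_comp => //; apply/measurable_EFinP.
        exact: (measurableT_comp mF (measurable_pair2 y)).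
      + exact: measurable_funeM.
      + move=> x _; rewrite -EFinM lee_fin /= !normrM mulrA (mulrC M) ler_wpM2r//.
        by rewrite ger0_norm ?indicE// ler_wpM2l.
    rewrite ge0_integralZl//; last by rewrite lee_fin mulr_ge0.
    rewrite (ge0_integral_shift (tau y) (f := fun x => `|f x|%:E))//; last first.
      by apply/measurable_EFinP; apply: measurableT_comp.
    by rewrite /C EFinM -!muleA (muleC _ (\1_Q y)%:E).
  have C0 : (0 <= C)%E by rewrite mule_ge0// integral_ge0.
  rewrite ge0_integralZl//; last by apply/measurable_EFinP; exact: measurable_indic.
  rewrite integral_indic// setIT; apply: lte_mul_pinfty => //.
  rewrite ge0_fin_numE//; apply: lte_mul_pinfty => //.
have [i1 i2 E] := Rfubini iF.
have E1 x : \int[nu]_y F (x, y) = \int[nu]_(y in Q) (psi x * f (x + tau y)).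
  rewrite [RHS]Rintegral_mkcond; congr Rintegral; apply/funext => y.
  by rewrite patch_indic /F /= mulrC.
have E2 : (fun y => \int[mu]_x F (x, y)) = (fun y => \int[mu]_x (psi x * f (x + tau y))) \_ Q.
  apply/funext => y; rewrite patch_indic /F /= indicE; case: (y \in Q) => /=.
    by rewrite mulr1; apply: eq_Rintegral => x _; rewrite mul1r.
  rewrite mulr0; under eq_Rintegral do rewrite mul0r.
  by rewrite Rintegral_cst// mul0r.
split.
- by move: i1; under eq_fun do rewrite E1.
- apply/integrable_mkcond => //; move: i2; rewrite E2.
  by rewrite restrict_EFin.
- by rewrite [RHS]Rintegral_mkcond -E2 -E; apply: eq_Rintegral => x _; rewrite E1.
Qed.

End Fubini_shift.

(** * Morrey's inequality *)

Section box_shift.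
Context {R : realType} {n : nat}.
Implicit Types (a b c e x y z d : 'rV[R]_n).
Local Notation mu := (@lebesgue_rV R n).
Local Notation delta i := (delta_mx ord0 i).
Variables (O : set 'rV[R]_n) (u : 'rV[R]_n -> R) (g : 'rV[R]_n -> 'rV[R]_n).
Hypotheses (oO : open O) (lu : locally_L1 O u) (gu : is_gradient O u g).

Lemma cbxS a b c e : (forall j, c ord0 j <= a ord0 j) -> (forall j, b ord0 j <= e ord0 j) ->
  cbx a b `<=` cbx c e.
Proof.
move=> ca be z /cbxP H; apply/cbxP => j; have /andP[h1 h2] := H j.
by rewrite (le_trans (ca j) h1) (le_trans h2 (be j)).
Qed.

Lemma box_shift1 i c e a b (t C : R) : cbx c e `<=` O ->
  (forall j, c ord0 j <= a ord0 j) -> (forall j, b ord0 j <= e ord0 j) ->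
  (forall j, c ord0 j <= (a + t *: delta i) ord0 j) ->
  (forall j, (b + t *: delta i) ord0 j <= e ord0 j) ->
  \int[mu]_(x in cbx c e) `|g x ord0 i| <= C ->
  `|\int[mu]_(x in bx (a + t *: delta i) (b + t *: delta i)) u x -
    \int[mu]_(x in bx a b) u x| <= C * `|t|.
Proof.
move=> ceO ca be ca' be' gC.
have ig := integrable_cbx oO (gu.1 i) ceO.
have le_C a' b' : cbx a' b' `<=` cbx c e -> \int[mu]_(x in cbx a' b') `|g x ord0 i| <= C.
  move=> sub; apply: le_trans gC.
  by apply: le_Rintegral_subset => //; exact: measurable_cbx.
have [t0|t0|->] := ltgtP t 0; last by rewrite scale0r !addr0 subrr !normr0 mulr0.
(* For negative [t] the roles of the two boxes are exchanged, and the shift is by [- t]. *)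
- have s : cbx (a + t *: delta i) (b + t *: delta i + (- t) *: delta i) `<=` cbx c e.
    by apply: cbxS => // j; rewrite scaleNr addrK.
  have t0' : 0 < - t by rewrite oppr_gt0.
  have := @shift_le R n O u g oO lu gu i _ _ _ t0' (subset_trans s ceO) C (le_C _ _ s).
  by rewrite !scaleNr !addrK distrC (ltr0_norm t0).
- have s : cbx a (b + t *: delta i) `<=` cbx c e by apply: cbxS.
  rewrite (gtr0_norm t0).
  exact: (@shift_le R n O u g oO lu gu i _ _ _ t0 (subset_trans s ceO) C (le_C _ _ s)).
Qed.

(** The displacement is made one coordinate after another, [D k] carrying the first [k] of them. In
    each coordinate an intermediate box coincides with one of the two end boxes, hence it stays in
    the hull. *)
Lemma box_shift c e a b d (C : R) : cbx c e `<=` O ->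
  (forall j, c ord0 j <= a ord0 j) -> (forall j, b ord0 j <= e ord0 j) ->
  (forall j, c ord0 j <= (a + d) ord0 j) ->
  (forall j, (b + d) ord0 j <= e ord0 j) ->
  (forall i, \int[mu]_(x in cbx c e) `|g x ord0 i| <= C) ->
  `|\int[mu]_(x in bx (a + d) (b + d)) u x - \int[mu]_(x in bx a b) u x| <=
  C * \sum_i `|d ord0 i|.
Proof.
move=> ceO ca be ca' be' gC.
pose D (k : nat) : 'rV[R]_n := \row_j if (j < k)%N then d ord0 j else 0.
have Dn : D n = d by apply/rowP => j; rewrite mxE ltn_ord.
have D0 : D 0 = 0 by apply/rowP => j; rewrite !mxE.
suff H k : (k <= n)%N ->
    `|\int[mu]_(x in bx (a + D k) (b + D k)) u x - \int[mu]_(x in bx a b) u x| <=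
    C * \sum_(i < n | (i < k)%N) `|d ord0 i|.
  rewrite -Dn (le_trans (H n (leqnn n)))// Dn le_eqVlt; apply/orP; left; apply/eqP.
  by congr (_ * _); apply: eq_bigl => i; rewrite ltn_ord.
elim: k => [_|k IH kn].
  by rewrite D0 !addr0 subrr normr0 big_pred0// mulr0.
have DS : D k.+1 = D k + d ord0 (Ordinal kn) *: delta (Ordinal kn).
  apply/rowP => j; rewrite !mxE eqxx /= ltnS leq_eqVlt.
  have [jk|jk] := eqVneq (j : nat) k.
    have -> : j = Ordinal kn by exact/val_inj.
    by rewrite /= eqxx ltnn mulr1 add0r.
  rewrite /= (_ : (j == Ordinal kn) = false) ?mulr0 ?addr0//.
  by apply/negbTE; apply: contra jk => /eqP ->.
have caD k' j : c ord0 j <= (a + D k') ord0 j.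
  by have := ca j; have := ca' j; rewrite !mxE; case: ifP => // _; rewrite addr0.
have beD k' j : (b + D k') ord0 j <= e ord0 j.
  by have := be j; have := be' j; rewrite !mxE; case: ifP => // _; rewrite addr0.
have sumE : \sum_(i < n | (i < k.+1)%N) `|d ord0 i| =
    `|d ord0 (Ordinal kn)| + \sum_(i < n | (i < k)%N) `|d ord0 i|.
  rewrite (bigD1 (Ordinal kn))//=; congr (_ + _); apply: eq_bigl => i.
  by rewrite -val_eqE /= ltnS ltn_neqAle andbC.
rewrite sumE mulrDr.
apply: (le_trans (ler_distD (\int[mu]_(x in bx (a + D k) (b + D k)) u x) _ _)).
apply: lerD; last exact: IH (ltnW kn).
rewrite DS !addrA; apply: (box_shift1 ceO) => //; try by move=> j; rewrite -addrA -DS.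
Qed.
End box_shift.

Section box_split.
Context {R : realType} {n : nat}.
Local Notation mu := (@lebesgue_rV R n).

Definition set_coord (a : 'rV[R]_n) (i : 'I_n) (t : R) : 'rV[R]_n :=
  \row_j if j == i then t else a ord0 j.

Lemma Rintegral_bx_split (u : 'rV[R]_n -> R) (a b : 'rV[R]_n) (i : 'I_n) (t : R) :
  a ord0 i <= t <= b ord0 i -> mu.-integrable (bx a b) (EFin \o u) ->
  \int[mu]_(x in bx a b) u x =
  \int[mu]_(x in bx a (set_coord b i t)) u x + \int[mu]_(x in bx (set_coord a i t) b) u x.
Proof.
move=> /andP[ait tbi] iu.
have E : bx a b = bx a (set_coord b i t) `|` bx (set_coord a i t) b.
  apply/seteqP; split=> x; last first.
    move=> [|] /bxP H; apply/bxP => j; have := H j; rewrite mxE; case: eqP => // ->.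
      by move=> /andP[-> h]; exact: le_trans tbi.
    by move=> /andP[h ->]; rewrite (le_lt_trans ait h).
  move=> /bxP H; have [xt|xt] := leP (x ord0 i) t; [left|right]; apply/bxP => j;
    have := H j; rewrite mxE; case: eqP => // ->.
    by move=> /andP[-> _].
  by move=> /andP[_ ->]; rewrite xt.
rewrite [in LHS]E Rintegral_setU//.
- exact: measurable_bx.
- exact: measurable_bx.
- by rewrite -E.
- apply/disj_setPS => x [/bxP H1 /bxP H2]; have := H1 i; have := H2 i.
  rewrite !mxE eqxx => /andP[h1 _] /andP[_ h2].
  by move: (lt_le_trans h1 h2); rewrite ltxx.
Qed.

End box_split.

Definition dyad {R : realType} (k : nat) : R := 2^-1 ^+ k.

Section dyad.
Context {R : realType}.
Local Notation r := (@dyad R).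

Lemma dyad_gt0 k : 0 < r k. Proof. by rewrite exprn_gt0// invr_gt0. Qed.

Lemma dyadS k : r k.+1 = r k / 2. Proof. by rewrite /dyad exprSr. Qed.

Lemma dyad_le k l : (k <= l)%N -> r l <= r k.
Proof.
by move=> kl; apply: ler_wiXn2l => //; rewrite invf_le1 ?ler1n.
Qed.

Lemma dyad_cvg0 : r @ \oo --> (0 : R).
Proof. by apply: cvg_expr; rewrite gtr0_norm ?invf_lt1 ?ltr1n. Qed.

Lemma dyad_small (e : R) : 0 < e -> exists k, r k < e.
Proof.
move=> e0; have /cvgrPdist_lt/(_ e e0)[k _ /(_ k (leqnn k))] := dyad_cvg0.
by rewrite /= sub0r normrN gtr0_norm ?dyad_gt0// => ?; exists k.
Qed.

Context {n : nat}.
Local Notation mu := (@lebesgue_rV R n).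

Lemma rV_coord_le_norm (x : 'rV[R]_n) j : `|x ord0 j| <= `|x|.
Proof.
change (`|x ord0 j| <= mx_norm x); rewrite mx_normrE.
exact: (@le_bigmax _ R _ 0 (fun i : 'I_1 * 'I_n => `|x i.1 i.2|) (ord0, j)).
Qed.

(** Compactness makes the scale [k] uniform over [K]. The factor 2 leaves room for a cube of side
    [r k] whose lower corner is the coordinatewise minimum of two points that are [r k / 2]
    apart. *)
Lemma compact_room (K O : set 'rV[R]_n) : compact K -> open O -> K `<=` O ->
  exists k, forall x z : 'rV[R]_n, K x -> (forall j, `|z ord0 j - x ord0 j| <= 2 * r k) -> O z.
Proof.
move=> /compact_near_coveringP cK oO KO.
pose P (k : nat) (x : 'rV[R]_n) :=
  forall z : 'rV[R]_n, (forall j, `|z ord0 j - x ord0 j| <= 2 * r k) -> O z.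
suff [k _ H] : \forall k \near \oo, K `<=` P k.
  by exists k => x z Kx; apply: (H k) => //=.
apply: cK => x Kx.
have /nbhs_ballP[_/posnumP[e] xO] : nbhs x O by apply: open_nbhs_nbhs; split => //; exact: KO.
(* 2 r k is then below e/2; the other half of [e] is spent on the distance from [x] to a
   neighbour. *)
have e4 : 0 < e%:num / 4 by rewrite divr_gt0.
have [k0 hk0] := dyad_small e4.
exists (ball x (e%:num / 2), [set k | (k0 <= k)%N]) => /=.
  by split; [apply: nbhsx_ballx; rewrite divr_gt0|exists k0].
move=> [y k] /= [[_ xy] k0k] z yz; apply: xO; split => // i j; rewrite (ord1 i).
have := xy ord0 j; have := yz j; have := dyad_le k0k.
rewrite /ball /= => h1; rewrite !ltr_norml ler_norml => /andP[? ?] /andP[? ?].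
by apply/andP; split; lra.
Qed.

Lemma continuous_locally_L1 (O : set 'rV[R]_n) (f : 'rV[R]_n -> R) : open O ->
  (forall x, O x -> {for x, continuous f}) -> locally_L1 O f.
Proof.
move=> oO cf; split; first exact: measurable_continuous_rV.
move=> K KO cK; have mK := measurable_compact cK.
have : bounded_set (f @` K).
  apply: compact_bounded; apply: continuous_compact => //.
  apply: continuous_in_subspaceT => x; rewrite inE => /KO; exact: cf.
move=> [M [_ HM]].
have Koo : (mu K < +oo)%E.
  have [M' [_ HM']] := compact_bounded cK.
  pose N : R := `|M'| + 1.
  have KN : K `<=` cbx (const_mx (- N)) (const_mx N).
    move=> x Kx; apply/cbxP => j; rewrite !mxE -ler_norml.
    have : `|x| <= N by apply: HM' => //; rewrite (le_lt_trans (ler_norm _))// ltrDl.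
    exact: le_trans (rV_coord_le_norm _ _).
  apply: le_lt_trans (mu_bx_lty (const_mx (- N)) (const_mx N)).
  rewrite -[X in (_ <= X)%E]mu_cbx; apply: le_measure; rewrite ?inE//.
  exact: measurable_cbx.
apply: (@le_lt_trans _ _ (\int[mu]_(x in K) (`|M| + 1)%:E)%E).
  apply: ge0_le_integral => //.
    by apply/measurable_EFinP; apply: measurableT_comp => //;
      apply: measurable_funS (measurable_continuous_rV oO cf) => //; exact: open_measurable_rV.
  move=> x Kx; rewrite lee_fin; apply: (HM (`|M| + 1)); last by exists x.
  by rewrite (le_lt_trans (ler_norm _))// ltrDl.
by rewrite integral_cst// lte_mul_pinfty// lee_fin addr_ge0.
Qed.

End dyad.

(** Let D k = c rho^k / (1 - rho), the tail of the geometric series. Then b - D increases and b + D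
    decreases, and D tends to 0, so the limit of b + D is that of b and lies within D 0 of b 0. *)
Lemma geometric_increments (R : realType) (b : nat -> R) (c rho : R) :
  0 <= c -> 0 < rho < 1 -> (forall k, `|b k.+1 - b k| <= c * rho ^+ k) ->
  exists l : R, b @ \oo --> l /\ `|l - b 0| <= c / (1 - rho).
Proof.
move=> c0 /andP[rho0 rho1] H; have r1 : 0 < 1 - rho by rewrite subr_gt0.
pose D k := c / (1 - rho) * rho ^+ k.
have DS k : D k - D k.+1 = c * rho ^+ k.
  by rewrite /D exprS; field; rewrite gt_eqF.
have D0 k : 0 <= D k by rewrite /D mulr_ge0 ?divr_ge0 ?exprn_ge0// ltW.
have Dcvg : D @ \oo --> (0 : R).
  rewrite -(mulr0 (c / (1 - rho))); apply: cvgM; first exact: cvg_cst.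
  by apply: cvg_expr; rewrite gtr0_norm.
have ndq : nondecreasing_seq (fun k => b k - D k).
  apply/nondecreasing_seqP => k; have := H k; rewrite ler_norml => /andP[h _].
  by have := DS k; lra.
have nip : nonincreasing_seq (fun k => b k + D k).
  apply/nonincreasing_seqP => k; have := H k; rewrite ler_norml => /andP[_ h].
  by have := DS k; lra.
have lb k : b 0 - D 0 <= b k + D k.
  by have := ndq 0%N k (leq0n k); have := D0 k; lra.
have cp : cvgn (fun k => b k + D k).
  by apply: nonincreasing_is_cvgn => //; exists (b 0 - D 0) => _ [k _ <-].
exists (limn (fun k => b k + D k)); split.
  have cD : b k + D k - D k @[k --> \oo] --> limn (fun k => b k + D k) - 0.
    exact: (cvgB cp Dcvg).
  rewrite subr0 in cD; apply: cvg_trans cD; apply: near_eq_cvg.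
  by near=> k; rewrite /= addrK.
rewrite ler_norml; apply/andP; split.
  have : b 0 - D 0 <= limn (fun k => b k + D k) by apply: limr_ge => //; exact: nearW.
  by rewrite /D expr0 mulr1; lra.
have := nonincreasing_cvgn_ge nip cp 0; rewrite /D expr0 mulr1; lra.
Unshelve. all: by end_near. Qed.

Section cube_hull.
Context {R : realType}.
Implicit Types x y z r : R.

(** In one coordinate: the interval of length [r] that starts at the minimum of [x] and [y] contains
    the intervals of length r/2 that start at [x] and at [y], and stays within 2 r of [x]. *)
Lemma cube_hull_norm x y z r : 0 < r -> `|y - x| <= r / 2 ->
  Num.min x y <= z <= Num.min x y + r -> `|z - x| <= 2 * r.
Proof.
rewrite !ler_norml => r0 /andP[? ?].
by case: (leP x y) => ? /andP[? ?]; apply/andP; split; lra.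
Qed.

Lemma cube_hull_lex x y r : `|y - x| <= r / 2 -> x + r / 2 <= Num.min x y + r.
Proof. by rewrite !ler_norml => /andP[? ?]; case: (leP x y) => ?; lra. Qed.

Lemma cube_hull_ley x y r : `|y - x| <= r / 2 -> x + r / 2 + (y - x) <= Num.min x y + r.
Proof. by rewrite !ler_norml => /andP[? ?]; case: (leP x y) => ?; lra. Qed.

Lemma cube_norm x z r : 0 < r -> x <= z <= x + r / 2 -> `|z - x| <= 2 * r.
Proof. by move=> r0 /andP[? ?]; rewrite ler_norml; apply/andP; split; lra. Qed.

Lemma cube_norm2 x y z r : 0 < r -> `|y - x| <= r / 2 -> y <= z <= y + r / 2 ->
  `|z - x| <= 2 * r.
Proof.
by rewrite !ler_norml => r0 /andP[? ?] /andP[? ?]; apply/andP; split; lra.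
Qed.

End cube_hull.

Section Morrey.
Context {R : realType} {n : nat}.
Implicit Types (a b c e x y z d : 'rV[R]_n).
Local Notation mu := (@lebesgue_rV R n).
Local Notation delta i := (delta_mx ord0 i).
Variables (O : set 'rV[R]_n) (u : 'rV[R]_n -> R) (g : 'rV[R]_n -> 'rV[R]_n).
Hypotheses (oO : open O) (lu : locally_L1 O u) (gu : is_gradient O u g).
Variables (B rho : R).
Hypotheses (B0 : 0 <= B) (rho01 : 0 < rho < 1).

Local Notation r := (@dyad R).
Local Notation cst_mx := (const_mx : R -> 'rV[R]_n).

(** The mean of |g_i| over a cube, times its side, decays geometrically in the scale. For a bounded
    gradient rho = 1/2; for a gradient in L^p it is 2^-(1 - n/p), which is below 1 when p > n. *)
Hypothesis Hcube : forall k a i, cbx a (a + cst_mx (r k)) `<=` O ->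
  \int[mu]_(x in cbx a (a + cst_mx (r k))) `|g x ord0 i| * r k <= B * rho ^+ k * r k ^+ n.

(** The point [x] is the lower corner of the cube, and stays so when the sides are halved. *)
Definition avg k x := \int[mu]_(y in bx x (x + cst_mx (r k))) u y / r k ^+ n.

(* The cube is halved along one axis at a time: the two halves of each box are
   translates of each other, so halving changes the average by a shift. *)
Lemma avg_step k x : cbx x (x + cst_mx (r k)) `<=` O ->
  `|avg k.+1 x - avg k x| <= 2 ^+ n * B * rho ^+ k.
Proof.
move=> xO; have rk := @dyad_gt0 R k; have rk1 := @dyad_gt0 R k.+1.
pose D := B * rho ^+ k * r k ^+ n; pose C := D / r k.
have rho0 : 0 <= rho ^+ k by case/andP: rho01 => /ltW ? _; exact: exprn_ge0.
have D0 : 0 <= D by rewrite /D !mulr_ge0// exprn_ge0// ltW.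
have gC i : \int[mu]_(x in cbx x (x + cst_mx (r k))) `|g x ord0 i| <= C.
  by rewrite /C ler_pdivlMr//; exact: Hcube.
(* The first [i] sides are halved. The weight 2^i in [m i] compensates the loss of volume, so that m
   i / r k ^ n is the average over that box. *)
pose ell i : 'rV[R]_n := \row_(j < n) if (j < i)%N then r k.+1 else r k.
pose m i := 2 ^+ i * \int[mu]_(y in bx x (x + ell i)) u y.
have ell_le i j : (x + ell i) ord0 j <= (x + cst_mx (r k)) ord0 j.
  by rewrite !mxE lerD2l; case: ifP => // _; exact: dyad_le.
have H i : (i <= n)%N -> `|m i - m 0| <= (2 ^+ i - 1) * D.
  elim: i => [_|i IH ni]; first by rewrite !subrr normr0 mul0r.
  apply: (le_trans (ler_distD (m i) _ _)).
  rewrite (_ : (2 ^+ i.+1 - 1) * D = 2 ^+ i * D + (2 ^+ i - 1) * D); last first.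
    by rewrite exprS; ring.
  apply: lerD; last exact: IH (ltnW ni).
  pose o := Ordinal ni.
  have io := integrable_bx oO lu (subset_trans (@cbxS _ _ _ _ _ _ (fun=> lexx _) (ell_le i)) xO).
  rewrite /m (@Rintegral_bx_split _ _ _ x (x + ell i) o (x ord0 o + r k.+1))//; last first.
    by rewrite !mxE ltnn !lerD2l lerDl (ltW rk1) /=; exact: dyad_le.
  have ellS j : j != o -> ell i.+1 ord0 j = ell i ord0 j.
    by rewrite -val_eqE !mxE /= ltnS leq_eqVlt => /negbTE ->.
  have ello : ell i.+1 ord0 o = r k.+1 by rewrite mxE ltnSn.
  have ello' : ell i ord0 o = r k by rewrite mxE ltnn.
  have -> : set_coord (x + ell i) o (x ord0 o + r k.+1) = x + ell i.+1.
    apply/rowP => j; rewrite mxE; case: (eqVneq j o) => [->|jo].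
      by rewrite [RHS]mxE ello.
    by rewrite mxE [RHS]mxE ellS.
  have -> : bx (set_coord x o (x ord0 o + r k.+1)) (x + ell i) =
      bx (x + r k.+1 *: delta o) (x + ell i.+1 + r k.+1 *: delta o).
    congr bx; apply/rowP => j; rewrite !mxE eqxx /=; case: (eqVneq j o) => [->|jo];
      rewrite ?mulr1 ?mulr0 ?addr0//.
      by rewrite /= ltnn ltnSn -addrA dyadS -splitr.
    by have := ellS _ jo; rewrite !mxE => ->.
  set J := Rintegral _ _ _; set J' := Rintegral _ _ _.
  have -> : 2 ^+ i.+1 * J - 2 ^+ i * (J + J') = 2 ^+ i * (J - J') by rewrite exprS; ring.
  rewrite normrM ger0_norm ?exprn_ge0// ler_wpM2l ?exprn_ge0// distrC.
  apply: (@le_trans _ _ (C * `|r k.+1|)).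
    apply: (box_shift1 oO lu gu xO) => //.
    - move=> j; rewrite !mxE eqxx /= lerDl; case: eqP => _; rewrite ?mulr1 ?mulr0//.
      exact: ltW.
    - move=> j; rewrite 2!mxE; case: (eqVneq j o) => [->|jo].
        by rewrite ello !mxE !eqxx mulr1 -addrA dyadS -splitr.
      rewrite ellS// [X in _ + _ + X]mxE [X in _ * X]mxE (negbTE jo) andbF mulr0 addr0.
      by have := ell_le i j; rewrite mxE.
  rewrite gtr0_norm// dyadS /C mulrA divfK ?gt_eqF// ler_pdivrMr// ler_peMr//.
  by rewrite ler1n.
have rkn : 0 < r k ^+ n by exact: exprn_gt0.
have ell0 : ell 0 = cst_mx (r k) by apply/rowP => j; rewrite !mxE.
have elln : ell n = cst_mx (r k.+1) by apply/rowP => j; rewrite !mxE ltn_ord.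
have -> : avg k x = m 0 / r k ^+ n by rewrite /m ell0 expr0 mul1r.
have -> : avg k.+1 x = m n / r k ^+ n.
  rewrite /m elln /avg; set J := Rintegral _ _ _.
  by rewrite dyadS expr_div_n invf_div mulrA (mulrC J).
rewrite -mulrBl normrM normfV (gtr0_norm rkn) ler_pdivrMr//.
apply: (le_trans (H n (leqnn n))).
rewrite /D !mulrA ler_wpM2r ?(ltW rkn)// ler_wpM2r// ler_wpM2r//.
by rewrite gerBl.
Qed.

(** The precise representative of [u]; at each point of [O] the limit exists by [avglim_avg]. *)
Definition avglim x : R := limn (avg ^~ x).

Let K := 2 ^+ n * B / (1 - rho).

Let rho_ge0 k : 0 <= rho ^+ k.
Proof. by case/andP: rho01 => /ltW ? _; exact: exprn_ge0. Qed.

Lemma avglim_avg k x : cbx x (x + cst_mx (r k)) `<=` O ->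
  (avg ^~ x) @ \oo --> avglim x /\ `|avglim x - avg k x| <= K * rho ^+ k.
Proof.
move=> xO.
have [||l [cl lb]] := @geometric_increments R (fun l => avg (l + k) x)
  (2 ^+ n * B * rho ^+ k) rho _ rho01 _.
- by rewrite !mulr_ge0// exprn_ge0.
- move=> l; rewrite -mulrA -exprD (addnC k) addSn; apply: avg_step.
  apply: subset_trans xO; apply: cbxS => // j; rewrite !mxE lerD2l.
  exact: dyad_le (leq_addl _ _).
have cl' : (avg ^~ x) @ \oo --> l by rewrite -(cvg_shiftn k).
have lE : avglim x = l by exact/cvg_lim.
by rewrite lE; split => //; move: lb; rewrite add0n /K mulrAC.
Qed.

(** Each limit is within K rho^k of the average over the cube of side [r k.+1] at its point, and
    these two cubes are translates of each other inside a common cube of side [r k]. *)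
Lemma avglim_holder k x y :
  (forall z, (forall j, `|z ord0 j - x ord0 j| <= 2 * r k) -> O z) ->
  (forall j, `|y ord0 j - x ord0 j| <= r k.+1) ->
  `|avglim y - avglim x| <= (n%:R * 2 ^+ n * B + 2 * K) * rho ^+ k.
Proof.
move=> xO xy; have rk := @dyad_gt0 R k; have rk1 := @dyad_gt0 R k.+1.
have rS := @dyadS R k.
have xyj j : `|y ord0 j - x ord0 j| <= r k / 2 by rewrite -rS.
have xO' : cbx x (x + cst_mx (r k.+1)) `<=` O.
  by move=> z /cbxP H; apply: xO => j; apply: cube_norm => //; have := H j; rewrite !mxE rS.
have yO' : cbx y (y + cst_mx (r k.+1)) `<=` O.
  move=> z /cbxP H; apply: xO => j; apply: (@cube_norm2 _ _ (y ord0 j)) => //.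
  by have := H j; rewrite !mxE rS.
have [_ hx] := avglim_avg xO'; have [_ hy] := avglim_avg yO'.
have K0 : 0 <= K.
  rewrite /K divr_ge0 ?mulr_ge0 ?exprn_ge0// subr_ge0.
  by case/andP: rho01 => _ /ltW.
have rhoS : rho ^+ k.+1 <= rho ^+ k.
  by case/andP: rho01 => h1 h2; rewrite ler_wiXn2l// ltW.
have KS : K * rho ^+ k.+1 <= K * rho ^+ k by rewrite ler_wpM2l.
suff H : `|avg k.+1 y - avg k.+1 x| <= n%:R * 2 ^+ n * B * rho ^+ k.
  apply: (le_trans (ler_distD (avg k.+1 y) _ _)).
  rewrite (_ : _ * _ = K * rho ^+ k + (n%:R * 2 ^+ n * B * rho ^+ k + K * rho ^+ k)); last by ring.
  apply: lerD; first exact: (le_trans hy KS).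
  apply: (le_trans (ler_distD (avg k.+1 x) _ _)); apply: lerD => //.
  by rewrite distrC; apply: (le_trans hx KS).
rewrite /avg -mulrBl normrM normfV.
have rkn : 0 < r k.+1 ^+ n by rewrite exprn_gt0.
rewrite (gtr0_norm rkn) ler_pdivrMr//.
pose c : 'rV[R]_n := \row_j Num.min (x ord0 j) (y ord0 j).
have cO : cbx c (c + cst_mx (r k)) `<=` O.
  move=> z /cbxP H; apply: xO => j; apply: (@cube_hull_norm _ _ (y ord0 j)) => //.
  by have := H j; rewrite !mxE.
pose C := B * rho ^+ k * r k ^+ n / r k.
have gC i : \int[mu]_(x in cbx c (c + cst_mx (r k))) `|g x ord0 i| <= C.
  by rewrite /C ler_pdivlMr//; exact: Hcube.
have yE : y = x + (y - x) by rewrite addrC subrK.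
have h1 j : c ord0 j <= x ord0 j by rewrite mxE ge_min lexx.
have h2 j : (x + cst_mx (r k.+1)) ord0 j <= (c + cst_mx (r k)) ord0 j.
  by rewrite !mxE rS; exact: cube_hull_lex.
have h3 j : c ord0 j <= (x + (y - x)) ord0 j by rewrite -yE mxE ge_min lexx orbT.
have h4 j : (x + cst_mx (r k.+1) + (y - x)) ord0 j <= (c + cst_mx (r k)) ord0 j.
  by rewrite !mxE rS; exact: cube_hull_ley.
have := box_shift oO lu gu cO h1 h2 h3 h4 gC.
rewrite -addrA (addrC (cst_mx _)) addrA -yE => /le_trans; apply.
apply: (@le_trans _ _ (C * (n%:R * r k.+1))).
  rewrite ler_wpM2l//.
    by apply: divr_ge0; rewrite ?(ltW rk)// !mulr_ge0// exprn_ge0// ltW.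
  rewrite -[n in n%:R]card_ord -sumr_const mulr_suml.
  by apply: ler_sum => j _; rewrite mul1r !mxE; exact: xy.
have E2 : r k = 2 * r k.+1 by rewrite rS mulrC divfK.
rewrite /C E2 exprMn; set X := r k.+1 ^+ n in rkn *.
have -> : B * rho ^+ k * (2 ^+ n * X) / (2 * r k.+1) * (n%:R * r k.+1) =
    (n%:R * 2 ^+ n * B * rho ^+ k * X) / 2 by field; rewrite gt_eqF.
rewrite ler_pdivrMr// ler_peMr ?ler1n// !mulr_ge0// ?exprn_ge0//.
Qed.

Lemma Rintegral_bx_shift (f : 'rV[R]_n -> R) e a b : measurable_fun setT f ->
  \int[mu]_(x in bx (a + e) (b + e)) f x = \int[mu]_(x in bx a b) f (x + e).
Proof.
move=> mf; rewrite Rintegral_mkcond [RHS]Rintegral_mkcond.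
rewrite -(Rintegral_shift e); last first.
  apply/(measurable_restrictT _ (@measurable_bx R n _ _)).
  exact: measurable_funS mf.
congr Rintegral; apply/funext => x; rewrite /patch.
congr (if _ then _ else _); apply/idP/idP; rewrite !inE => /bxP H; apply/bxP => j;
  by have := H j; rewrite !mxE ltrD2r lerD2r.
Qed.

(* By Fubini, the integral of [avg k] over a box is the mean of the integrals of
   [u] over the translates of this box by the points of a cube of side [r k]. *)
Lemma Rintegral_avglim a b : cbx a b `<=` O ->
  \int[mu]_(x in bx a b) avglim x = \int[mu]_(x in bx a b) u x.
Proof.
move=> abO.
have [ab|ab] := pselect (forall j, a ord0 j <= b ord0 j); last first.
  by rewrite bx_empty// !Rintegral_set0.
have [k0 room] := compact_room (@compact_cbx _ _ a b) oO abO.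
(* All translates of the box by points of a cube of side at most [r k0] lie in [S]; cutting [u] off
   outside [S] gives [f], which is integrable on the whole space. *)
pose S := cbx a (b + cst_mx (r k0)).
have SO : S `<=` O.
  move=> z /cbxP zS; pose x : 'rV[R]_n := \row_j Num.min (z ord0 j) (b ord0 j).
  apply: (room x).
    apply/cbxP => j; rewrite mxE le_min ge_min lexx orbT andbT.
    by have /andP[-> _] := zS j; rewrite ab.
  move=> j; rewrite mxE; have := zS j; rewrite !mxE => /andP[_ h].
  by have := @dyad_gt0 R k0; case: (leP (z ord0 j) (b ord0 j)) => ? ?;
    rewrite ler_norml; apply/andP; split; lra.
have mS : measurable S by exact: measurable_cbx.
pose f := u \_ S.
have fE x : S x -> f x = u x by move=> Sx; rewrite /f patchT// inE.
have intf : mu.-integrable setT (EFin \o f).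
  rewrite /f -restrict_EFin; apply/(integrable_mkcond _ mS).
  exact: integrable_cbx SO.
have mf : measurable_fun setT f by have /integrableP[/measurable_EFinP] := intf.
have mab := @measurable_bx R n a b.
pose psi : 'rV[R]_n -> R := \1_(bx a b).
pose Q k := bx 0 (cst_mx (r k)).
have QS k x y : (k0 <= k)%N -> bx a b x -> cbx 0 (cst_mx (r k)) y -> S (x + y).
  move=> k0k /bxP hx /cbxP hy; apply/cbxP => j; have := hx j; have := hy j.
  by have := @dyad_le R _ _ k0k; rewrite !mxE => ? /andP[? ?] /andP[? ?]; apply/andP; split; lra.
have avgE k x : (k0 <= k)%N -> bx a b x ->
    avg k x = (r k ^+ n)^-1 * \int[mu]_(y in Q k) (psi x * f (x + y)).
  move=> k0k hx; rewrite /avg mulrC; congr (_ * _).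
  transitivity (\int[mu]_(y in bx x (x + cst_mx (r k))) f y).
    apply: eq_Rintegral => y; rewrite inE => /bx_cbx /cbxP hy; rewrite fE//.
    rewrite -(addrNK x y) addrC; apply: (QS k) => //.
    by apply/cbxP => j; have := hy j; rewrite !mxE => /andP[? ?]; apply/andP; split; lra.
  have -> : bx x (x + cst_mx (r k)) = bx (0 + x) (cst_mx (r k) + x) by rewrite add0r addrC.
  rewrite Rintegral_bx_shift//.
  by apply: eq_Rintegral => y _; rewrite /psi indicE mem_set// mul1r addrC.
have muQ k : mu (Q k) = (r k ^+ n)%:E.
  rewrite /Q mu_bx; last by move=> j; rewrite !mxE ltW// dyad_gt0.
  by congr EFin; rewrite (eq_bigr (fun=> r k)) ?prodr_const ?card_ord// => j _; rewrite !mxE subr0.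
have psiM x : `|psi x| <= 1 by rewrite /psi indicE; case: (_ \in _); rewrite ?normr1 ?normr0.
have mpsi : measurable_fun setT psi by exact: measurable_indic.
have FS k : exists A G : 'rV[R]_n -> R,
    [/\ forall x, A x = \int[mu]_(y in Q k) (psi x * f (x + y)),
        forall y, G y = \int[mu]_x (psi x * f (x + y)),
        mu.-integrable setT (EFin \o A),
        mu.-integrable (Q k) (EFin \o G) &
        \int[mu]_x A x = \int[mu]_(y in Q k) G y].
  have [i1 i2 E] := @Fubini_shift R n _ _ mu idfun (Q k) f psi 1 (@measurable_id _ _ _)
    (@measurable_bx R n _ _) (mu_bx_lty _ _) intf mpsi psiM.
  by eexists; eexists; split; [| |exact: i1|exact: i2|exact: E].
pose C := \sum_i \int[mu]_(x in S) `|g x ord0 i|.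
have gC i : \int[mu]_(x in S) `|g x ord0 i| <= C.
  rewrite /C (bigD1 i)//= lerDl; apply: sumr_ge0 => j _; exact: Rintegral_ge0.
have GE y : S `<=` O -> (forall x, bx a b x -> S (x + y)) ->
    \int[mu]_x (psi x * f (x + y)) = \int[mu]_(x in bx (a + y) (b + y)) u x.
  move=> _ yS; transitivity (\int[mu]_(x in bx a b) f (x + y)).
    rewrite [RHS]Rintegral_mkcond; congr Rintegral; apply/funext => x.
    by rewrite patch_indic /= mulrC.
  rewrite -Rintegral_bx_shift//; apply: eq_Rintegral => x; rewrite inE => /bxP hx.
  rewrite fE// -(subrK y x); apply: yS; apply/bxP => j; have := hx j; rewrite !mxE.
  by rewrite ltrBrDr lerBlDr.
pose I := \int[mu]_(x in bx a b) u x.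
(* The integral of [avg k] is a mean over [y] of integrals of [u] over boxes shifted by [y], each of
   which differs from [I] by at most C n r k, by [box_shift]. *)
have avgI k : (k0 <= k)%N ->
    mu.-integrable (bx a b) (EFin \o avg k) /\
    `|\int[mu]_(x in bx a b) avg k x - I| <= C * (n%:R * r k).
  move=> k0k; have [A [G [AE GE' iA iG E]]] := FS k.
  have rkn : 0 < r k ^+ n by rewrite exprn_gt0// dyad_gt0.
  have iAab := integrableS measurableT mab (@subsetT _ _) iA.
  have avgA x : bx a b x -> avg k x = (r k ^+ n)^-1 * A x by move=> hx; rewrite avgE// AE.
  split.
    apply: (eq_integrable mab _ _ _ (integrableZl mab (r k ^+ n)^-1 iAab)).
    by move=> x; rewrite inE => hx; rewrite /= avgA.
  have -> : \int[mu]_(x in bx a b) avg k x = (r k ^+ n)^-1 * \int[mu]_(y in Q k) G y.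
    transitivity (\int[mu]_(x in bx a b) ((r k ^+ n)^-1 * A x)).
      by apply: eq_Rintegral => x; rewrite inE => hx; rewrite avgA.
    rewrite (RintegralZl _ mab iAab) -E; congr (_ * _).
    apply/esym/Rintegral_subset => // x _ hx; rewrite AE.
    rewrite /psi indicE memNset//; under eq_Rintegral do rewrite mul0r.
    by rewrite Rintegral_cst ?mul0r//; exact: measurable_bx.
  have mQ : measurable (Q k) by exact: measurable_bx.
  have Qoo : (mu (Q k) < +oo)%E by exact: mu_bx_lty.
  have iI : mu.-integrable (Q k) (EFin \o (cst I : 'rV[R]_n -> R)).
    by apply: measurable_bounded_integrable => //; exact: bounded_cst.
  have -> : (r k ^+ n)^-1 * \int[mu]_(y in Q k) G y - I =
      (r k ^+ n)^-1 * \int[mu]_(y in Q k) (G y - I).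
    rewrite (RintegralB mQ iG iI) Rintegral_cst// [X in fine X]muQ /= mulrBr.
    by congr (_ - _); rewrite mulrCA mulVf ?mulr1// gt_eqF.
  rewrite normrM normfV (gtr0_norm rkn) ler_pdivrMl// mulrC.
  rewrite (_ : r k ^+ n = fine (mu (Q k))); last by rewrite muQ.
  apply: Rintegral_bound => //; first by have := integrableB mQ iG iI.
  move=> y /bx_cbx Qy; have Qy' := (cbxP _ _ _).1 Qy.
  rewrite GE' GE//; last by move=> x hx; exact: QS Qy.
  have rS := @dyad_le R _ _ k0k.
  apply: (le_trans (@box_shift _ _ _ _ _ oO lu gu a (b + cst_mx (r k0)) a b y C SO _ _ _ _ gC)).
  - by [].
  - by move=> j; rewrite !mxE lerDl ltW// dyad_gt0.
  - by move=> j; rewrite mxE lerDl; have := Qy' j; rewrite mxE => /andP[].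
  - move=> j; rewrite !mxE lerD2l; have := Qy' j; rewrite !mxE => /andP[_ h].
    exact: le_trans rS.
  rewrite ler_wpM2l//; first by apply: sumr_ge0 => i _; exact: Rintegral_ge0.
  rewrite -[n in n%:R]card_ord -sumr_const mulr_suml; apply: ler_sum => j _.
  by have := Qy' j; rewrite !mxE mul1r => /andP[h1 h2]; rewrite ger0_norm.
(* The index starts at [k0], from which scale on the cubes stay inside [O]. *)
have cvgI : \int[mu]_(x in bx a b) avg (m + k0) x @[m --> \oo] --> I.
  apply/cvgrPdist_le => e e0.
  have c0 : C * (n%:R * r (m + k0)) @[m --> \oo] --> (0 : R).
    rewrite -(mulr0 C); apply: cvgM; first exact: cvg_cst.
    rewrite -(mulr0 n%:R); apply: cvgM; first exact: cvg_cst.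
    by rewrite (cvg_shiftn k0 r); exact: dyad_cvg0.
  have /cvgrPdist_le/(_ e e0) := c0; apply: filterS => m; rewrite sub0r normrN => h.
  rewrite distrC; apply: (le_trans (avgI _ (leq_addl _ _)).2).
  exact: le_trans (ler_norm _) h.
have xO k x : (k0 <= k)%N -> bx a b x -> cbx x (x + cst_mx (r k)) `<=` O.
  move=> k0k hx z /cbxP hz; apply: (room x); first exact: bx_cbx.
  move=> j; have := hz j; have := @dyad_le R _ _ k0k; have := @dyad_gt0 R k0.
  by rewrite !mxE => ? ? /andP[? ?]; rewrite ler_norml; apply/andP; split; lra.
have K0 : 0 <= K.
  rewrite /K divr_ge0 ?mulr_ge0 ?exprn_ge0// subr_ge0.
  by case/andP: rho01 => _ /ltW.
(* A majorant for all later averages: each of them, like [avg k0], is within [K] of [avglim]. *)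
have ig : mu.-integrable (bx a b) (EFin \o (fun x => `|avg k0 x| + (K + K))).
  have iKK : mu.-integrable (bx a b) (EFin \o (cst (K + K) : 'rV[R]_n -> R)).
    apply: measurable_bounded_integrable => //; [exact: mu_bx_lty|exact: bounded_cst].
  have := integrableD mab (integrable_norm (avgI k0 (leqnn k0)).1) iKK; exact.
apply: (cvg_unique _ (dominated_cvgR (f_ := fun m => avg (m + k0)) mab _ _ ig _).2 cvgI) => //.
- by move=> m; have /integrableP[/measurable_EFinP] := (avgI (m + k0)%N (leq_addl _ _)).1.
- by move=> x hx; rewrite (cvg_shiftn k0 (avg ^~ x)); exact: (avglim_avg (xO _ _ (leqnn k0) hx)).1.
- move=> m x hx.
  have rle l : K * rho ^+ l <= K.
    by rewrite ler_piMr// exprn_ile1//; case/andP: rho01 => /ltW ? /ltW.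
  have h1 := (avglim_avg (xO _ _ (leqnn k0) hx)).2.
  have h2 := (avglim_avg (xO _ _ (leq_addl m k0) hx)).2.
  rewrite -(subrK (avg k0 x) (avg (m + k0) x)) addrC.
  apply: (le_trans (ler_normD _ _)); rewrite lerD2l.
  apply: (le_trans (ler_distD (avglim x) _ _)); apply: lerD.
    by rewrite distrC; exact: le_trans h2 (rle _).
  exact: le_trans h1 (rle _).
Qed.

Let M := n%:R * 2 ^+ n * B + 2 * K.

Lemma avglim_continuous x : O x -> {for x, continuous avglim}.
Proof.
move=> Ox; have Fx := nbhs_filter x.
apply/(@cvgrPdist_le _ _ _ _ Fx) => e e0.
have [|k0 room] := @compact_room R n [set x] O (@compact_set1 _ x) oO _.
  by move=> y ->.
have Mc : M * rho ^+ k @[k --> \oo] --> (0 : R).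
  rewrite -(mulr0 M); apply: cvgM; first exact: cvg_cst.
  by apply: cvg_expr; case/andP: rho01 => ? ?; rewrite gtr0_norm.
have /cvgrPdist_le/(_ e e0)[k1 _ Hk1] := Mc.
pose k := maxn k0 k1.
have Mk : M * rho ^+ k <= e.
  have := Hk1 k (leq_maxr _ _); rewrite /= sub0r normrN; exact: le_trans (ler_norm _).
apply/nbhs_ballP; exists (r k.+1); first exact: dyad_gt0.
move=> y [_ xy]; rewrite /= distrC; apply: le_trans Mk; apply: avglim_holder.
  move=> z xz; apply: (room x) => // j; apply: (le_trans (xz j)).
  by rewrite ler_pM2l//; apply: dyad_le; exact: leq_maxl.
by move=> j; have := xy ord0 j; rewrite /ball /= distrC => /ltW.
Qed.

Lemma ae_avglim : {ae mu, forall x, O x -> u x = avglim x}.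
Proof.
have la : locally_L1 O avglim.
  by apply: continuous_locally_L1 => //; exact: avglim_continuous.
suff : {ae mu, forall x, O x -> u x + -1 * avglim x = 0}.
  by apply: filterS => x H Ox; apply/eqP; rewrite -subr_eq0 -(H Ox) mulN1r.
have lZ := locally_L1Z (-1) oO la.
apply: ae_eq0_bx => //; first exact: locally_L1D.
move=> a b abO; have mab := @measurable_bx R n a b.
have iu := integrable_bx oO lu abO; have ia := integrable_bx oO la abO.
rewrite (RintegralD mab iu (integrable_bx oO lZ abO)) (RintegralZl _ mab ia).
by rewrite mulN1r Rintegral_avglim// subrr.
Qed.

End Morrey.

(** [M] is produced before [O], [u] and [g]; this uniformity is what makes the later choice of scale
    independent of the function. *)
Lemma morrey (R : realType) (n : nat) (B rho : R) : 0 <= B -> 0 < rho < 1 ->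
  exists M : R, forall (O : set 'rV[R]_n) (u : 'rV[R]_n -> R) (g : 'rV[R]_n -> 'rV[R]_n),
  open O -> locally_L1 O u -> is_gradient O u g ->
  (forall k a i, cbx a (a + const_mx (dyad k)) `<=` O ->
    \int[@lebesgue_rV R n]_(x in cbx a (a + const_mx (dyad k))) `|g x ord0 i| * dyad k <=
    B * rho ^+ k * dyad k ^+ n) ->
  exists ut : 'rV[R]_n -> R,
  [/\ {ae @lebesgue_rV R n, forall x, O x -> u x = ut x},
      forall x, O x -> {for x, continuous ut} &
      forall k (x y : 'rV[R]_n),
        (forall z : 'rV[R]_n, (forall j, `|z ord0 j - x ord0 j| <= 2 * dyad k) -> O z) ->
        (forall j, `|y ord0 j - x ord0 j| <= dyad k.+1) ->
        `|ut y - ut x| <= M * rho ^+ k].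
Proof.
move=> B0 rho01; exists (n%:R * 2 ^+ n * B + 2 * (2 ^+ n * B / (1 - rho))).
move=> O u g oO lu gu Hcube; exists (avglim u); split.
- exact: (ae_avglim oO lu gu B0 rho01 Hcube).
- exact: (avglim_continuous oO lu gu B0 rho01 Hcube).
- by move=> k x y; exact: (avglim_holder oO lu gu B0 rho01 Hcube).
Qed.

Lemma restrict_indicM (T : Type) (R : realType) (w : T -> R) (D : set T) (x : T) :
  (w \_ D) x = w x * \1_D x.
Proof. by rewrite patch_indic. Qed.

(** * The chain rule for weak gradients *)

Section weak_shift.
Context {R : realType} {n : nat}.
Implicit Types (a b e x y z : 'rV[R]_n).
Local Notation mu := (@lebesgue_rV R n).
Local Notation leb := (@lebesgue_measure R).
Local Notation r := (@dyad R).
Local Notation delta i := (delta_mx ord0 i).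

Lemma compact_in_cube (K : set 'rV[R]_n) : compact K ->
  exists2 N : R, 0 <= N & forall x, K x -> forall j, `|x ord0 j| <= N.
Proof.
move=> cK; have [M [_ HM]] := compact_bounded cK.
exists (`|M| + 1); first by rewrite addr_ge0.
move=> x Kx j; apply: le_trans (rV_coord_le_norm _ _) _.
by apply: HM => //; rewrite (le_lt_trans (ler_norm _))// ltrDl.
Qed.

Lemma continuous_shift e : continuous (fun x : 'rV[R]_n => x + e).
Proof.
move=> x; apply: (@continuousD _ _ _ idfun (cst e)); first exact: cvg_id.
by have Fx := nbhs_filter x; apply: (@cvg_cst _ _ _ (nbhs x) Fx).
Qed.

Lemma integrable_locally_L1 (O : set 'rV[R]_n) (f : 'rV[R]_n -> R) : open O ->
  mu.-integrable setT (EFin \o f) -> locally_L1 O f.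
Proof.
move=> oO intf; split.
  apply: (measurable_funS measurableT) => //.
  by have /integrableP[/measurable_EFinP] := intf.
move=> K KO cK.
by have /integrableP[] := integrableS measurableT (measurable_compact cK) (@subsetT _ _) intf.
Qed.

Variables (O : set 'rV[R]_n) (u : 'rV[R]_n -> R) (g : 'rV[R]_n -> 'rV[R]_n).
Hypotheses (oO : open O) (cu : forall x, O x -> {for x, continuous u}).
Hypothesis (gu : is_gradient O u g).
Variables (i : 'I_n) (L : R).
Hypothesis gL : {ae mu, forall x, O x -> `|g x ord0 i| <= L}.
Variables (K : set 'rV[R]_n) (N : R).
Hypothesis KN : forall x, K x -> forall j, `|x ord0 j| <= N.

Let lu : locally_L1 O u. Proof. exact: continuous_locally_L1. Qed.

(* Cutting [g] off outside this set makes it integrable on the whole space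
   without changing it near [K]. *)
Definition cube_part : set 'rV[R]_n := O `&` cbx (const_mx (- (N + 2))) (const_mx (N + 2)).
Local Notation Z := cube_part.
Local Notation f := ((fun x : 'rV[R]_n => g x ord0 i) \_ Z).

Lemma measurable_cube_part : measurable Z.
Proof. by apply: measurableI; [exact: open_measurable_rV|exact: measurable_cbx]. Qed.

Lemma integrable_cube_part : mu.-integrable setT (EFin \o f).
Proof.
have mZ := measurable_cube_part.
rewrite -restrict_EFin; apply/(integrable_mkcond _ mZ).
have mg : measurable_fun Z (fun x => g x ord0 i).
  apply: (measurable_funS (open_measurable_rV oO)); last exact: (gu.1 i).1.
  exact: subIsetl.
have Zoo : (mu Z < +oo)%E.
  apply: le_lt_trans (mu_bx_lty (const_mx (- (N + 2))) (const_mx (N + 2))).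
  rewrite -[X in (_ <= X)%E]mu_cbx; apply: le_measure; rewrite ?inE//.
    exact: measurable_cbx.
  exact: subIsetr.
apply/integrableP; split; first exact/measurable_EFinP.
apply: (@le_lt_trans _ _ (\int[mu]_(x in Z) `|L|%:E)%E).
  apply: ae_ge0_le_integral => //.
    by apply/measurable_EFinP; exact: measurableT_comp.
  apply: filterS gL => x gx Zx; rewrite lee_fin; apply: le_trans (ler_norm _).
  by apply: gx; have [] := Zx.
by rewrite integral_cst// lte_mul_pinfty// lee_fin.
Qed.

Variable k : nat.
Hypothesis room : forall x z : 'rV[R]_n, K x -> (forall j, `|z ord0 j - x ord0 j| <= 2 * r k) -> O z.
Local Notation h := (r k.+1).

(** An open neighbourhood of [K] from which steps of length up to [r k] stay in [Z]. [K] lies in the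
    cube of radius [N], [U] in that of radius [N + 1], and a step is at most 1; hence the radius
    [N + 2] of [Z]. *)
Let U : set 'rV[R]_n :=
  interior [set x : 'rV[R]_n | forall z : 'rV[R]_n, (forall j, `|z ord0 j - x ord0 j| <= r k) -> O z] `&`
  obx (const_mx (- (N + 1))) (const_mx (N + 1)).

Let h0 : 0 < h. Proof. exact: dyad_gt0. Qed.
Let hr : h <= r k. Proof. exact: dyad_le. Qed.
Let r1 : r k <= 1. Proof. by apply: (@le_trans _ _ (r 0)); [exact: dyad_le|rewrite /dyad expr0]. Qed.

Lemma open_obx a b : open (obx a b).
Proof.
rewrite openE => x abx; apply/nbhs_ballP.
pose m := \big[Num.min/1]_j Num.min (x ord0 j - a ord0 j) (b ord0 j - x ord0 j).
have m0 : 0 < m.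
  rewrite /m lt_bigmin// => j _; have := abx j; rewrite /= in_itv/= => /andP[? ?].
  by rewrite lt_min !subr_gt0; apply/andP.
exists m => // y [_ xy] j; have := xy ord0 j; rewrite /ball /= => xyj.
have : m <= Num.min (x ord0 j - a ord0 j) (b ord0 j - x ord0 j) by exact: bigmin_le.
rewrite le_min in_itv/= => /andP[? ?]; move: xyj; rewrite ltr_norml => /andP[? ?].
by apply/andP; split; lra.
Qed.

Let oU : open U.
Proof. by apply: openI; [exact: open_interior|exact: open_obx]. Qed.

Let KU : K `<=` U.
Proof.
move=> x Kx; split.
  apply/nbhs_ballP; exists (r k); first exact: dyad_gt0.
  move=> y [_ xy] z yz; apply: (room Kx) => j.
  have := xy ord0 j; have := yz j; rewrite /ball /= ltr_norml !ler_norml.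
  by move=> /andP[? ?] /andP[? ?]; apply/andP; split; lra.
move=> j; rewrite /= !mxE in_itv/=; have := KN Kx j; rewrite ler_norml => /andP[? ?].
by apply/andP; split; lra.
Qed.

Let Uroom (x z : 'rV[R]_n) : U x -> (forall j, `|z ord0 j - x ord0 j| <= r k) -> Z z.
Proof.
move=> [/interior_subset xO xN] xz; split; first exact: xO.
apply/cbxP => j; have := xz j; have := xN j; have := r1.
rewrite /= !mxE in_itv/= ler_norml => ? /andP[? ?] /andP[? ?].
by apply/andP; split; lra.
Qed.

Let Useg x (s : R) : U x -> `[0, h]%classic s -> Z (x + s *: delta i).
Proof.
rewrite /= in_itv/= => Ux /andP[s0 sh]; apply: (Uroom Ux) => j.
rewrite !mxE eqxx /= addrAC subrr add0r; case: (j == i); rewrite ?mulr1 ?mulr0.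
  by rewrite ger0_norm// (le_trans sh).
by rewrite normr0 ltW// dyad_gt0.
Qed.

Let mI : measurable (`[0, h]%classic : set (measurableTypeR R)).
Proof. exact: measurable_itv. Qed.

Let Ioo : (leb (`[0%R, h]%classic : set (measurableTypeR R)) < +oo)%E.
Proof. by rewrite /= lebesgue_measure_itv /=; case: ifP => _; rewrite ltry. Qed.

Let tau (s : measurableTypeR R) : 'rV[R]_n := (s : R) *: delta i.

Let mtau : measurable_fun setT tau.
Proof.
apply: measurable_fun_rVP => j; rewrite /tau; under eq_fun do rewrite mxE.
by apply: measurable_funM => //; exact: measurable_cst.
Qed.

Lemma Fubini_segment (psi : 'rV[R]_n -> R) (M : R) : measurable_fun setT psi ->
  (forall x, `|psi x| <= M) ->
  [/\ mu.-integrable setT (EFin \o (fun x => \int[leb]_(s in `[0, h]) (psi x * f (x + tau s)))),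
      leb.-integrable (`[0, h]%classic : set (measurableTypeR R))
        (EFin \o (fun s => \int[mu]_x (psi x * f (x + tau s)))) &
      \int[mu]_x (\int[leb]_(s in `[0, h]) (psi x * f (x + tau s))) =
      \int[leb]_(s in `[0, h]) (\int[mu]_x (psi x * f (x + tau s)))].
Proof.
move=> mpsi psiM.
exact: (@Fubini_shift R n _ _ leb tau `[0, h] f psi M mtau mI Ioo integrable_cube_part mpsi psiM).
Qed.

(** Both sides have the same integral over every box in [U]: [shift_identity] gives the left one,
    Fubini the right one, and [ae_eq0_bx] concludes. *)
Lemma ae_shift : {ae mu, forall x, K x ->
  u (x + h *: delta i) - u x = \int[leb]_(s in `[0, h]) f (x + tau s)}.
Proof.
pose A x := \int[leb]_(s in `[0, h]) f (x + tau s).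
have iA : mu.-integrable setT (EFin \o A).
  have [|i1 _ _] := @Fubini_segment (cst 1) 1 (@measurable_cst _ _ _ _ _ _).
    by move=> x; rewrite normr1.
  rewrite (_ : A = fun x => \int[leb]_(s in `[0, h]) ((cst 1 : 'rV[R]_n -> R) x * f (x + tau s)))//.
  by apply/funext => x; apply: eq_Rintegral => s _; rewrite /= mul1r.
have lA : locally_L1 U A by exact: integrable_locally_L1.
have sub : U `<=` O.
  move=> x Ux; suff [] : Z x by [].
  by apply: (Uroom Ux) => j; rewrite subrr normr0 ltW// dyad_gt0.
have lU : locally_L1 U u by apply: continuous_locally_L1 => // x /sub; exact: cu.
have lUh : locally_L1 U (fun x => u (x + h *: delta i)).
  apply: continuous_locally_L1 => // x Ux.
  apply: continuous_comp; first exact: continuous_shift.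
  apply: cu; have hI : `[0, h]%classic h by rewrite /= in_itv/= lexx ltW.
  by have [] := Useg Ux hI.
suff : {ae mu, forall x, U x -> (u (x + h *: delta i) + -1 * u x) + -1 * A x = 0}.
  by apply: filterS => x H /KU /H; rewrite !mulN1r => /eqP; rewrite subr_eq0 => /eqP.
have lD := locally_L1D oU lUh (locally_L1Z (-1) oU lU).
apply: ae_eq0_bx => //; first exact: locally_L1D oU lD (locally_L1Z (-1) oU lA).
move=> a b abU; have mab := @measurable_bx R n a b.
have [ab|ab] := pselect (forall j, a ord0 j <= b ord0 j); last first.
  by rewrite bx_empty// Rintegral_set0.
(* A point [z] of the hull is a point of the box moved along axis [i]; [t] is the least move that
   achieves this. *)
have hullZ : cbx a (b + h *: delta i) `<=` Z.
  move=> z /cbxP hz; pose t := Num.max 0 (z ord0 i - b ord0 i).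
  have ht : `[0, h]%classic t.
    rewrite /= in_itv/= le_max lexx /= ge_max ltW//=.
    by have := hz i; rewrite !mxE !eqxx mulr1 lerBlDl => /andP[].
  rewrite -(subrK (t *: delta i) z); apply: Useg ht; apply: abU; apply/cbxP => j.
  have := hz j; rewrite !mxE eqxx /=; case: (eqVneq j i) => [->|_]; last first.
    by rewrite !mulr0 subr0 addr0.
  rewrite !mulr1 /t => /andP[h1 h2]; have := ab i.
  by case: (leP 0 (z ord0 i - b ord0 i)) => ? ?; apply/andP; split; lra.
have hullO : cbx a (b + h *: delta i) `<=` O by move=> z /hullZ[].
have [iV E] := shift_identity oO lu gu h0 hullO.
have segZ s x : `[0, h]%classic s -> bx (a + s *: delta i) (b + s *: delta i) x -> Z x.
  move=> hs /bxP hx; rewrite -(subrK (s *: delta i) x); apply: Useg hs.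
  apply: abU; apply/cbxP => j; have /andP[h1 h2] := hx j; move: h1 h2; rewrite !mxE.
  by move=> /ltW h1 h2; rewrite lerBrDr h1 lerBlDr.
have mf : measurable_fun setT f by have /integrableP[/measurable_EFinP] := integrable_cube_part.
have iu := integrable_bx oU lU abU; have iuh := integrable_bx oU lUh abU.
have iA' := integrable_bx oU lA abU.
have hI : `[0, h]%classic h by rewrite /= in_itv/= lexx ltW.
have Euh : \int[mu]_(x in bx a b) u (x + h *: delta i) =
    \int[mu]_(x in bx (a + h *: delta i) (b + h *: delta i)) u x.
  have muO : measurable_fun setT (u \_ O).
    by apply/(measurable_restrictT _ (open_measurable_rV oO)); exact: lu.1.
  transitivity (\int[mu]_(x in bx (a + h *: delta i) (b + h *: delta i)) (u \_ O) x).
    rewrite Rintegral_bx_shift//; apply: eq_Rintegral => x; rewrite inE => /bx_cbx/abU Ux.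
    by rewrite patchT// inE; have [] := Useg Ux hI.
  apply: eq_Rintegral => x; rewrite inE => hx; rewrite patchT// inE.
  by have [] := segZ _ _ hI hx.
have EA : \int[mu]_(x in bx a b) A x = \int[leb]_(s in `[0, h])
    \int[mu]_(x in bx (a + s *: delta i) (b + s *: delta i)) g x ord0 i.
  pose psi : 'rV[R]_n -> R := \1_(bx a b).
  have psi1 x : `|psi x| <= 1 by rewrite /psi indicE; case: (_ \in _); rewrite ?normr1 ?normr0.
  have mpsi : measurable_fun setT psi by exact: measurable_indic.
  have [_ _ E'] := Fubini_segment mpsi psi1.
  transitivity (\int[mu]_x \int[leb]_(s in `[0, h]) (psi x * f (x + tau s))).
    rewrite Rintegral_mkcond; congr Rintegral; apply/funext => x.
    rewrite /patch /psi; case: (boolP (x \in bx a b)) => hx.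
      by apply: eq_Rintegral => s _; rewrite indicE hx mul1r.
    rewrite (_ : Rintegral _ _ _ = 0)//; under eq_Rintegral do rewrite indicE (negbTE hx) mul0r.
    by rewrite Rintegral_cst ?mul0r//; exact: mI.
  rewrite E'; apply: eq_Rintegral => s; rewrite inE => hs.
  transitivity (\int[mu]_(x in bx a b) f (x + tau s)).
    rewrite [RHS]Rintegral_mkcond; congr Rintegral; apply/funext => x.
    by rewrite [RHS](restrict_indicM (fun x => f (x + tau s))) mulrC.
  rewrite -Rintegral_bx_shift//; apply: eq_Rintegral => x; rewrite inE => hx.
  by rewrite patchT// inE; exact: segZ hs hx.
rewrite (RintegralD mab (integrable_bx oU lD abU)
  (integrable_bx oU (locally_L1Z (-1) oU lA) abU)).
rewrite (RintegralD mab iuh (integrable_bx oU (locally_L1Z (-1) oU lU) abU)).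
rewrite (RintegralZl _ mab iu) (RintegralZl _ mab iA') !mulN1r EA Euh E subrr.
by [].
Qed.

End weak_shift.

Lemma ae_Rintegral_bound d (T : measurableType d) (R : realType)
    (mu : {measure set T -> \bar R}) (D : set T) (f : T -> R) (M : R) : 0 <= M ->
  measurable D -> (mu D < +oo)%E -> mu.-integrable D (EFin \o f) ->
  {ae mu, forall x, D x -> `|f x| <= M} ->
  `|\int[mu]_(x in D) f x| <= M * fine (mu D).
Proof.
move=> M0 mD Doo intf fM; apply: (le_trans (le_normr_Rintegral mD intf)).
rewrite -Rintegral_cst// /Rintegral; apply: fine_le.
- exact: (integrable_fin_num mD (integrable_norm intf)).
- by rewrite integral_cst// fin_numM// ge0_fin_numE.
apply: ae_ge0_le_integral => //.
by apply/measurable_EFinP; apply: measurableT_comp => //; have /integrableP[/measurable_EFinP] := intf.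
Qed.

(* If [f] is not integrable, its extended integral is infinite and [Rintegral],
   which is [fine] of it, is 0; the same holds for its nonzero multiples. *)
Lemma RintegralZl_measurable d (T : measurableType d) (R : realType)
    (mu : {measure set T -> \bar R}) (D : set T) (f : T -> R) (c : R) :
  measurable D -> measurable_fun D f ->
  \int[mu]_(x in D) (c * f x) = c * \int[mu]_(x in D) f x.
Proof.
move=> mD mf; have [->|c0] := eqVneq c 0.
  by under eq_Rintegral do rewrite mul0r; rewrite Rintegral_cst// !mul0r.
have fin0 (h : T -> R) : measurable_fun D h -> ~ mu.-integrable D (EFin \o h) ->
    \int[mu]_(x in D) h x = 0.
  move=> mh nint; have [hfin|/negPf hfin] := boolP (\int[mu]_(x in D) (h x)%:E \is a fin_num)%E; last first.
    by rewrite /Rintegral; move: hfin; case: (\int[mu]_(_ in _) _)%E.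
  case: nint; apply/integrableP; split; first exact/measurable_EFinP.
  move: hfin; rewrite integralE fin_numB => /andP[p m].
  have mH : measurable_fun D (EFin \o h) by exact/measurable_EFinP.
  have -> : (\int[mu]_(x in D) `|(h x)%:E| =
      \int[mu]_(x in D) ((EFin \o h)^\+ x + (EFin \o h)^\- x))%E.
    by apply: eq_integral => x _; rewrite -/((abse \o (EFin \o h)) x) fune_abse.
  rewrite ge0_integralD//; first by rewrite lte_add_pinfty// ltey_eq ?p ?m.
  - exact: measurable_funepos.
  - exact: measurable_funeneg.
have [intf|nint] := pselect (mu.-integrable D (EFin \o f)); first exact: RintegralZl.
rewrite (fin0 f)// mulr0 fin0//; first exact: measurable_funM.
move=> icf; apply: nint; have := integrableZl mD c^-1 icf.
by under eq_fun do rewrite /= -EFinM mulrA mulVf// mul1r.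
Qed.

Section chain_rule.
Context {R : realType} {n : nat}.
Implicit Types (a b e x y z : 'rV[R]_n).
Local Notation mu := (@lebesgue_rV R n).
Local Notation leb := (@lebesgue_measure R).
Local Notation r := (@dyad R).
Local Notation delta i := (delta_mx ord0 i).

Variables (O : set 'rV[R]_n) (u : 'rV[R]_n -> R) (g : 'rV[R]_n -> 'rV[R]_n).
Hypotheses (oO : open O) (cu : forall x, O x -> {for x, continuous u}).
Hypothesis (gu : is_gradient O u g).
Variables (L Lam : R).
Hypothesis gL : forall i, {ae mu, forall x, O x -> `|g x ord0 i| <= L}.
Hypothesis Lam0 : 0 <= Lam.
Hypothesis uLam : forall k (x y : 'rV[R]_n),
  (forall z : 'rV[R]_n, (forall j, `|z ord0 j - x ord0 j| <= 2 * r k) -> O z) ->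
  (forall j, `|y ord0 j - x ord0 j| <= r k.+1) -> `|u y - u x| <= Lam * r k.
Variables (F F' : R -> R) (N : R).
Hypotheses (cF : continuous F) (cF' : continuous F').
Hypotheses (FN : forall a : R, `|F a| <= N) (F'N : forall a : R, `|F' a| <= N).
Hypothesis FT : forall a b : R, `|F b - F a - F' a * (b - a)| <= N * (b - a) ^+ 2.
Hypothesis F'L : forall a b : R, `|F' b - F' a| <= N * `|b - a|.

Let lu : locally_L1 O u. Proof. exact: continuous_locally_L1. Qed.
Let mO : measurable O. Proof. exact: open_measurable_rV. Qed.
Let N_ge0 : 0 <= N. Proof. exact: le_trans (FN 0). Qed.

Let cFu (G : R -> R) x : continuous G -> O x -> {for x, continuous (fun x => G (u x))}.
Proof. by move=> cG Ox; apply: continuous_comp; [exact: cu|exact: cG]. Qed.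

Section test.
Variables (phi : 'rV[R]_n -> R) (i : 'I_n).
Hypothesis tphi : test_function O phi.
Let K := closure [set x | phi x != 0].
Let cK : compact K. Proof. by have [] := tphi. Qed.
Let KO : K `<=` O. Proof. by have [] := tphi. Qed.
Variables (Mphi Mp N0 : R).
Hypotheses (Mphi0 : 0 <= Mphi) (phiM : forall x, `|phi x| <= Mphi).
Hypotheses (Mp0 : 0 <= Mp) (phi'M : forall x, `|partial i phi x| <= Mp).
Hypothesis KN : forall x, K x -> forall j, `|x ord0 j| <= N0.
Variable k0 : nat.
Hypothesis room0 : forall x z : 'rV[R]_n, K x -> (forall j, `|z ord0 j - x ord0 j| <= 2 * r k0) -> O z.

(** [w], [psi] and [f] are extended by 0 to the whole space, where integrals can be translated. *)
Let w := (fun x => F (u x)) \_ O.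
Let psi := (fun x => F' (u x) * phi x) \_ O.
Local Notation Z := (cube_part O N0).
Let f := (fun x : 'rV[R]_n => g x ord0 i) \_ Z.

Let room k : (k0 <= k)%N ->
  forall x z : 'rV[R]_n, K x -> (forall j, `|z ord0 j - x ord0 j| <= 2 * r k) -> O z.
Proof.
move=> k0k x z Kx xz; apply: (room0 Kx) => j; apply: le_trans (xz j) _.
by rewrite ler_pM2l//; exact: dyad_le.
Qed.

Let mphi : measurable_fun setT phi.
Proof. by apply: measurable_continuous_rV; [exact: openT|move=> x _; exact: (test_continuous tphi)]. Qed.

Let mw : measurable_fun setT w.
Proof.
apply/(measurable_restrictT _ mO); apply: measurable_continuous_rV => // x.
exact: cFu.
Qed.

Let mpsi : measurable_fun setT psi.
Proof.
apply/(measurable_restrictT _ mO); apply: measurable_funM.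
  by apply: measurable_continuous_rV => // x; exact: cFu.
exact: measurable_funS mphi.
Qed.

Let wN x : `|w x| <= N.
Proof. by rewrite /w /patch; case: ifP => // _; rewrite normr0. Qed.

Let psiM x : `|psi x| <= N * Mphi.
Proof.
rewrite /psi /patch; case: ifP => _; last by rewrite normr0 mulr_ge0.
by rewrite normrM ler_pM.
Qed.

Let intf : mu.-integrable setT (EFin \o f).
Proof. exact: (integrable_cube_part oO gu (gL i)). Qed.

Let step (x : 'rV[R]_n) (t : R) j : `|(x + t *: delta i) ord0 j - x ord0 j| <= `|t|.
Proof.
by rewrite !mxE eqxx /= addrAC subrr add0r; case: (j == i); rewrite ?mulr1 ?mulr0 ?normr0.
Qed.

Let stepO k x (t : R) : (k0 <= k)%N -> K x -> `|t| <= r k -> O (x + t *: delta i).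
Proof.
move=> k0k Kx tk; apply: (room k0k Kx) => j; apply: le_trans (step _ _ _) _.
by rewrite (le_trans tk)// ler_peMl ?ler1n// ltW// dyad_gt0.
Qed.

(** The Lipschitz constant of [psi] along axis [i]: the first term comes from [phi], the second from
    F'(u). The 2 appears because [uLam] bounds a step of r k.+1 by Lam r k. *)
Let C1 := N * Mp + 2 * Mphi * N * Lam.

Let C1_ge0 : 0 <= C1. Proof. by rewrite /C1 addr_ge0 ?mulr_ge0. Qed.

Let psi_lip k x (t : R) : (k0 <= k)%N -> K x -> `|t| <= r k.+1 ->
  `|psi (x + t *: delta i) - psi x| <= C1 * r k.+1.
Proof.
move=> k0k Kx tk; have hr : r k.+1 <= r k by exact: dyad_le.
have Oz := stepO k0k Kx (le_trans tk hr).
rewrite /psi !patchT ?inE//; last exact: KO.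
set z := x + t *: delta i.
have -> : F' (u z) * phi z - F' (u x) * phi x =
    F' (u z) * (phi z - phi x) + phi x * (F' (u z) - F' (u x)) by ring.
apply: (le_trans (ler_normD _ _)).
rewrite /C1 mulrDl; apply: lerD; rewrite normrM.
  rewrite -mulrA; apply: ler_pM => //.
  have dphi := fun x => @test_derivable R n _ _ tphi i x.
  apply: (le_trans (MVT_line dphi phi'M x t)).
  by rewrite ler_wpM2l.
have -> : 2 * Mphi * N * Lam * r k.+1 = Mphi * (N * (Lam * r k)) by rewrite dyadS; field.
apply: ler_pM => //; apply: (le_trans (F'L _ _)); rewrite ler_wpM2l//.
apply: uLam => [y|j]; first exact: (room k0k Kx).
exact: le_trans (step _ _ _) tk.
Qed.

Let psi0 x : ~ K x -> psi x = 0.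
Proof. by move=> Kx; rewrite /psi /patch (test_eq0 Kx) mulr0; case: ifP. Qed.

Let psi_lip_all k x (t : R) : (k0 <= k)%N -> `|t| <= r k.+1 ->
  `|psi (x + t *: delta i) - psi x| <= C1 * r k.+1.
Proof.
move=> k0k tk; have [Kx|Kx] := pselect (K x); first exact: psi_lip.
have [Kz|Kz] := pselect (K (x + t *: delta i)); last first.
  rewrite !psi0// subrr normr0 /C1 mulr_ge0 ?addr_ge0 ?mulr_ge0//.
  by rewrite ltW// dyad_gt0.
(* With [x] outside [K], the step is taken backwards from the shifted point. *)
have := @psi_lip k (x + t *: delta i) (- t) k0k Kz.
by rewrite scaleNr addrK normrN distrC; apply.
Qed.

Let T := \int[mu]_x (psi x * f x).

Let C2 := C1 * \int[mu]_x `|f x|.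

(** The translation is moved from [f], which is only integrable, to [psi], which is Lipschitz along
    axis [i]. *)
Let V_T k (s : R) : (k0 <= k)%N -> `[0, r k.+1]%classic s ->
  `|\int[mu]_x (psi x * f (x + s *: delta i)) - T| <= C2 * r k.+1.
Proof.
move=> k0k; rewrite /= in_itv/= => /andP[s0 sk].
have mf : measurable_fun setT f by have /integrableP[/measurable_EFinP] := intf.
have mpsis : measurable_fun setT (fun x => psi (x - s *: delta i)).
  by apply: (@measurableT_comp _ _ _ _ _ _ psi) => //; exact: measurable_shift.
have -> : \int[mu]_x (psi x * f (x + s *: delta i)) =
    \int[mu]_x (psi (x - s *: delta i) * f x).
  rewrite -(Rintegral_shift (- (s *: delta i))); last first.
    apply: measurable_funM => //.
    by apply: (@measurableT_comp _ _ _ _ _ _ f) => //; exact: measurable_shift.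
  by apply: eq_Rintegral => x _; rewrite subrK.
have i1 : mu.-integrable setT (EFin \o (fun x => psi (x - s *: delta i) * f x)).
  have := @integrable_mul_bounded _ _ _ mu setT f _ (N * Mphi) measurableT intf mpsis (fun x _ => psiM _).
  by under eq_fun do rewrite mulrC.
have i2 : mu.-integrable setT (EFin \o (fun x => psi x * f x)).
  have := @integrable_mul_bounded _ _ _ mu setT f _ (N * Mphi) measurableT intf mpsi (fun x _ => psiM _).
  by under eq_fun do rewrite mulrC.
rewrite /T -(RintegralB measurableT i1 i2).
have i3 := integrableB measurableT i1 i2.
apply: (le_trans (le_normr_Rintegral measurableT i3)).
have C1r : 0 <= C1 * r k.+1 by rewrite mulr_ge0 ?C1_ge0// ltW// dyad_gt0.
rewrite /C2 mulrAC -(RintegralZl _ measurableT (integrable_norm intf)).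
apply: le_Rintegral => //.
- exact: integrable_norm.
- by have := integrableZl measurableT (C1 * r k.+1) (integrable_norm intf).
move=> x _; rewrite -mulrBl normrM ler_wpM2r//.
rewrite -scaleNr; apply: psi_lip_all => //.
by rewrite normrN ger0_norm.
Qed.

Let iphi : mu.-integrable setT (EFin \o phi).
Proof.
have mK := measurable_compact cK.
apply: (@integrable_subset _ _ _ mu setT K) => //; first by move=> x _; exact: test_eq0.
have lphi : locally_L1 setT phi.
  apply: continuous_locally_L1; first exact: openT.
  by move=> x _; exact: (test_continuous tphi).
exact: (locally_L1_integrable openT lphi cK).
Qed.

Let muK : (mu K < +oo)%E.
Proof.
apply: le_lt_trans (mu_bx_lty (const_mx (- N0)) (const_mx N0)).
rewrite -[X in (_ <= X)%E]mu_cbx; apply: le_measure; rewrite ?inE.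
- exact: measurable_compact.
- exact: measurable_cbx.
- by move=> x Kx; apply/cbxP => j; rewrite !mxE -ler_norml; exact: KN.
Qed.

Let C3 := N * Lam ^+ 2 * Mphi * fine (mu K).

(* Translating [phi] amounts to translating [w = F(u)], whose increments are
   [F'(u)] times those of [u], up to a Taylor remainder of order [r k.+1 ^+ 2]
   because [u] is Lipschitz. *)
Let difference_quotient k : (k0 <= k)%N ->
  `|\int[mu]_x (w x * (phi x - phi (x - r k.+1 *: delta i))) + r k.+1 * T| <=
  (C3 * 4 + C2) * r k.+1 ^+ 2.
Proof.
move=> k0k; set h := r k.+1; have h0 : 0 < h by exact: dyad_gt0.
have hr : h <= r k by exact: dyad_le.
pose A x := \int[leb]_(s in `[0, h]) f (x + (s : R) *: delta i).
have mwh : measurable_fun setT (fun x => w (x + h *: delta i)).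
  by apply: (@measurableT_comp _ _ _ _ _ _ w) => //; exact: measurable_shift.
have i1 : mu.-integrable setT (EFin \o (fun x => phi x * w x)).
  exact: (integrable_mul_bounded measurableT iphi mw (fun x _ => wN x)).
have i2 : mu.-integrable setT (EFin \o (fun x => phi x * w (x + h *: delta i))).
  exact: (integrable_mul_bounded measurableT iphi mwh (fun x _ => wN _)).
have mphih : measurable_fun setT (fun x => phi (x - h *: delta i)).
  by apply: (@measurableT_comp _ _ _ _ _ _ phi) => //; exact: measurable_shift.
have i2' : mu.-integrable setT (EFin \o (fun x => phi (x - h *: delta i) * w x)).
  have := integrable_shift (- (h *: delta i)) i2.
  by under eq_fun do rewrite /= subrK.
have [iA iV EV] := Fubini_segment oO gu (gL i) N0 k mpsi psiM.
have mf : measurable_fun setT f by have /integrableP[/measurable_EFinP] := intf.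
have mI : measurable (`[0, h]%classic : set (measurableTypeR R)) by exact: measurable_itv.
have EpA x : \int[leb]_(s in `[0, h]) (psi x * f (x + (s : R) *: delta i)) = psi x * A x.
  apply: RintegralZl_measurable => //.
  apply: (measurable_funS measurableT) => //.
  apply: (@measurableT_comp _ _ _ _ _ _ f) => //.
  apply: measurable_fun_rVP => j; under eq_fun do rewrite !mxE.
  by apply: measurable_funD => //; apply: measurable_funM.
have -> : \int[mu]_x (w x * (phi x - phi (x - h *: delta i))) =
    - \int[mu]_x (phi x * w (x + h *: delta i) - phi x * w x).
  rewrite (RintegralB measurableT i2 i1) opprB.
  transitivity (\int[mu]_x (phi x * w x - phi (x - h *: delta i) * w x)).
    by apply: eq_Rintegral => x _; ring.
  rewrite (RintegralB measurableT i1 i2'); congr (_ - _).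
  rewrite -(Rintegral_shift (h *: delta i)); last exact: measurable_funM.
  by apply: eq_Rintegral => x _; rewrite addrK.
have iA' : mu.-integrable setT (EFin \o (fun x => psi x * A x)).
  by move: iA; rewrite (_ : (fun x => _) = fun x => psi x * A x)//; apply/funext => x; exact: EpA.
have EV' : \int[mu]_x (psi x * A x) =
    \int[leb]_(s in `[0, h]) (\int[mu]_x (psi x * f (x + (s : R) *: delta i))).
  by rewrite -[RHS]EV; apply: eq_Rintegral => x _; rewrite -EpA.
have i21 : mu.-integrable setT (EFin \o (fun x => phi x * w (x + h *: delta i) - phi x * w x)).
  exact: (integrableB measurableT i2 i1).
have main : `|\int[mu]_x (phi x * w (x + h *: delta i) - phi x * w x) -
    \int[mu]_x (psi x * A x)| <= C3 * 4 * h ^+ 2.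
  have i3 : mu.-integrable setT (EFin \o (fun x =>
      (phi x * w (x + h *: delta i) - phi x * w x) - psi x * A x)).
    exact: (integrableB measurableT i21 iA').
  rewrite -(RintegralB measurableT i21 iA').
  rewrite (@Rintegral_subset _ _ _ mu setT K)//; last first.
    by move=> x _ Kx; rewrite (test_eq0 Kx) psi0// !mul0r !subr0.
  have mK := measurable_compact cK.
  (* The 4 comes from r k = 2 h. *)
  have -> : C3 * 4 * h ^+ 2 = N * (Lam * r k) ^+ 2 * Mphi * fine (mu K).
    by rewrite /C3 /h dyadS; field.
  apply: ae_Rintegral_bound => //.
  - by rewrite mulr_ge0// mulr_ge0// sqr_ge0.
  - exact: (integrableS measurableT mK (@subsetT _ _) i3).
  apply: filterS (ae_shift oO cu gu (gL i) KN (room k0k)) => x + Kx => /(_ Kx) uA.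
  have Oxh : O (x + h *: delta i) by apply: (stepO k0k Kx); rewrite gtr0_norm.
  rewrite /w /psi !patchT ?inE//; try exact: KO.
  rewrite /A -uA; set y := x + _.
  have -> : phi x * F (u y) - phi x * F (u x) - F' (u x) * phi x * (u y - u x) =
    (F (u y) - F (u x) - F' (u x) * (u y - u x)) * phi x by ring.
  rewrite normrM; apply: ler_pM => //; apply: (le_trans (FT _ _)).
  rewrite ler_wpM2l// -[leLHS]real_normK ?num_real// ler_sqr ?nnegrE ?mulr_ge0//; last by rewrite ltW// dyad_gt0.
  apply: uLam => [z|j]; first exact: (room k0k Kx).
  by apply: le_trans (step _ _ _) _; rewrite gtr0_norm.
have Vb : `|\int[leb]_(s in `[0, h]) (\int[mu]_x (psi x * f (x + (s : R) *: delta i))) - h * T|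
    <= C2 * h ^+ 2.
  have Ih : leb (`[0%R, h]%classic : set (measurableTypeR R)) = h%:E.
    by rewrite /= lebesgue_measure_itv /= lte_fin h0 sube0.
  have Ioo : (leb (`[0%R, h]%classic : set (measurableTypeR R)) < +oo)%E by rewrite Ih ltry.
  have iT : leb.-integrable (`[0, h]%classic : set (measurableTypeR R)) (EFin \o (cst T : R -> R)).
    by apply: measurable_bounded_integrable => //; exact: bounded_cst.
  have -> : h * T = \int[leb]_(s in `[0, h]) T.
    transitivity (T * fine (leb (`[0%R, h]%classic : set (measurableTypeR R)))).
      by rewrite Ih mulrC.
    by rewrite Rintegral_cst.
  rewrite -(RintegralB mI iV iT).
  have -> : C2 * h ^+ 2 = C2 * h * fine (leb (`[0%R, h]%classic : set (measurableTypeR R))).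
    by rewrite Ih -mulrA.
  apply: Rintegral_bound => //; first exact: (integrableB mI iV iT).
  by move=> s hs; exact: V_T.
rewrite EV' in main.
move: main Vb.
generalize (\int[mu]_x (phi x * w (x + h *: delta i) - phi x * w x))
   (\int[leb]_(s in `[0, h]) \int[mu]_x (psi x * f (x + (s : R) *: delta i))).
move=> a b; rewrite (_ : - a + h * T = - ((a - b) + (b - h * T))); last by ring.
rewrite normrN mulrDl => *; apply: (le_trans (ler_normD _ _)); exact: lerD.
Qed.

Let Bx : set 'rV[R]_n := cbx (const_mx (- (N0 + 2))) (const_mx (N0 + 2)).

Let KBx x (t : R) : `|t| <= 1 -> K (x + t *: delta i) -> Bx x.
Proof.
move=> t1 Kx; apply/cbxP => j; have := KN Kx j.
have := step x t j; rewrite !mxE !ler_norml => /andP[? ?] /andP[? ?].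
by apply/andP; split; lra.
Qed.

Let rS1 k : `|- r k.+1| <= 1.
Proof.
rewrite normrN gtr0_norm ?dyad_gt0//.
by apply: (@le_trans _ _ (r 0)); [exact: dyad_le|rewrite /dyad expr0].
Qed.

(** Dominated convergence on the cube [Bx], which contains the support of [phi] and its translates
    by at most 1; the quotients are bounded by [Mp] through the mean value theorem. *)
Let limit :
  (r k.+1)^-1 * (\int[mu]_x (w x * (phi x - phi (x - r k.+1 *: delta i)))) @[k --> \oo]
  --> \int[mu]_x (w x * partial i phi x).
Proof.
have mBx : measurable Bx by exact: measurable_cbx.
have KB : K `<=` Bx.
  by move=> x Kx; apply: (@KBx x 0); rewrite ?normr0// scale0r addr0.
rewrite (@Rintegral_subset _ _ _ mu setT Bx)//; last first.
  by move=> x _ Bx0; rewrite (partial_eq0 _ (contra_not (@KB _) Bx0)) mulr0.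
pose q k x := w x * ((phi x - phi (x - r k.+1 *: delta i)) / r k.+1).
have mq k : measurable_fun setT (q k).
  apply: measurable_funM => //; apply: measurable_funM => //; apply: measurable_funB => //.
  by apply: (@measurableT_comp _ _ _ _ _ _ phi) => //; exact: measurable_shift.
have iC : mu.-integrable Bx (EFin \o (cst (N * Mp) : 'rV[R]_n -> R)).
  apply: measurable_bounded_integrable => //; last exact: bounded_cst.
  by rewrite /Bx [X in (X < _)%E]mu_cbx; exact: mu_bx_lty.
have qE k x : phi (x + - r k.+1 *: delta i) = phi (x - r k.+1 *: delta i).
  by rewrite scaleNr.
have [k|x _|k x _|_] := @dominated_cvgR _ _ _ mu Bx q
    (fun x => w x * partial i phi x) _ mBx _ _ iC.
- exact: measurable_funS (mq k).
- apply: cvgM; first exact: cvg_cst.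
  have /cvg_ex[l /cvgr_dnbhsP Dl] := @test_derivable R n O phi tphi i x.
  have -> : partial i phi x = l by apply/cvg_lim => //; exact/cvgr_dnbhsP.
  (* The quotient in [q] belongs to the increment - r k.+1, which tends to 0 through nonzero
     values. *)
  have t0 : (forall k, - r k.+1 != 0) /\ (- r k.+1 @[k --> \oo] --> (0 : R)).
    split=> [k|]; first by rewrite oppr_eq0 lt0r_neq0// dyad_gt0.
    rewrite -[X in _ --> X]oppr0; apply: cvgN.
    by have := @dyad_cvg0 R; rewrite -cvg_shiftS.
  apply: cvg_trans (Dl _ t0); apply: near_eq_cvg; near=> k.
  rewrite /= invrN scaleNr -scalerN opprB mulrC; congr (_ * (_ - phi _)).
  by rewrite addrC scaleNr.
- rewrite /q normrM ler_pM// normrM normfV (gtr0_norm (dyad_gt0 _))//.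
  rewrite ler_pdivrMr ?dyad_gt0// -qE distrC.
  have dphi := fun x => @test_derivable R n _ _ tphi i x.
  have := MVT_line dphi phi'M x (- r k.+1).
  by rewrite normrN (gtr0_norm (dyad_gt0 _)).
apply: cvg_trans; apply: near_eq_cvg; near=> k.
rewrite /= /q -(@Rintegral_subset _ _ _ mu setT Bx)//; last first.
  move=> x _ Bx0; rewrite (test_eq0 (contra_not (@KB _) Bx0)).
  rewrite -qE (_ : phi (x + _) = 0) ?subrr ?mul0r ?mulr0//.
  by apply: test_eq0 => Kx; apply: Bx0; exact: KBx (rS1 k) Kx.
rewrite -RintegralZl_measurable//.
  by apply: eq_Rintegral => x _; ring.
apply: measurable_funM => //; apply: measurable_funB => //.
by apply: (@measurableT_comp _ _ _ _ _ _ phi) => //; exact: measurable_shift.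
Unshelve. all: by end_near. Qed.

(** Divided by r k.+1, [difference_quotient] shows that the sequence in [limit] also tends to
    [- T]. *)
Lemma chain_rule_test : \int[mu]_(x in O) (F (u x) * partial i phi x) =
  - \int[mu]_(x in O) (F' (u x) * g x ord0 i * phi x).
Proof.
have E1 : \int[mu]_(x in O) (F (u x) * partial i phi x) = \int[mu]_x (w x * partial i phi x).
  rewrite (@Rintegral_subset _ _ _ mu setT O)//; last first.
    by move=> x _ Ox; rewrite /w patchN ?mul0r// notin_setE.
  by apply: eq_Rintegral => x xO; rewrite /w patchT.
have E2 : \int[mu]_(x in O) (F' (u x) * g x ord0 i * phi x) = T.
  rewrite /T (@Rintegral_subset _ _ _ mu setT O)//; last first.
    by move=> x _ Ox; rewrite /psi patchN ?mul0r// notin_setE.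
  rewrite (@Rintegral_subset _ _ _ mu O K)//; last first.
    by move=> x _ Kx; rewrite (test_eq0 Kx) mulr0.
  rewrite [RHS](@Rintegral_subset _ _ _ mu O K)//; last first.
    by move=> x _ Kx; rewrite psi0// mul0r.
  apply: eq_Rintegral => x; rewrite inE => Kx.
  rewrite /psi /f !patchT ?inE//; [ring| |exact: KO].
  by split; [exact: KO|apply: (@KBx x 0); rewrite ?normr0// scale0r addr0].
rewrite E1 E2; apply: (cvg_unique _ limit) => //.
have cT : r k.+1 * (C3 * 4 + C2) @[k --> \oo] --> (0 : R).
  rewrite -(mul0r (C3 * 4 + C2)); apply: cvgM; last exact: cvg_cst.
  by have := @dyad_cvg0 R; rewrite -cvg_shiftS.
apply/cvgrPdist_le => e e0; near=> k.
have k0k : (k0 <= k)%N by near: k; exists k0.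
have h0 := @dyad_gt0 R k.+1.
have := difference_quotient k0k.
set J := \int[mu]_x _ => JT.
have : `|r k.+1 * (C3 * 4 + C2)| <= e.
  by near: k; have := cT => /cvgrPdist_le /(_ e e0); apply: filterS => k; rewrite sub0r normrN.
apply: le_trans; rewrite distrC opprK.
have -> : (r k.+1)^-1 * J + T = (r k.+1)^-1 * (J + r k.+1 * T) by field; exact: lt0r_neq0.
rewrite normrM normfV (gtr0_norm h0) mulrC ler_pdivrMr//; apply: le_trans JT _.
rewrite expr2 mulrA; apply: ler_wpM2r; first exact: ltW.
by rewrite [leLHS]mulrC ler_norm.
Unshelve. all: by end_near. Qed.

End test.

Lemma chain_rule : is_gradient O (fun x => F (u x)) (fun x => F' (u x) *: g x).
Proof.
split=> [i|phi tphi i].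
  have mFu : measurable_fun O (fun x => F' (u x)).
    by apply: measurable_continuous_rV => // x; exact: cFu.
  split; first by under eq_fun do rewrite mxE; apply: measurable_funM => //; exact: (gu.1 i).1.
  move=> K KO cK; have mK := measurable_compact cK.
  have ig := locally_L1_integrable oO (gu.1 i) cK KO mK (@subset_refl _ _).
  have := integrable_mul_bounded mK ig (measurable_funS mO KO mFu) (fun x _ => F'N (u x)).
  by move=> /integrableP[_]; under [in X in _ -> X]eq_integral do rewrite mxE mulrC.
have [_ cK KO] := tphi.
have [Mphi Mphi0 phiM] := test_bounded tphi.
have [Mp Mp0 pM] := partial_bounded tphi i.
have [N0 _ KN] := compact_in_cube cK.
have [k0 room] := compact_room cK oO KO.
rewrite (chain_rule_test tphi Mphi0 phiM Mp0 pM KN room).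
by under [in RHS]eq_Rintegral do rewrite mxE.
Qed.

End chain_rule.

(** * Gradients, norms and continuous representatives *)

Section gradient_theory.
Context {R : realType} {n : nat}.
Implicit Types (O : set 'rV[R]_n) (u : 'rV[R]_n -> R) (g : 'rV[R]_n -> 'rV[R]_n).
Local Notation mu := (@lebesgue_rV R n).

Lemma locally_L1_cst O (c : R) : open O -> locally_L1 O (cst c).
Proof. by move=> oO; apply: continuous_locally_L1 => // x _; exact: cst_continuous. Qed.

(** In substance, the partial derivatives of a test function have integral 0. This is the chain rule
    for a constant outer function, applied to the zero function, whose gradient is 0 by
    inspection. *)
Lemma is_gradient_cst O (c : R) : open O -> is_gradient O (cst c) (cst 0).
Proof.
move=> oO.
have g0 : is_gradient O (cst 0) (cst 0).
  split=> [i|phi _ i].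
    by under eq_fun do rewrite mxE; exact: locally_L1_cst.
  under eq_Rintegral do rewrite mul0r.
  under [in RHS]eq_Rintegral do rewrite mxE mul0r.
  by rewrite Rintegral_cst ?mul0r ?oppr0//; exact: open_measurable_rV.
have : is_gradient O (fun x : 'rV[R]_n => (cst c : R -> R) ((cst 0 : 'rV[R]_n -> R) x))
    (fun x => (cst 0 : R -> R) ((cst 0 : 'rV[R]_n -> R) x) *: (cst 0 : 'rV[R]_n -> 'rV[R]_n) x).
  apply: (@chain_rule R n O (cst 0) (cst 0) oO _ g0 0 0 _ _ _ (cst c) (cst 0) `|c|) => //.
  - by move=> x _; exact: cst_continuous.
  - by move=> i; apply: aeW => x _; rewrite mxE normr0.
  - by move=> k x y _ _; rewrite subrr normr0 mul0r.
  - by move=> x; exact: cst_continuous.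
  - by move=> x; exact: cst_continuous.
  - by move=> a; rewrite normr0.
  - by move=> a b; rewrite /= subrr mul0r subr0 normr0 mulr_ge0 ?sqr_ge0.
  - by move=> a b; rewrite /= subrr normr0 mulr_ge0.
by under [X in is_gradient _ _ X]eq_fun do rewrite /= scaler0.
Qed.

Lemma integrable_mul_partial O u phi i : open O -> locally_L1 O u ->
  test_function O phi -> mu.-integrable O (EFin \o (fun x => u x * partial i phi x)).
Proof.
move=> oO lu tphi; have [_ cK KO] := tphi; have mK := measurable_compact cK.
have mO := open_measurable_rV oO.
have [M M0 pM] := partial_bounded tphi i.
apply: (@integrable_subset _ _ _ mu O (closure [set x | phi x != 0])) => //.
  by move=> x _ Kx; rewrite (partial_eq0 _ Kx) mulr0.
have iu := locally_L1_integrable oO lu cK KO mK (@subset_refl _ _).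
apply: (integrable_mul_bounded mK iu) => [|x _]; last exact: pM.
apply: (measurable_funS measurableT) => //.
apply: measurable_continuous_rV; first exact: openT.
by move=> x _; exact: (test_partial_continuous tphi).
Qed.

Lemma is_gradientDcst O u g (c : R) : open O -> locally_L1 O u ->
  is_gradient O u g -> is_gradient O (fun x => u x + c) g.
Proof.
move=> oO lu [lg gu]; split=> // phi tphi i.
have iu := integrable_mul_partial i oO lu tphi.
have ic := integrable_mul_partial i oO (locally_L1_cst c oO) tphi.
under eq_Rintegral do rewrite mulrDl.
rewrite (RintegralD (open_measurable_rV oO) iu ic) gu//.
have [_ ->//] := is_gradient_cst c oO.
under [X in _ - X]eq_Rintegral do rewrite mxE mul0r.
by rewrite Rintegral_cst ?mul0r ?subr0//; exact: open_measurable_rV.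
Qed.

(** The two sets of weak gradients coincide, so [xget] picks the same element: the equality holds at
    every point and not only almost everywhere. *)
Lemma gradientDcst O u (c : R) : open O -> locally_L1 O u ->
  gradient O (fun x => u x + c) = gradient O u.
Proof.
move=> oO lu; rewrite /gradient; congr (xget _ _); apply/seteqP; split=> g /=; last first.
  exact: is_gradientDcst.
move=> /(is_gradientDcst (- c) oO (locally_L1D oO lu (locally_L1_cst c oO))).
by under eq_fun do rewrite addrK.
Qed.

Lemma is_gradient_ae_eq O u v g : open O -> measurable_fun O u -> measurable_fun O v ->
  u = v %[ae mu in O] -> is_gradient O u g -> is_gradient O v g.
Proof.
move=> oO mu_ mv uv [lg gu]; split=> // phi tphi i; rewrite -gu//.
have mO := open_measurable_rV oO.
have mp : measurable_fun O (partial i phi).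
  apply: (measurable_funS measurableT) => //.
  apply: measurable_continuous_rV; first exact: openT.
  by move=> x _; exact: (test_partial_continuous tphi).
rewrite /Rintegral; congr fine; apply: ae_eq_integral => //.
- by apply/measurable_EFinP; exact: measurable_funM.
- by apply/measurable_EFinP; exact: measurable_funM.
- by apply: filterS uv => x uv Ox; rewrite uv.
Qed.

Lemma gradient_ae_eq O u v : open O -> measurable_fun O u -> measurable_fun O v ->
  u = v %[ae mu in O] -> gradient O u = gradient O v.
Proof.
move=> oO mu_ mv uv; rewrite /gradient; congr (xget _ _).
apply/seteqP; split=> g /=; apply: is_gradient_ae_eq => //.
by apply: filterS uv => x uv Ox; rewrite uv.
Qed.

Lemma is_gradient_gradient O u g : is_gradient O u g -> is_gradient O u (gradient O u).
Proof. by move=> gu; apply: (@xgetPex _ (cst 0) [set g | is_gradient O u g]); exists g. Qed.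

Lemma gradient_ae O u g : open O -> is_gradient O u g ->
  {ae mu, forall x, O x -> gradient O u x = g x}.
Proof. by move=> oO gu; exact: gradient_ae_unique oO (is_gradient_gradient gu) gu. Qed.

Lemma coord_le_enorm (x : 'rV[R]_n) i : `|x ord0 i| <= enorm x.
Proof.
rewrite -sqrtr_sqr ler_wsqrtr// (bigD1 i)//= lerDl.
by apply: sumr_ge0 => j _; exact: sqr_ge0.
Qed.

Lemma enormZ (a : R) (x : 'rV[R]_n) : enorm (a *: x) = `|a| * enorm x.
Proof.
rewrite /enorm -sqrtr_sqr -sqrtrM ?sqr_ge0// mulr_sumr.
by congr (Num.sqrt _); apply: eq_bigr => j _; rewrite mxE exprMn.
Qed.

Lemma enorm_ge0 (x : 'rV[R]_n) : 0 <= enorm x. Proof. exact: sqrtr_ge0. Qed.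

Lemma Lp_norm_oo_leP O (f : 'rV[R]_n -> R) (M : R) : 0 <= M ->
  (Lp_norm O +oo f <= M%:E)%E <-> {ae mu, forall x, O x -> `|f x| <= M}.
Proof.
move=> M0; have E : {ae mu, forall x, O x -> `|f x| <= M} <->
    (\forall x \ae mu, ((abse \o (EFin \o f \_ O)) x <= M%:E)%E).
  split; apply: filterS => x /=; rewrite lee_fin /patch.
    by case: ifPn => [|_ _]; rewrite ?normr0// inE => Ox; exact.
  by move=> + Ox; rewrite mem_set.
(* The norm is 0 by convention if the whole space is negligible; then every property holds almost
   everywhere. *)
rewrite /Lp_norm unlock E; case: ifPn => muT; first by split => /ess_supP.
split=> [_|_]; last by rewrite lee_fin.
have muT0 : mu setT = 0%E by apply/eqP; rewrite eq_le measure_ge0 andbT leNgt.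
by exists setT; split => //; exact: measurableT.
Qed.

Lemma Lp_norm_ge0 O p (f : 'rV[R]_n -> R) : (0 <= Lp_norm O p f)%E.
Proof. exact: Lnorm_ge0. Qed.

End gradient_theory.

Section representatives.
Context {R : realType} {n : nat}.
Implicit Types (O : set 'rV[R]_n) (u : 'rV[R]_n -> R) (g : 'rV[R]_n -> 'rV[R]_n).
Local Notation mu := (@lebesgue_rV R n).
Local Notation r := (@dyad R).

Lemma mu_dyad_cube k (a : 'rV[R]_n) : mu (cbx a (a + const_mx (r k))) = (r k ^+ n)%:E.
Proof.
rewrite [LHS]mu_cbx mu_bx; last by move=> j; rewrite !mxE lerDl ltW// dyad_gt0.
congr EFin; rewrite (eq_bigr (fun=> r k)) ?prodr_const ?card_ord// => j _.
by rewrite !mxE addrAC subrr add0r.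
Qed.

(** Morrey's inequality with rho = 1/2, for which rho^k is the side of the cube: a Hölder estimate
    of exponent 1, that is, a local Lipschitz bound. *)
Lemma bounded_gradient_rep (L : R) : 0 <= L -> exists2 Lam : R, 0 <= Lam &
  forall O u g, open O -> locally_L1 O u -> is_gradient O u g ->
  (forall i, {ae mu, forall x, O x -> `|g x ord0 i| <= L}) ->
  exists ut : 'rV[R]_n -> R, [/\ {ae mu, forall x, O x -> u x = ut x},
    forall x, O x -> {for x, continuous ut} &
    forall k (x y : 'rV[R]_n),
      (forall z : 'rV[R]_n, (forall j, `|z ord0 j - x ord0 j| <= 2 * r k) -> O z) ->
      (forall j, `|y ord0 j - x ord0 j| <= r k.+1) -> `|ut y - ut x| <= Lam * r k].
Proof.
move=> L0; have rho01 : 0 < (2^-1 : R) < 1 by apply/andP; split; lra.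
have [M HM] := @morrey R n L 2^-1 L0 rho01.
exists `|M| => // O u g oO lu gu gL.
have [|ut [uut cut utM]] := HM O u g oO lu gu.
  move=> k a i QO; rewrite -/(r k) mulrAC ler_wpM2r//; first by rewrite ltW// dyad_gt0.
  have mQ := @measurable_cbx R n a (a + const_mx (r k)).
  have ig := integrable_cbx oO (gu.1 i) QO.
  have fM : fine (mu (cbx a (a + const_mx (r k)))) = r k ^+ n by rewrite [X in fine X]mu_dyad_cube.
  rewrite -fM -[leLHS]ger0_norm; last by apply: Rintegral_ge0 => x _.
  apply: ae_Rintegral_bound => //.
  - by rewrite [X in (X < _)%E]mu_dyad_cube ltry.
  - exact: integrable_norm.
  - by apply: filterS (gL i) => x gx /QO Ox; rewrite normr_id gx.
exists ut; split => // k x y xO xy; apply: le_trans (utM k x y xO xy) _.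
by rewrite ler_wpM2r ?ler_norm// ltW// dyad_gt0.
Qed.

(** Either t <= lam, or t = lam (t/lam) <= lam (t/lam)^p. Integrated over a cube, with [lam] fitted
    to its side, it plays the part of Hölder's inequality. *)
Lemma ler_young (p lam t : R) : 1 <= p -> 0 < lam -> 0 <= t ->
  t <= lam + lam * lam `^ (- p) * t `^ p.
Proof.
move=> p1 lam0 t0; have lam0' := ltW lam0; have [tl|tl] := leP t lam.
  by rewrite (le_trans tl)// lerDl !mulr_ge0 ?powR_ge0.
apply: (@le_trans _ _ (lam * lam `^ (- p) * t `^ p)); last by rewrite lerDr.
have -> : lam * lam `^ (- p) * t `^ p = lam * (t / lam) `^ p.
  rewrite powRM ?invr_ge0// -mulrA; congr (_ * _); rewrite mulrC; congr (_ * _).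
  by rewrite -powR_inv1// -powRrM mulN1r.
rewrite -[leLHS](divfK (lt0r_neq0 lam0)) mulrC ler_pM2l//.
have s1 : 1 <= t / lam by rewrite ler_pdivlMr// mul1r ltW.
rewrite -[leLHS]powRr1; last by rewrite (le_trans _ s1).
exact: ler_powR.
Qed.

Lemma measurable_enorm g : (forall i, measurable_fun setT (fun x => g x ord0 i)) ->
  measurable_fun setT (enorm \o g).
Proof.
move=> mg; have ms := continuous_measurable_fun (@sqrt_continuous R).
rewrite (_ : _ \o _ = Num.sqrt \o (fun x => \sum_i g x ord0 i ^+ 2))//.
apply: (measurableT_comp ms).
by apply: measurable_sum => i; apply: measurable_funX.
Qed.

(* [ler_young] is applied with lam = h^(-n/p), for which the two terms balance. *)
Lemma integral_dyad_cube_le g (p G : R) : 1 <= p -> 0 <= G ->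
  (forall i, measurable_fun setT (fun x => g x ord0 i)) ->
  (\int[mu]_x (enorm (g x) `^ p)%:E <= G%:E)%E ->
  forall k a i, \int[mu]_(x in cbx a (a + const_mx (r k))) `|g x ord0 i| * r k <=
    (1 + G) * ((2^-1 : R) `^ (1 - n%:R / p)) ^+ k * r k ^+ n.
Proof.
move=> p1 G0 mg gG k a i; set Q := cbx a _; set h := r k.
have h0 : 0 < h by exact: dyad_gt0.
have h0' := ltW h0.
have p0 : 0 < p by exact: lt_le_trans p1.
pose lam := h `^ (- (n%:R / p)); have lam0 : 0 < lam by exact: powR_gt0.
have lam0' := ltW lam0.
have lamp : lam `^ (- p) = h ^+ n.
  rewrite /lam -powRrM -powR_mulrn//; congr (_ `^ _); field; exact: lt0r_neq0.
have mQ : measurable Q by exact: measurable_cbx.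
have me : measurable_fun setT (fun x => enorm (g x) `^ p).
  by apply: (measurableT_comp (measurable_powR p)); exact: measurable_enorm.
have bound : (\int[mu]_(x in Q) `|g x ord0 i|%:E <= (lam * h ^+ n + lam * h ^+ n * G)%:E)%E.
  apply: (@le_trans _ _ (\int[mu]_(x in Q) (lam%:E + (lam * h ^+ n)%:E * (enorm (g x) `^ p)%:E))%E).
    apply: ge0_le_integral => //.
    - by apply/measurable_EFinP; apply: measurableT_comp => //; exact: measurable_funS (mg i).
    - by apply/measurable_EFinP; apply: measurable_funD => //; apply: measurable_funM => //; exact: measurable_funS me.
    move=> x _; rewrite -EFinM -EFinD lee_fin -lamp.
    by apply: (le_trans (coord_le_enorm _ _)); apply: ler_young => //; exact: enorm_ge0.
  rewrite ge0_integralD//; last 2 first.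
  - by move=> x _; rewrite -EFinM lee_fin !mulr_ge0 ?powR_ge0// ?exprn_ge0.
  - by apply/measurable_EFinP; apply: measurable_funM => //; exact: measurable_funS me.
  rewrite integral_cst// [X in (_ * X + _)%E]mu_dyad_cube EFinD leeD//.
  rewrite ge0_integralZl_EFin//; last 3 first.
  - by move=> x _; rewrite lee_fin powR_ge0.
  - by apply/measurable_EFinP; exact: measurable_funS me.
  - by rewrite !mulr_ge0 ?exprn_ge0.
  rewrite [leRHS]EFinM; apply: lee_wpmul2l; first by rewrite lee_fin mulr_ge0 ?exprn_ge0.
  apply: le_trans gG; apply: ge0_subset_integral => //.
  - exact/measurable_EFinP.
  - by move=> x _; rewrite lee_fin powR_ge0.
(* lam h = h^(1 - n/p) with h = 2^-k; the exponent 1 - n/p is positive exactly when p > n. *)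
have lamh : lam * h = ((2^-1 : R) `^ (1 - n%:R / p)) ^+ k.
  rewrite /lam -[in X in _ * X](powRr1 (ltW h0)) -powRD; last by rewrite (lt0r_neq0 h0) implybT.
  by rewrite addrC /h /dyad -[RHS]powR_mulrn ?powR_ge0// powRAC powR_mulrn.
rewrite -lamh.
have : \int[mu]_(x in Q) `|g x ord0 i| <= lam * h ^+ n + lam * h ^+ n * G.
  rewrite -lee_fin /Rintegral fineK//.
  by rewrite ge0_fin_numE ?(le_lt_trans bound) ?ltry// integral_ge0.
move=> H; apply: le_trans (ler_wpM2r (ltW h0) H) _.
by rewrite le_eqVlt; apply/orP; left; apply/eqP; ring.
Qed.

Lemma Lp_norm_setT_le (p G : R) (f : 'rV[R]_n -> R) : 0 < p -> 0 <= G ->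
  (forall x, 0 <= f x) -> (Lp_norm setT p%:E f <= G%:E)%E ->
  (\int[mu]_x (f x `^ p)%:E <= (G `^ p)%:E)%E.
Proof.
move=> p0 G0 f0 fG; have H := @powR_Lnorm _ _ _ mu (EFin \o (f \_ setT)) p (lt0r_neq0 p0).
apply: (@le_trans _ _ (Lp_norm setT p%:E f `^ p)%E).
  rewrite /Lp_norm H le_eqVlt; apply/orP; left; apply/eqP; apply: eq_integral => x _.
  by rewrite /= patchT ?in_setT// ger0_norm.
rewrite -poweR_EFin; apply: gt0_ler_poweR => //; first exact: ltW.
- by rewrite in_itv/= Lp_norm_ge0 leey.
- by rewrite in_itv/= lee_fin G0 leey.
Qed.

(** For finite [q], rho = 2^-(1 - n/q) is below 1 because q > n; for q = +oo the gradient is bounded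
    and rho = 1/2. [M] and [rho] are fixed before [w]. *)
Lemma sobolev_rep (q : \bar R) (G : R) : (0 < n)%N -> (n%:R%:E < q)%E -> 0 <= G ->
  exists (M rho : R), 0 < rho < 1 /\ forall w, locally_L1 setT w ->
    is_gradient setT w (gradient setT w) ->
    (Lp_norm setT q (enorm \o gradient setT w) <= G%:E)%E ->
    exists wt, [/\ {ae mu, forall x, w x = wt x}, continuous wt &
      forall k (x y : 'rV[R]_n), (forall j, `|y ord0 j - x ord0 j| <= r k.+1) ->
        `|wt y - wt x| <= M * rho ^+ k].
Proof.
move=> n0; case: q => [p| |]// np G0.
  rewrite lte_fin in np.
  have p1 : 1 <= p by rewrite (le_trans _ (ltW np))// ler1n.
  have p0 : 0 < p by exact: lt_le_trans p1.
  pose rho := (2^-1 : R) `^ (1 - n%:R / p).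
  have rho01 : 0 < rho < 1.
    rewrite powR_gt0//= /rho -[ltRHS](congr1 (fun f => f (1 - n%:R / p)) (@powR1 R)).
    by apply: gt0_ltr_powR; rewrite ?nnegrE ?subr_gt0 ?ltr_pdivrMr ?mul1r//; lra.
  have [|M HM] := @morrey R n (1 + G `^ p) rho _ rho01; first by rewrite addr_ge0 ?powR_ge0.
  exists M, rho; split=> // w lw gw /Lp_norm_setT_le wG.
  have [|wt [wwt cwt wtM]] := HM setT w _ openT lw gw.
    move=> k a i _; apply: integral_dyad_cube_le => //; rewrite ?powR_ge0//.
      by move=> j; exact: (gw.1 j).1.
    by apply: wG => // x; exact: enorm_ge0.
  exists wt; split; first by apply: filterS wwt => x; exact.
    by move=> x; exact: cwt.
  by move=> k x y xy; apply: wtM.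
have [M M0 HM] := bounded_gradient_rep G0.
exists M, 2^-1; split; first by apply/andP; split; lra.
move=> w lw gw /(Lp_norm_oo_leP _ _ G0) wG.
have [|wt [wwt cwt wtM]] := HM setT w _ openT lw gw.
  move=> i; apply: filterS wG => x /(_ I) wG _; apply: le_trans wG.
  by rewrite [leRHS]ger0_norm ?enorm_ge0// coord_le_enorm.
exists wt; split; first by apply: filterS wwt => x; exact.
  by move=> x; exact: cwt.
by move=> k x y xy; apply: wtM.
Qed.

(** If [f] and [h] differ at a point of [O], they differ on a small cube there, whose measure is
    positive. *)
Lemma continuous_ae_eq O (f h : 'rV[R]_n -> R) : open O ->
  (forall x, O x -> {for x, continuous f}) -> (forall x, O x -> {for x, continuous h}) ->
  {ae mu, forall x, O x -> f x = h x} -> forall x, O x -> f x = h x.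
Proof.
move=> oO cf ch fh x Ox; apply/eqP; rewrite -subr_eq0; apply/negPn/negP => fhx.
have Fx := nbhs_filter x.
have cfh : {for x, continuous (fun y => f y - h y)} by apply: cvgB; [exact: cf|exact: ch].
have : \forall y \near x, O y /\ f y - h y != 0.
  apply: filterI; first exact: open_nbhs_nbhs.
  have : nbhs (f x - h x) [set t : R | t != 0] by exact: open_nbhs_nbhs.
  exact: cfh.
move=> /nbhs_ballP[e /= e0 He]; have [N [mN N0 fhN]] := fh.
have [k ke] := dyad_small e0.
have QN : cbx x (x + const_mx (r k)) `<=` N.
  move=> y /cbxP xy; apply: fhN => /= H; have [|Oy /eqP] := He y; last by rewrite H// subrr.
  split=> // i j; rewrite (ord1 i) /ball/= distrC.
  have := xy j; rewrite !mxE => /andP[y1 y2].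
  by rewrite ger0_norm ?subr_ge0// ltrBlDl (le_lt_trans y2)// ltrD2l.
have : (mu (cbx x (x + const_mx (r k))) <= mu N)%E.
  by apply: le_measure; rewrite ?inE//; exact: measurable_cbx.
rewrite [X in (X <= _)%E]mu_dyad_cube [X in (_ <= X)%E]N0 lee_fin leNgt.
by rewrite exprn_gt0// dyad_gt0.
Qed.

End representatives.

(** * Oscillation of functions with bounded gradient *)

Section bump.
Variable R : realType.
Implicit Types a b t L : R.

(* Any smooth bounded function with bounded derivatives and a strict global
   minimum at 0 that it does not approach at infinity would do. *)
Definition well t : R := t ^+ 2 / (1 + t ^+ 2).
Definition well' t : R := 2 * t / (1 + t ^+ 2) ^+ 2.

Let D_gt0 t : 0 < 1 + t ^+ 2. Proof. by rewrite ltr_wpDr// sqr_ge0. Qed.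

Lemma well_ge0 t : 0 <= well t.
Proof. by rewrite divr_ge0 ?sqr_ge0// ltW. Qed.

Lemma well_le1 t : well t <= 1.
Proof. by rewrite ler_pdivrMr// mul1r lerDr. Qed.

Lemma well_lt2 t : well t < 2^-1 -> `|t| < 1.
Proof.
rewrite /well ltr_pdivrMr// => H; have H2 : t ^+ 2 < 1 by lra.
by rewrite ltr_norml; apply/andP; split; nra.
Qed.

Lemma well'_le1 t : `|well' t| <= 1.
Proof.
rewrite normrM normfV [`|_ ^+ 2|]ger0_norm ?sqr_ge0//.
rewrite ler_pdivrMr ?exprn_gt0// mul1r ler_norml.
have := sqr_ge0 t; have := sqr_ge0 (1 - t); have := sqr_ge0 (1 + t).
have : 1 + t ^+ 2 <= (1 + t ^+ 2) ^+ 2.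
  by apply: ler_eXnr; rewrite // lerDl sqr_ge0.
by move=> *; apply/andP; split; lra.
Qed.

Lemma well_taylor a b : `|well b - well a - well' a * (b - a)| <= 4 * (b - a) ^+ 2.
Proof.
have A0 := D_gt0 a; have B0 := D_gt0 b; rewrite /well /well'.
(* The remainder has the factor (b - a)^2 in closed form; it remains to see that the other factor is
   at most 4 in absolute value. *)
have -> : b ^+ 2 / (1 + b ^+ 2) - a ^+ 2 / (1 + a ^+ 2) - 2 * a / (1 + a ^+ 2) ^+ 2 * (b - a) =
   (b - a) ^+ 2 * ((1 - a ^+ 2 - 2 * a * b) / ((1 + a ^+ 2) ^+ 2 * (1 + b ^+ 2))).
  by field; rewrite !lt0r_neq0.
have P0 : 0 < (1 + a ^+ 2) ^+ 2 * (1 + b ^+ 2) by rewrite mulr_gt0// exprn_gt0.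
rewrite normrM ger0_norm ?sqr_ge0// mulrC ler_wpM2r ?sqr_ge0//.
rewrite normrM normfV (gtr0_norm P0) ler_pdivrMr//.
have A1 : 1 <= 1 + a ^+ 2 by rewrite lerDl sqr_ge0.
have B1 : 1 <= 1 + b ^+ 2 by rewrite lerDl sqr_ge0.
have H1 : 1 + a ^+ 2 <= (1 + a ^+ 2) ^+ 2 * (1 + b ^+ 2).
  by rewrite expr2 -mulrA; apply: ler_peMr; [exact: ltW|exact: mulr_ege1].
have H2 : 1 + b ^+ 2 <= (1 + a ^+ 2) ^+ 2 * (1 + b ^+ 2).
  by apply: ler_peMl; [exact: ltW|exact: exprn_ege1].
have := sqr_ge0 (a + b); have := sqr_ge0 (a - b); have := sqr_ge0 a; have := sqr_ge0 b.
by rewrite ler_norml => *; apply/andP; split; lra.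
Qed.

Lemma well'_lipschitz a b : `|well' b - well' a| <= 8 * `|b - a|.
Proof.
have A0 := D_gt0 a; have B0 := D_gt0 b; rewrite /well'.
have -> : 2 * b / (1 + b ^+ 2) ^+ 2 - 2 * a / (1 + a ^+ 2) ^+ 2 =
   (1 - 2 * (a * b) - a * b * (a ^+ 2 + a * b + b ^+ 2)) /
   ((1 + a ^+ 2) * (1 + b ^+ 2)) ^+ 2 * (2 * (b - a)).
  by field; rewrite !lt0r_neq0.
have P0 : 0 < (1 + a ^+ 2) * (1 + b ^+ 2) by rewrite mulr_gt0.
have -> : 8 * `|b - a| = 4 * `|2 * (b - a)| by rewrite normrM ger0_norm//; ring.
rewrite normrM ler_wpM2r//.
rewrite normrM normfV [`|_ ^+ 2|]gtr0_norm ?exprn_gt0// ler_pdivrMr ?exprn_gt0//.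
(* Numerator and denominator depend on [s] and [m] alone, with P = 1 + s + m^2 and 2 |m| <= s. *)
set s := a ^+ 2 + b ^+ 2; set m := a * b; set P := (1 + a ^+ 2) * (1 + b ^+ 2).
have PE : P = 1 + s + m ^+ 2 by rewrite /P /s /m; ring.
have sm : 2 * `|m| <= s.
  have := sqr_ge0 (a + b); have := sqr_ge0 (a - b); rewrite /s /m.
  by case: (ger0P (a * b)) => ? *; lra.
have -> : a ^+ 2 + m + b ^+ 2 = s + m by rewrite /s; ring.
have := sqr_ge0 m; move: (normr_ge0 m) (ler_norm m) (ler_norm (- m)); rewrite normrN => h1 h2 h3 h4.
have sP : s <= P by lra.
have P1 : 1 <= P by lra.
have P2 : P <= P ^+ 2 by rewrite expr2 ler_peMr// (le_trans _ P1).
have s0 : 0 <= s by lra.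
have sP2 : s ^+ 2 <= P ^+ 2 by rewrite ler_sqr ?nnegrE// (le_trans s0).
have mm : `|m * (s + m)| <= s ^+ 2.
  rewrite normrM expr2 (_ : s * s = s / 2 * (2 * s)); last by field.
  apply: ler_pM => //; first lra.
  by rewrite ler_norml; apply/andP; split; lra.
move: mm; rewrite !ler_norml => /andP[? ?]; apply/andP; split; lra.
Qed.

End bump.

(** * Chaining in bounded connected sets *)

Section chaining.
Context {R : realType} {n : nat}.
Implicit Types (O : set 'rV[R]_n).

(* Points of [O] in the same cell of a grid of mesh [d] are [d]-close. Linking two
   cells when they contain [d]-close points of [O] gives a connected graph, whose
   paths need not visit a cell twice. *)
Lemma chaining O (d : R) : connected O -> bounded_set O -> 0 < d ->
  exists N : nat, forall (f : 'rV[R]_n -> R) (L : R), 0 <= L ->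
    (forall x y, O x -> O y -> (forall j, `|y ord0 j - x ord0 j| <= d) -> `|f y - f x| <= L) ->
    forall x y, O x -> O y -> `|f y - f x| <= N%:R * L.
Proof.
move=> cO bO d0.
have [M M0 OM] : exists2 M : R, 0 <= M & forall x, O x -> forall j, `|x ord0 j| <= M.
  have [M [_ HM]] := bO; exists (`|M| + 1); first by rewrite addr_ge0.
  move=> x Ox j; apply: le_trans (rV_coord_le_norm _ _) _.
  by apply: HM => //; rewrite (le_lt_trans (ler_norm _))// ltrDl.
pose K := Num.truncn (2 * M / d).
pose cell (x : 'rV[R]_n) (j : 'I_n) := Num.truncn ((x ord0 j + M) / d).
have cell_le x j : O x -> (cell x j < K.+1)%N.
  move=> Ox; rewrite ltnS /cell /K; apply: le_truncn.
  rewrite ler_pM2r ?invr_gt0//; have := OM x Ox j; rewrite ler_norml => /andP[_ ?]; lra.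
pose c (x : 'rV[R]_n) : {ffun 'I_n -> 'I_K.+1} := [ffun j => inord (cell x j)].
have same x y : O x -> O y -> c x = c y -> forall j, `|y ord0 j - x ord0 j| <= d.
  move=> Ox Oy cxy j.
  have E : cell x j = cell y j.
    have := congr1 (fun h : {ffun _ -> _} => nat_of_ord (h j)) cxy.
    by rewrite /c !ffunE !inordK ?cell_le.
  have ge0 z : O z -> 0 <= (z ord0 j + M) / d.
    move=> Oz; apply: divr_ge0; last exact: ltW.
    by have := OM z Oz j; rewrite ler_norml => /andP[? _]; lra.
  have /andP[x1 x2] := truncn_itv (ge0 x Ox); have /andP[y1 y2] := truncn_itv (ge0 y Oy).
  move: x1 x2 y1 y2; rewrite -!/(cell _ j) E ler_pdivlMr// ltr_pdivrMr// ler_pdivlMr// ltr_pdivrMr//.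
  rewrite -[(cell y j).+1]addn1 natrD mulrDl mul1r => *.
  by rewrite ler_norml; apply/andP; split; lra.
pose near_ (x y : 'rV[R]_n) := forall j, `|y ord0 j - x ord0 j| <= d.
pose e : rel {ffun 'I_n -> 'I_K.+1} := fun a b =>
  `[< exists x y, [/\ O x, O y, c x = a, c y = b & near_ x y] >].
have connO x y : O x -> O y -> connect e (c x) (c y).
  move=> Ox Oy; pose S := [set z | O z /\ connect e (c x) (c z)].
  suff SO : S = O by have [] : S y by rewrite SO.
  have ball_near z t : ball z d t -> near_ z t /\ near_ t z.
    move=> [_ zt]; split=> j; have := zt ord0 j; rewrite /ball /= => /ltW//.
    by rewrite distrC.
  have step z t : O z -> O t -> near_ z t -> connect e (c z) (c t).
    by move=> Oz Ot zt; apply: connect1; apply/asboolP; exists z, t.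
  apply: cO.
  - by exists x; split.
  - exists (\bigcup_(z in S) ball z d); first by apply: bigcup_open => z _; exact: ball_open.
    apply/seteqP; split=> [z Sz|z [Oz [t [Ot xt] tz]]].
      by split; [have [] := Sz|exists z => //; exact: ballxx].
    split=> //; apply: connect_trans xt _; apply: step => //.
    by have [] := ball_near _ _ tz.
  - exists (~` \bigcup_(z in O `\` S) ball z d).
      by apply: open_closedC; apply: bigcup_open => z _; exact: ball_open.
    apply/seteqP; split=> [z Sz|z [Oz Nz]].
      split; first by have [] := Sz.
      move=> [t [Ot St] tz]; apply: St; split=> //; have [Oz xz] := Sz.
      by apply: connect_trans xz _; apply: step => //; have [] := ball_near _ _ tz.
    by apply: contrapT => Sz; apply: Nz; exists z => //; exact: ballxx.
(* A path with p links costs p jumps between cells and at most p + 1 jumps inside the cells it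
   visits, hence 2 p + 1 in all. *)
exists (2 * #|{ffun 'I_n -> 'I_K.+1}|).+1 => f L L0 fL x y Ox Oy.
have path_le p : forall a, path e a p -> forall x y, O x -> O y -> c x = a ->
    c y = last a p -> `|f y - f x| <= (2 * size p).+1%:R * L.
  elim: p => [a _ {Ox Oy}x {}y Ox Oy <- /= cyx|b p IH a /= /andP[/asboolP[z [t [Oz Ot za tb zt]]] bp]].
    by rewrite mul1r; apply: fL => //; exact: same.
  move=> {Ox Oy}x {}y Ox Oy xa cy.
  have h1 := fL x z Ox Oz (same x z Ox Oz (etrans xa (esym za))).
  have h2 := fL z t Oz Ot zt.
  have h3 := IH b bp t y Ot Oy tb cy.
  have -> : f y - f x = (f y - f t) + (f t - f z) + (f z - f x) by ring.
  have -> : (2 * (size p).+1).+1%:R * L = (2 * size p).+1%:R * L + L + L.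
    by rewrite -addrA -mulr2n -[L *+ 2]mulr_natl -mulrDl -natrD; congr (_%:R * _); lia.
  by rewrite (le_trans (ler_normD _ _))// lerD// (le_trans (ler_normD _ _))// lerD.
have /connectP[p0 + +] := connO x y Ox Oy.
move=> /shortenP[p pe up _] yE.
apply: le_trans (path_le p (c x) pe x y Ox Oy erefl yE) _.
have sp : (size (c x :: p) <= #|{ffun 'I_n -> 'I_K.+1}|)%N.
  by rewrite -(card_uniqP up) max_card.
by rewrite ler_wpM2r// ler_nat ltnS leq_mul2l/= (leq_trans _ sp)//=.
Qed.

End chaining.

(** * From the extension operator to the oscillation bound *)

Section extension.
Context {R : realType} {n : nat}.
Implicit Types (O : set 'rV[R]_n) (u w : 'rV[R]_n -> R) (g : 'rV[R]_n -> 'rV[R]_n).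
Local Notation mu := (@lebesgue_rV R n).
Local Notation r := (@dyad R).

Lemma well_continuous : continuous (@well R).
Proof.
move=> t; apply: cvgM; first exact: exprn_continuous.
apply: cvgV; first by rewrite lt0r_neq0// ltr_wpDr// sqr_ge0.
by apply: cvgD; [exact: cvg_cst|exact: exprn_continuous].
Qed.

Lemma well'_continuous : continuous (@well' R).
Proof.
move=> t; apply: cvgM; first by apply: cvgM; [exact: cvg_cst|exact: cvg_id].
have D0 : 0 < 1 + t ^+ 2 by rewrite ltr_wpDr// sqr_ge0.
apply: cvgV; first by rewrite lt0r_neq0// exprn_gt0.
apply: (@continuous_comp _ _ _ (fun t : R => 1 + t ^+ 2) (fun s => s ^+ 2)).
  by apply: cvgD; [exact: cvg_cst|exact: exprn_continuous].
exact: exprn_continuous.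
Qed.

Lemma chain_rule_well O u g (L Lam a l : R) : open O ->
  (forall x, O x -> {for x, continuous u}) -> is_gradient O u g ->
  (forall i, {ae mu, forall x, O x -> `|g x ord0 i| <= L}) -> 0 <= Lam ->
  (forall k (x y : 'rV[R]_n),
    (forall z : 'rV[R]_n, (forall j, `|z ord0 j - x ord0 j| <= 2 * r k) -> O z) ->
    (forall j, `|y ord0 j - x ord0 j| <= r k.+1) -> `|u y - u x| <= Lam * r k) ->
  0 <= l ->
  (forall x, O x -> {for x, continuous (fun x => well (l * (u x - a)))}) /\
  is_gradient O (fun x => well (l * (u x - a))) (fun x => (well' (l * (u x - a)) * l) *: g x).
Proof.
move=> oO cu gu gL Lam0 uLam l0.
have ca : continuous (fun t : R => l * (t - a)).
  move=> t; apply: cvgM; first exact: cvg_cst.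
  by apply: cvgB; [exact: cvg_id|exact: cvg_cst].
have cF : continuous (fun t : R => well (l * (t - a))).
  move=> t; apply: (@continuous_comp _ _ _ (fun t : R => l * (t - a)) (@well R)); first exact: ca.
  exact: well_continuous.
split; first by move=> x Ox; apply: (@continuous_comp _ _ _ u (fun t => well (l * (t - a)))); [exact: cu|exact: cF].
(* One constant must bound the function by 1, its derivative by l, the Taylor remainder by 4 l^2 and
   the Lipschitz constant of the derivative by 8 l^2. *)
have N1 : 1 <= 8 * (1 + l) ^+ 2 by nra.
have Nl : l <= 8 * (1 + l) ^+ 2 by nra.
have Nl2 : 8 * l ^+ 2 <= 8 * (1 + l) ^+ 2 by nra.
apply: (@chain_rule R n O u g oO cu gu L Lam gL Lam0 uLam (fun t => well (l * (t - a)))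
  (fun t => well' (l * (t - a)) * l) (8 * (1 + l) ^+ 2)) => //.
- move=> t; apply: cvgM; last exact: cvg_cst.
  apply: (@continuous_comp _ _ _ (fun t : R => l * (t - a)) (@well' R)); first exact: ca.
  exact: well'_continuous.
- by move=> t; rewrite ger0_norm ?well_ge0// (le_trans (well_le1 _)).
- move=> t; rewrite normrM (ger0_norm l0); apply: le_trans Nl.
  by rewrite ler_piMl// well'_le1.
- move=> s t; have -> : well' (l * (s - a)) * l * (t - s) =
    well' (l * (s - a)) * (l * (t - a) - l * (s - a)) by ring.
  apply: (le_trans (well_taylor _ _)).
  have -> : l * (t - a) - l * (s - a) = l * (t - s) by ring.
  rewrite exprMn mulrA ler_wpM2r ?sqr_ge0//; apply: le_trans Nl2.
  by rewrite ler_wpM2r ?sqr_ge0// ler_nat.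
- move=> s t; rewrite -mulrBl normrM (ger0_norm l0) mulrC.
  apply: (le_trans (ler_wpM2l l0 (well'_lipschitz _ _))).
  have -> : l * (t - a) - l * (s - a) = l * (t - s) by ring.
  rewrite normrM (ger0_norm l0) mulrCA !mulrA ler_wpM2r//.
  by rewrite -!mulrA.
Qed.

Lemma Lp_gradient_le_W1p q w : (0 < q)%E -> measurable_fun setT w ->
  is_gradient setT w (gradient setT w) ->
  (Lp_norm setT q (enorm \o gradient setT w) <= fs_norm (W1p q setT) w)%E.
Proof.
case: q => [p| |]// p0 mw gw /=.
  rewrite lte_fin in p0; rewrite /Lp_norm unlock.
  have mg : measurable_fun setT (fun x => enorm (gradient setT w x) `^ p).
    apply: (measurableT_comp (measurable_powR p)).
    by apply: measurable_enorm => i; exact: (gw.1 i).1.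
  apply: gt0_ler_poweR; rewrite ?invr_ge0 ?(ltW p0)//.
  - by rewrite in_itv/= leey andbT integral_ge0// => x _; exact: poweR_ge0.
  - by rewrite in_itv/= leey andbT integral_ge0// => x _; rewrite lee_fin addr_ge0 ?powR_ge0.
  rewrite (eq_integral (fun x => (enorm (gradient setT w x) `^ p)%:E)); last first.
    by move=> x _; rewrite /= patchT ?in_setT// ger0_norm ?enorm_ge0.
  apply: ge0_le_integral => //.
  - by move=> x _; rewrite lee_fin powR_ge0.
  - exact/measurable_EFinP.
  - apply/measurable_EFinP; apply: measurable_funD => //.
    by apply: (measurableT_comp (measurable_powR p)); exact: measurableT_comp.
  - by move=> x _; rewrite lee_fin lerDr powR_ge0.
rewrite /Lp_norm unlock; case: ifP => // _; apply: le_ess_sup; apply: aeW => x.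
rewrite /= !patchT ?in_setT// lee_fin ger0_norm ?enorm_ge0//.
by rewrite ger0_norm ?lerDr ?addr_ge0 ?enorm_ge0.
Qed.

Variables (q : \bar R) (Omega : set 'rV[R]_n) (E : ('rV[R]_n -> R) -> 'rV[R]_n -> R) (C : R).
Hypotheses (n0 : (0 < n)%N) (nq : (n%:R%:E < q)%E) (oO : open Omega) (C0 : 0 < C).
Hypothesis HE : forall u, fs_mem (W1p +oo%E Omega) u ->
  [/\ fs_mem (W1p q setT) (E u), E u = u %[ae mu in Omega] &
      (fs_norm (W1p q setT) (E u) <= C%:E * fs_norm (W1p +oo%E Omega) u)%E].

(** The scale [k] is fixed by [C], [q] and [n] before [u] is given. [Lam] makes the chain rule
    applicable and does not enter [k]. *)
Lemma local_oscillation : exists k, forall u g (Lam L : R),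
  (forall x, Omega x -> {for x, continuous u}) -> is_gradient Omega u g -> 0 <= Lam ->
  (forall k (x y : 'rV[R]_n),
    (forall z : 'rV[R]_n, (forall j, `|z ord0 j - x ord0 j| <= 2 * r k) -> Omega z) ->
    (forall j, `|y ord0 j - x ord0 j| <= r k.+1) -> `|u y - u x| <= Lam * r k) ->
  0 < L -> {ae mu, forall x, Omega x -> enorm (g x) <= L} ->
  forall x y : 'rV[R]_n, Omega x -> Omega y ->
    (forall j, `|y ord0 j - x ord0 j| <= r k.+1) -> `|u y - u x| <= L.
Proof.
have C20 : 0 <= C * 2 by rewrite mulr_ge0 ?ltW.
(* The composed function [v] will have W^{1,oo} norm at most 2, so C * 2 bounds the W^{1,q} norm of
   its extension. *)
have [M [rho [/andP[rho0 rho1] HM]]] := sobolev_rep n0 nq C20.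
have [k kM] : exists k, M * rho ^+ k < 2^-1.
  have : M * rho ^+ k @[k --> \oo] --> M * 0.
    by apply: cvgM; [exact: cvg_cst|apply: cvg_expr; rewrite gtr0_norm].
  rewrite mulr0 => /cvgrPdist_lt/(_ 2^-1)[|k _ /(_ k (leqnn k))]; first by rewrite invr_gt0.
  by rewrite /= sub0r normrN => kM; exists k; rewrite (le_lt_trans (ler_norm _)).
exists k => u g Lam L cu gu Lam0 uLam L0 gL x y Ox Oy xy.
have gL' i : {ae mu, forall x, Omega x -> `|g x ord0 i| <= L}.
  by apply: filterS gL => z gL Oz; rewrite (le_trans (coord_le_enorm _ _)) ?gL.
have Li0 : 0 <= L^-1 by rewrite invr_ge0 ltW.
have [cv gv] := chain_rule_well (u x) oO cu gu gL' Lam0 uLam Li0.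
set v := (fun x : 'rV[R]_n => well _) in cv gv; set g' := (fun x : 'rV[R]_n => _ *: _) in gv.
have lv : locally_L1 Omega v by exact: continuous_locally_L1.
have v1 z : `|v z| <= 1 by rewrite ger0_norm ?well_ge0 ?well_le1.
have g'1 : {ae mu, forall x, Omega x -> enorm (g' x) <= 1}.
  apply: filterS gL => z gL Oz; rewrite /g' enormZ normrM -mulrA.
  rewrite -[leRHS]mulr1; apply: ler_pM; rewrite ?mulr_ge0 ?enorm_ge0 ?well'_le1//.
  by rewrite (ger0_norm Li0) mulrC ler_pdivrMr// mul1r gL.
have vW : fs_mem (W1p +oo%E Omega) v.
  split; last first.
    by apply: (@le_lt_trans _ _ 1%:E); rewrite ?ltry//; apply/Lp_norm_oo_leP => //; exact: aeW.
  split=> //; exists g' => //; apply: (@le_lt_trans _ _ 1%:E); rewrite ?ltry//.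
  apply/Lp_norm_oo_leP => //; apply: filterS g'1 => z + Oz => /(_ Oz).
  by rewrite /= ger0_norm ?enorm_ge0.
have vn : (fs_norm (W1p +oo%E Omega) v <= 2%:E)%E.
  apply/Lp_norm_oo_leP => //; apply: filterS2 g'1 (gradient_ae oO gv) => z g1 gE Oz.
  rewrite gE// ger0_norm ?addr_ge0 ?enorm_ge0// -[2]/(1 + 1).
  by rewrite lerD ?g1.
have [[[lE [gE gEP _]] _] Ev En] := HE vW.
have gEw := is_gradient_gradient gEP.
have q0 : (0 < q)%E by apply: le_lt_trans nq; rewrite lee_fin.
have EG : (Lp_norm setT q (enorm \o gradient setT (E v)) <= (C * 2)%:E)%E.
  apply: (le_trans (Lp_gradient_le_W1p q0 lE.1 gEw)); apply: (le_trans En).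
  by rewrite EFinM lee_wpmul2l// lee_fin ltW.
have [wt [wwt cwt wtM]] := HM _ lE gEw EG.
(* Agreement almost everywhere is not enough, as the two functions are compared at the given points
   [x] and [y]; continuity makes it hold everywhere on [Omega]. *)
have vwt : forall z, Omega z -> v z = wt z.
  apply: continuous_ae_eq => //; first by move=> z _; exact: cwt.
  by apply: filterS2 wwt Ev => z <- Ev Oz; rewrite Ev.
have := wtM k x y xy; rewrite -!vwt// => H.
(* As [v] vanishes at [x], v y is at most M rho^k < 1/2, and [well] is below 1/2 only on ]-1, 1[. *)
have vx : v x = 0 by rewrite /v subrr mulr0 /well expr0n/= mul0r.
have : `|L^-1 * (u y - u x)| < 1.
  apply: well_lt2; apply: le_lt_trans kM; apply: le_trans H.
  by rewrite vx subr0 ler_norm.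
by rewrite normrM (ger0_norm Li0) mulrC ltr_pdivrMr// mul1r => /ltW.
Qed.

Lemma L1oo_normP O u : open O -> fs_mem (L1p +oo%E O) u ->
  exists2 l, 0 <= l & [/\ fs_norm (L1p +oo%E O) u = l%:E, locally_L1 O u,
    is_gradient O u (gradient O u) &
    {ae mu, forall x, O x -> enorm (gradient O u x) <= l}].
Proof.
move=> oO' [lu [g gu goo]]; have gE := gradient_ae oO' gu.
have [m m0 mE] : exists2 m : R, 0 <= m & Lp_norm O +oo%E (enorm \o g) = m%:E.
  have := Lp_norm_ge0 O +oo%E (enorm \o g); move: goo.
  by case: (Lp_norm _ _ _) => // m _; exists m.
have Goo : (Lp_norm O +oo%E (enorm \o gradient O u) <= m%:E)%E.
  apply/Lp_norm_oo_leP => //.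
  have /(Lp_norm_oo_leP _ _ m0) : (Lp_norm O +oo%E (enorm \o g) <= m%:E)%E by rewrite mE.
  by apply: filterS2 gE => x gE H Ox; rewrite /= gE// H.
have [l l0 lE] : exists2 l : R, 0 <= l & Lp_norm O +oo%E (enorm \o gradient O u) = l%:E.
  have := Lp_norm_ge0 O +oo%E (enorm \o gradient O u); move: Goo.
  by case: (Lp_norm _ _ _) => // l _; exists l.
exists l => //; split=> //; first exact: is_gradient_gradient gu.
have /(Lp_norm_oo_leP _ _ l0) : (Lp_norm O +oo%E (enorm \o gradient O u) <= l%:E)%E by rewrite lE.
by apply: filterS => x + Ox => /(_ Ox); rewrite /= ger0_norm ?enorm_ge0.
Qed.

Lemma oscillation_bound : Omega !=set0 -> connected Omega -> bounded_set Omega ->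
  exists N : nat, forall u, fs_mem (L1p +oo%E Omega) u -> exists c,
    {ae mu, forall x, Omega x -> `|u x - c| <= N%:R * fine (fs_norm (L1p +oo%E Omega) u)}.
Proof.
move=> [x0 Ox0] cO bO; have [k kP] := local_oscillation.
have [N NP] := chaining cO bO (@dyad_gt0 R k.+1).
exists N => u uL; have [l l0 [-> lu gu gl]] := L1oo_normP oO uL.
have [Lam Lam0 H] := @bounded_gradient_rep R n l l0.
have [|ut [uut cut utLam]] := H Omega u _ oO lu gu.
  by move=> i; apply: filterS gl => x gl Ox; rewrite (le_trans (coord_le_enorm _ _)) ?gl.
have gut : is_gradient Omega ut (gradient Omega u).
  apply: (is_gradient_ae_eq oO lu.1 _ _ gu) => //.
  exact: measurable_continuous_rV.
have osc x y : Omega x -> Omega y -> `|ut y - ut x| <= N%:R * l.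
  (* [l] may be 0, whereas [local_oscillation] rescales by a positive bound; it is used with l + e
     for every e > 0. *)
  apply: NP => // {}x {}y Ox Oy xy; apply/ler_addgt0Pr => e e0.
  apply: (kP ut _ Lam (l + e) cut gut Lam0 utLam) => //; first by rewrite ltr_wpDl.
  by apply: filterS gl => z gl Oz; rewrite (le_trans (gl Oz))// lerDl ltW.
(* The constant is the value of the continuous representative at a point of [Omega]. *)
by exists (ut x0); apply: filterS uut => x uut Ox; rewrite uut//= osc.
Qed.

End extension.

(** The target seminorm sees only the gradient, so adding the constant back after the extension
    costs nothing, and the W^{1,q} norm of the extension of u - c bounds it. *)
Theorem proposition4p1 (R : realType) (n : nat) (q : \bar R)
    (Omega : set 'rV[R]_n) :
  (0 < n)%N -> (n%:R%:E < q)%E -> domain Omega -> bounded_set Omega ->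
  extension_domain (W1p +oo%E) (W1p q) Omega ->
  extension_domain (L1p +oo%E) (L1p q) Omega.
Proof.
move=> n0 nq [nzO oO cO] bO [E [C [C0 Ewd HE]]].
have [N NP] := oscillation_bound n0 nq oO C0 HE nzO cO bO.
have q0 : (0 < q)%E by apply: le_lt_trans nq; rewrite lee_fin.
pose S (u : 'rV[R]_n -> R) := [set c : R | {ae lebesgue_rV (n:=n), forall x, Omega x ->
  `|u x - c| <= N%:R * fine (fs_norm (L1p +oo%E Omega) u)}].
(* [S u], hence [c u], only depends on the almost everywhere class of [u]. *)
pose c u := xget 0 (S u).
have cP u : fs_mem (L1p +oo%E Omega) u -> {ae lebesgue_rV (n:=n), forall x, Omega x ->
    `|u x - c u| <= N%:R * fine (fs_norm (L1p +oo%E Omega) u)}.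
  by move=> /NP[d dP]; apply: (@xgetPex _ 0 (S u)); exists d.
have W u : fs_mem (L1p +oo%E Omega) u -> fs_mem (W1p +oo%E Omega) (fun x => u x - c u).
  move=> uL; have [lu [g gu goo]] := uL; have [l l0 [lE _ _ _]] := L1oo_normP oO uL.
  split; first split.
  - exact: (locally_L1D oO lu (locally_L1_cst (- c u) oO)).
  - by exists g => //; exact: is_gradientDcst.
  - have Nl : 0 <= N%:R * l by rewrite mulr_ge0.
    apply: (@le_lt_trans _ _ (N%:R * l)%:E); rewrite ?ltry//; apply/Lp_norm_oo_leP => //.
    by have := cP u uL; rewrite lE.
exists (fun u x => E (fun x => u x - c u) x + c u), (C * (N%:R + 1)); split.
- by rewrite mulr_gt0// ltr_wpDl.
- move=> u v uL vL uv.
  have Guv := gradient_ae_eq oO uL.1.1 vL.1.1 uv.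
  (* [gradient] takes the same value at [u] and at [v], so their seminorms agree and [S u] and [S v]
     are the same set, from which [xget] draws the same constant. *)
  have cuv : c u = c v.
    have nE : fs_norm (L1p +oo%E Omega) u = fs_norm (L1p +oo%E Omega) v by rewrite /= Guv.
    suff SE : S u = S v by rewrite /c SE.
    rewrite /S nE; apply/seteqP; split=> d; apply: filterS2 uv => x uv + Ox => /(_ Ox).
      by rewrite uv.
    by rewrite uv.
  have := Ewd _ _ (W u uL) (W v vL); rewrite -cuv => H.
  have {}H := H _; apply: filterS (H _) => [x Ex|]; first by rewrite Ex.
  by apply: filterS uv => x uv Ox; rewrite uv.
- move=> u uL; have [l l0 [lE lu gu gl]] := L1oo_normP oO uL.
  have [[[lEu [g gE goo]] _] Eu En] := HE _ (W u uL).
  have gEE := is_gradient_gradient gE.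
  split.
  + split; first exact: (locally_L1D openT lEu (locally_L1_cst (c u) openT)).
    by exists g => //; exact: is_gradientDcst (openT) lEu gE.
  + by apply: filterS Eu => x Eu Ox; rewrite Eu// subrK.
  + rewrite /= gradientDcst//; last exact: openT.
    apply: (le_trans (Lp_gradient_le_W1p q0 lEu.1 gEE)); apply: (le_trans En).
    have lE' : Lp_norm Omega +oo%E (enorm \o gradient Omega u) = l%:E := lE.
    rewrite lE' -EFinM -mulrA EFinM; apply: lee_wpmul2l; first by rewrite lee_fin ltW.
    have Nl : 0 <= (N%:R + 1) * l by rewrite mulr_ge0 ?addr_ge0.
    apply/Lp_norm_oo_leP => //; rewrite (gradientDcst (- c u) oO lu).
    have := cP u uL; rewrite lE; apply: filterS2 gl => x gl cu Ox.
    by rewrite ger0_norm ?addr_ge0 ?enorm_ge0// mulrDl mul1r lerD ?gl ?cu.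
Qed.
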